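(* Let $n\ge1$ be an integer, $M=\mathbb{T}\times[-1,1]$, and let $u_*(x,y)=(v(y),0)$ with $v\in C^{n+1}([-1,1])$ such that, for some $y_0\in(-1,1)$, $$\sum_{i=0}^{n-1}|v^{(i)}(y_0)|=0,\qquad v^{(n)}(y_0)\neq0.$$ Then for every $\varepsilon>0$ and every $\alpha\in(0,1)$ there exist non-shear solutions $u(t)$ of the Euler equations on $M$ of each of the following types: stationary; time periodic; and quasiperiodic in time with $N$ non-commensurate frequencies, for any prescribed number $N$; and each of them satisfies $\|u(t)-u_*\|_{C^{n-1,\alpha}(M)}<\varepsilon$ for all $t$.
   Context: The Euler equations on $M$ are $\partial_t u+u\cdot\nabla u=-\nabla p$, $\nabla\cdot u=0$ in $M$, $u\cdot\hat n=0$ on $\partial M$. A shear flow is a field of the form $(\tilde v(y),0)$; non-shear means not of this form. Time periodic means non-stationary and periodic in $t$. A solution is quasiperiodic with $N$ non-commensurate frequencies if $u(t)=V(\omega_1t,\dots,\omega_Nt)$ for some continuous $V$ on the $N$-torus with values in velocity fields and rationally independent $\omega_1,\dots,\omega_N$, where this cannot be done with fewer than $N$ frequencies. $C^{n-1,\alpha}$ is the usual Hölder space; the paper writes $C^{n-}$ for $C^{n-1,\alpha}$ with arbitrary $0<\alpha<1$. *)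

(* Defs.v *)
From HB Require Import structures.
From mathcomp Require Import all_boot all_order all_algebra.
From mathcomp Require Import all_classical all_reals all_analysis.

Set Implicit Arguments.
Unset Strict Implicit.
Unset Printing Implicit Defensive.

Import Order.TTheory GRing.Theory Num.Theory.
Import numFieldNormedType.Exports.

Local Open Scope classical_set_scope.
Local Open Scope ring_scope.

(* The torus T is R / 2 pi Z.  Functions on M = T x [-1, 1] are represented by
   functions on R * R that are 2 pi-periodic in the first variable; their
   values outside the closed strip R x [-1, 1] are irrelevant. *)
Definition strip (R : realType) : set (R * R) := [set p | -1 < p.2 < 1].
Definition cstrip (R : realType) : set (R * R) := [set p | -1 <= p.2 <= 1].

Definition x_periodic (R : realType) (W : Type) (f : R * R -> W) : Prop :=
  forall p, cstrip p -> f (p.1 + 2 * pi, p.2) = f p.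

(* C^k up to the boundary, for an open domain D: f is continuous on the
   closure of D, and the partial derivatives of order at most k (along the
   coordinate directions listed in [basis]) exist in D and extend continuously
   to the closure of D. *)
Fixpoint Ck_upto (R : realType) (E W : normedModType R) (basis : seq E)
    (D : set E) (k : nat) (f : E -> W) : Prop :=
  {within closure D, continuous f} /\
  (if k is k'.+1 then
     forall e, e \in basis ->
       (forall p, D p -> derivable f p e) /\
       (exists g : E -> W, Ck_upto basis D k' g /\
          (forall p, D p -> g p = 'D_e f p))
   else True).

Definition Ck_segment (R : realType) (k : nat) (v : R -> R) : Prop :=
  Ck_upto [:: 1 : R] [set y : R | -1 < y < 1] k v.

Definition Ck_M (R : realType) (W : normedModType R) (k : nat)
    (f : R * R -> W) : Prop :=
  Ck_upto [:: (1, 0) : R * R; (0, 1)] (@strip R) k f.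

Definition Ck_spacetime (R : realType) (W : normedModType R) (k : nat)
    (f : R -> R * R -> W) : Prop :=
  Ck_upto [:: (1, (0, 0)) : R * (R * R); (0, (1, 0)); (0, (0, 1))]
    [set z : R * (R * R) | strip z.2] k (fun z => f z.1 z.2).

Definition dx (R : realType) (W : normedModType R) (f : R * R -> W)
  : R * R -> W := 'D_((1, 0) : R * R) f.
Definition dy (R : realType) (W : normedModType R) (f : R * R -> W)
  : R * R -> W := 'D_((0, 1) : R * R) f.
Definition partial (R : realType) (W : normedModType R) (i j : nat)
  (f : R * R -> W) : R * R -> W := iter i (@dx R W) (iter j (@dy R W) f).

Definition sup_norm (R : realType) (W : normedModType R) (f : R * R -> W)
  : \bar R := ereal_sup [set `|f p|%:E | p in @strip R].

(* By periodicity, taking pairs of points of the universal cover gives the same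
   value as using the distance of T x [-1, 1]. *)
Definition holder_seminorm (R : realType) (W : normedModType R) (alpha : R)
    (f : R * R -> W) : \bar R :=
  ereal_sup [set r | exists p q : R * R, [/\ strip p, strip q, p != q &
    r = (`|f p - f q| / `|p - q| `^ alpha)%:E]].

(* Meaningful for f in Ck_M k. *)
Definition holder_norm (R : realType) (W : normedModType R) (k : nat)
    (alpha : R) (f : R * R -> W) : \bar R :=
  (\sum_(i < k.+1) \sum_(j < k.+1 | (i + j <= k)%N) sup_norm (partial i j f) +
   \sum_(i < k.+1) holder_seminorm alpha (partial i (k - i)%N f))%E.

Definition holder_space (R : realType) (W : normedModType R) (k : nat)
    (alpha : R) (f : R * R -> W) : Prop :=
  [/\ x_periodic f, Ck_M k f & (holder_norm k alpha f < +oo)%E].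

(* Classical solutions, defined for all times. *)
Definition euler_solution (R : realType) (u : R -> R * R -> R * R) : Prop :=
  [/\ (forall t, x_periodic (u t)),
      Ck_spacetime 1 u,
      (exists pr : R -> R * R -> R,
         [/\ (forall t, x_periodic (pr t)),
             (forall t, Ck_M 1 (pr t)) &
             (forall t p, strip p ->
                derive1 (fun s => u s p) t +
                  ((u t p).1 *: dx (u t) p + (u t p).2 *: dy (u t) p)
                = - (dx (pr t) p, dy (pr t) p))]),
      (forall t p, strip p -> (dx (u t) p).1 + (dy (u t) p).2 = 0) &
      (forall t x, (u t (x, 1)).2 = 0 /\ (u t (x, -1)).2 = 0)].

Definition shear (R : realType) (w : R * R -> R * R) : Prop :=
  exists v : R -> R, forall p, cstrip p -> w p = (v p.2, 0).

Definition shear_flow (R : realType) (v : R -> R) : R * R -> R * R :=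
  fun p => (v p.2, 0).

Definition stationary (R : realType) (u : R -> R * R -> R * R) : Prop :=
  forall t s p, cstrip p -> u t p = u s p.

Definition time_periodic (R : realType) (u : R -> R * R -> R * R) : Prop :=
  ~ stationary u /\
  exists2 T : R, 0 < T & forall t p, cstrip p -> u (t + T) p = u t p.

Definition rationally_independent (R : realType) (N : nat) (omega : 'rV[R]_N)
  : Prop :=
  forall q : 'I_N -> rat,
    \sum_(i < N) ratr (q i) * omega 0 i = 0 -> forall i, q i = 0.

(* V is a function on the torus (R / 2 pi Z)^N with values in C^{k,alpha}(M),
   continuous for the norm of that space. *)
Definition torus_map (R : realType) (k : nat) (alpha : R) (N : nat)
    (V : 'rV[R]_N -> R * R -> R * R) : Prop :=
  [/\ (forall th i p, cstrip p ->
         V (th + (2 * pi) *: delta_mx 0 i) p = V th p),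
      (forall th, holder_space k alpha (V th)) &
      (forall th0,
         holder_norm k alpha (V th \- V th0) @[th --> th0] --> 0%E)].

Definition has_frequencies (R : realType) (k : nat) (alpha : R) (N : nat)
    (u : R -> R * R -> R * R) : Prop :=
  exists (V : 'rV[R]_N -> R * R -> R * R) (omega : 'rV[R]_N),
    [/\ torus_map k alpha V, rationally_independent omega &
        forall t p, cstrip p -> u t p = V (t *: omega) p].

Definition quasiperiodic (R : realType) (k : nat) (alpha : R) (N : nat)
    (u : R -> R * R -> R * R) : Prop :=
  has_frequencies k alpha N u /\
  forall N', (N' < N)%N -> ~ has_frequencies k alpha N' u.

(* Non-shear solutions staying within eps of w in C^{k,alpha}(M). *)
Definition nonshear_solution_near (R : realType) (k : nat) (alpha eps : R)
    (w : R * R -> R * R) (u : R -> R * R -> R * R) : Prop :=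
  [/\ euler_solution u,
      (forall t, ~ shear (u t)) &
      (forall t, holder_space k alpha (u t \- w) /\
                 (holder_norm k alpha (u t \- w)%R < eps%:E)%E)].

(* Main.v *)
Require Import Defs.
From HB Require Import structures.
From mathcomp Require Import all_boot all_order all_algebra.
From mathcomp Require Import all_classical all_reals all_analysis.
From mathcomp Require Import lra ring zify.
Import Order.TTheory GRing.Theory Num.Theory.
Import numFieldNormedType.Exports.
Local Open Scope classical_set_scope.
Local Open Scope ring_scope.
Set Implicit Arguments.
Unset Strict Implicit.
Unset Printing Implicit Defensive.

(* Since v vanishes to order n at y0, it is the n-fold primitive of its n-th
   derivative from y0; replacing that derivative by 0 on a small interval around
   y0 produces a profile that vanishes near y0 and is close to v in C^{n-1,alpha}
   (the derivatives of order less than n change little, that of order n remains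
   bounded).  Inside the interval of rest, choose disjoint strips, give the i-th
   one a small constant velocity c_i, and put into it a small radial vortex of
   compact support.  Each vortex is a steady Euler flow, so it is carried along
   with velocity c_i without change of shape, and the phases of the vortices are
   c_i t.  With c_0 = 0 and the other c_i proportional to logarithms of distinct
   primes this gives stationary, periodic and quasiperiodic solutions.

   Fewer frequencies omega' cannot suffice: whenever all omega'_j t are close to
   2 pi Z, every vortex is close to its initial position, and then averaging
   cos (c_i t) against the nonnegative kernel prod_j ((1 + cos (omega'_j t)) / 2)^K
   for large K shows that c_i is an integral combination of the omega'_j. *)

(** * Directional derivatives *)

(** The flattened profile is not close to [v] in C^n: the change of the derivative of order n is
    only bounded, by a constant [M0] independent of the cutoff. Interpolation with the small lower
    orders gives a factor a^(1 - alpha), and this is where alpha < 1 enters. Hence the order of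
    choices: [M0], the target size [a], the cutoff radius [d], the vortex radius [rho] for which all
    strips fit into the interval of rest, and last [kappa]. Thin vortices have huge derivatives, but
    the amplitude [kappa] is chosen after them; it also multiplies the velocities c_i, and a common
    factor preserves rational independence. In the lower bound on the number of frequencies, the
    omega'_j may satisfy arbitrary relations. The mean of the kernel is nevertheless at least (2 K +
    1)^(-N'), while off the times of return the kernel is at most x^K with x < 1: a polynomial
    against an exponential. Finally, N numbers in the integral span of N' < N numbers are rationally
    dependent. *)

Lemma is_derive_line (R : realType) (E W : normedModType R) (f : E -> W) (p e : E) d :
  is_derive p e f d <-> is_derive (0 : R) 1 (fun h : R => f (h *: e + p)) d.
Proof.
have eqq : (fun h : R => h^-1 *: ((f \o shift p) (h *: e) - f p)) =
  (fun h : R => h^-1 *: (((fun h : R => f (h *: e + p)) \o shift 0) (h *: 1)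
     - f (0 *: e + p))).
  by apply/funext => h /=; rewrite addr0 scale0r add0r [_%:A]mulr1.
split=> -[df <-]; apply: DeriveDef.
- exact: ((derivable1P f p e).1 df).
- by rewrite /derive eqq.
- exact: ((derivable1P f p e).2 df).
- by rewrite /derive eqq.
Qed.

(** [L] maps the line through p in direction e to the line through [L p] in direction e', so the
    difference quotients coincide. Slices, translations, projections and moving frames are
    instances. *)
Lemma is_derive_affine (R : realType) (E E' W : normedModType R) (L : E' -> E) (f : E -> W)
    (p e : E') (e' : E) d :
  (forall h : R, L (h *: e + p) = h *: e' + L p) ->
  is_derive (L p) e' f d -> is_derive p e (f \o L) d.
Proof.
move=> Le /is_derive_line df; apply/is_derive_line.
suff -> : (fun h : R => (f \o L) (h *: e + p)) =
  (fun h => f (h *: e' + L p)) by [].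
by apply/funext => h /=; rewrite Le.
Qed.

Lemma is_derive_comp (R : realType) (E : normedModType R) (f : E -> R)
    (g : R -> R) (p e : E) df dg :
  is_derive p e f df -> is_derive (f p) 1 g dg ->
  is_derive p e (g \o f) (dg * df).
Proof.
move=> /is_derive_line Df Dg; apply/is_derive_line.
have Dg' : is_derive (f (0 *: e + p)) 1 g dg by rewrite scale0r add0r.
exact: (@is_derive1_comp _ g (fun h => f (h *: e + p)) 0 dg df).
Qed.

Lemma is_derive_pair (R : realType) (E W1 W2 : normedModType R) (f : E -> W1)
    (g : E -> W2) (p e : E) df dg :
  is_derive p e f df -> is_derive p e g dg ->
  is_derive p e (fun q => (f q, g q)) (df, dg).
Proof.
move=> [Df Ef] [Dg Eg].
have cf : h^-1 *: (f (h *: e + p) - f p) @[h --> 0^'] --> df by rewrite -Ef.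
have cg : h^-1 *: (g (h *: e + p) - g p) @[h --> 0^'] --> dg by rewrite -Eg.
have cc := cvg_pair cf cg.
apply: DeriveDef; first by apply/cvg_ex; exists (df, dg); exact: cc.
by apply: cvg_lim => //; exact: cc.
Qed.

Lemma is_derive_derive (R : realType) (E W : normedModType R) (f df : E -> W) (e : E) :
  (forall p, is_derive p e f (df p)) -> 'D_e f = df.
Proof. by move=> Df; apply/funext => p; case: (Df p). Qed.

(** An error quadratic in w - z forces differentiability. This covers z max(z, 0) at its kink, and
    affine maps with C = 0, by inequalities alone. *)
Lemma is_derive_quadratic {R : realType} (f : R -> R) (z d C : R) :
  (forall w, `|f w - f z - d * (w - z)| <= C * (w - z) ^+ 2) ->
  is_derive z 1 f d.
Proof.
move=> Hq.
have cv : h^-1 *: (f (h *: 1 + z) - f z) @[h --> 0^'] --> d.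
  apply/cvgrPdist_le => /= e e0.
  have C0 : 0 < `|C| + 1 by rewrite ltr_pwDr.
  near=> h.
  have h0 : h != 0 by near: h; exact: nbhs_dnbhs_neq.
  have hle : `|h| <= e / (`|C| + 1).
    by near: h; apply: dnbhs0_le; rewrite divr_gt0.
  have := Hq (h *: 1 + z); rewrite [h *: 1]mulr1 addrK => H.
  rewrite -normrN opprB.
  have -> : h^-1 *: (f (h + z) - f z) - d = h^-1 * (f (h + z) - f z - d * h).
    by transitivity (h^-1 * (f (h + z) - f z) - d); [by []|field].
  rewrite normrM normfV ler_pdivrMl ?normr_gt0//.
  apply: le_trans H _.
  apply: le_trans (_ : `|C| * `|h ^+ 2| <= _).
    by rewrite [`|h ^+ 2|]ger0_norm ?sqr_ge0// ler_wpM2r ?sqr_ge0// ler_norm.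
  rewrite normrX expr2 mulrCA ler_wpM2l//.
  move: hle; rewrite ler_pdivlMr// => hle.
  by apply: le_trans hle; rewrite mulrC ler_wpM2l// lerDl.
by apply: DeriveDef; [apply/cvg_ex; exists d|exact: cvg_lim].
Unshelve. all: by end_near. Qed.

Lemma is_derive_scaled_direction (R : realType) (E : normedModType R)
    (f : E -> R) (p e : E) (c d : R) :
  is_derive p e f d -> is_derive p (c *: e) f (c * d).
Proof.
move=> /is_derive_line df; apply/is_derive_line.
have -> : (fun h : R => f (h *: (c *: e) + p)) =
  (fun h => f (h *: e + p)) \o ( *%R c).
  by apply/funext => h /=; rewrite scalerA mulrC.
rewrite mulrC; apply: is_derive_comp; last by rewrite mulr0.
apply: (@is_derive_quadratic _ _ _ _ 0) => w.
by rewrite mulrBr subrr normr0 mul0r.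
Qed.

Lemma is_derive_mulc (R : realType) (E : normedModType R) (f : E -> R) (k : R)
    (p e : E) d : is_derive p e f d -> is_derive p e (fun q => k * f q) (k * d).
Proof. by move=> D; exact: (@is_deriveZ _ _ _ _ k _ _ _ D). Qed.

Lemma is_derive_add (R : realType) (E : normedModType R) (f g : E -> R)
    (p e : E) df dg : is_derive p e f df -> is_derive p e g dg ->
  is_derive p e (fun q => f q + g q) (df + dg).
Proof. by move=> Df Dg; exact: (@is_deriveD _ _ _ _ _ _ _ _ _ Df Dg). Qed.

(** * Functions of class C^k with bounds *)

(* [Ck_bounded b D k A f]: f is C^k on the whole space along the directions
   listed in b, its derivatives of order j being bounded by [A j] on D;
   taking D empty, no bound is required. *)
Fixpoint Ck_bounded (R : realType) (E : normedModType R) (b : seq E)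
    (D : set E) (k : nat) (A : nat -> R) (f : E -> R) : Prop :=
  [/\ continuous f, (forall p, D p -> `|f p| <= A 0%N) &
  (if k is k'.+1 then
     forall e, e \in b -> exists2 g : E -> R,
       Ck_bounded b D k' (A \o succn) g & forall p, is_derive p e f (g p)
   else True)].

Notation Ck_global b k f := (Ck_bounded b set0 k (fun=> 0) f).

Section CkBounded.
Variables (R : realType) (E : normedModType R) (b : seq E).
Implicit Types (D : set E) (f g : E -> R) (A : nat -> R).

Lemma Ck_bounded_continuous D k A f : Ck_bounded b D k A f -> continuous f.
Proof. by case: k => [|k] []. Qed.

Lemma Ck_bounded_le D k A f p : Ck_bounded b D k A f -> D p -> `|f p| <= A 0%N.
Proof. by case: k => [|k] [_ + _]; exact. Qed.

(** The bounds are compared only if D' has a point, so that passing to the empty set discards them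
    and gives [Ck_global]. *)
Lemma Ck_bounded_weaken D D' k k' A A' f : (k' <= k)%N -> D' `<=` D ->
  (forall j, (j <= k')%N -> D' !=set0 -> A j <= A' j) ->
  Ck_bounded b D k A f -> Ck_bounded b D' k' A' f.
Proof.
elim: k' k A A' f => [|k' IH] [|k] A A' f // kk DD AA [fc fA fD]; split=> //.
- by move=> p Dp; apply: le_trans (AA _ _ _) => //; [apply/fA/DD|exists p].
- by move=> p Dp; apply: le_trans (AA _ _ _) => //; [apply/fA/DD|exists p].
- by move=> p Dp; apply: le_trans (AA _ _ _) => //; [apply/fA/DD|exists p].
- move=> e /fD[g gA gD]; exists g => //.
  by apply: IH gA => // j jk; exact: AA.
Qed.

Lemma Ck_bounded_global D k k' A f : (k' <= k)%N ->
  Ck_bounded b D k A f -> Ck_global b k' f.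
Proof. by move=> kk; apply: Ck_bounded_weaken => // j _ []. Qed.

Lemma Ck_bounded_cst D k c A : `|c| <= A 0%N -> (forall j, 0 <= A j) ->
  Ck_bounded b D k A (fun=> c).
Proof.
elim: k c A => [|k IH] c A cA A0; split => //; try exact: cst_continuous.
move=> e _; exists (fun=> 0); first by apply: IH => [|j]; rewrite ?normr0 /=.
by move=> p; exact: is_derive_cst.
Qed.

Lemma Ck_global_cst k (c : R) : Ck_global b k (fun=> c).
Proof.
apply: (@Ck_bounded_global set0 k _ (fun=> `|c|)) => //.
by apply: Ck_bounded_cst.
Qed.

Lemma Ck_boundedD D k A A' f g : Ck_bounded b D k A f -> Ck_bounded b D k A' g ->
  Ck_bounded b D k (A \+ A') (f \+ g).
Proof.
elim: k A A' f g => [|k IH] A A' f g [fc fA fD] [gc gA gD]; split=> //.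
- by move=> p; apply: continuousD; [exact: fc|exact: gc].
- by move=> p Dp; rewrite (le_trans (ler_normD _ _))// lerD ?fA ?gA.
- by move=> p; apply: continuousD; [exact: fc|exact: gc].
- by move=> p Dp; rewrite (le_trans (ler_normD _ _))// lerD ?fA ?gA.
- move=> e eb; have [f' f'A f'D] := fD _ eb; have [g' g'A g'D] := gD _ eb.
  by exists (f' \+ g'); [exact: IH|move=> p; exact: is_deriveD].
Qed.

Lemma Ck_boundedZ D k A c f : Ck_bounded b D k A f ->
  Ck_bounded b D k (fun j => `|c| * A j) (fun p => c * f p).
Proof.
have cM (h : E -> R) : continuous h -> continuous (fun p => c * h p).
  by move=> hc p; apply: continuousM; [exact: cst_continuous|exact: hc].
elim: k A f => [|k IH] A f [fc fA fD]; split=> //.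
- exact: cM.
- by move=> p Dp; rewrite normrM ler_wpM2l ?fA.
- exact: cM.
- by move=> p Dp; rewrite normrM ler_wpM2l ?fA.
- move=> e eb; have [f' f'A f'D] := fD _ eb.
  exists (fun p => c * f' p); first exact: IH.
  by move=> p; have := @is_deriveZ R E R f c p e _ (f'D p).
Qed.

Lemma Ck_bounded_sum (I : Type) (r : seq I) D k (A : I -> nat -> R)
    (f : I -> E -> R) :
  (forall i, Ck_bounded b D k (A i) (f i)) ->
  Ck_bounded b D k (fun j => \sum_(i <- r) A i j) (fun p => \sum_(i <- r) f i p).
Proof.
move=> fA; elim: r => [|i r IH].
  have -> : (fun p => \sum_(i <- [::]) f i p) = (fun=> 0) :> (E -> R).
    by apply/funext => p; rewrite big_nil.
  by apply: Ck_bounded_cst => [|j]; rewrite big_nil// normr0.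
have := Ck_boundedD (fA i) IH.
congr Ck_bounded; apply/funext => p /=; by rewrite big_cons.
Qed.

(** The constants of the Leibniz rule are not tracked: functions built from products get their
    bounds later, from periodicity and compactness. *)
Lemma Ck_globalM k f g : Ck_global b k f -> Ck_global b k g ->
  Ck_global b k (fun p => f p * g p).
Proof.
elim: k f g => [|k IH] f g fk gk; have [fc fA fD] := fk; have [gc gA gD] := gk; split=> //.
- by move=> p; apply: continuousM; [exact: fc|exact: gc].
- by move=> p; apply: continuousM; [exact: fc|exact: gc].
- move=> e eb; have [f' f'A f'D] := fD _ eb; have [g' g'A g'D] := gD _ eb.
  have f1 : Ck_global b k f by exact: Ck_bounded_global (leqnSn k) fk.
  have g1 : Ck_global b k g by exact: Ck_bounded_global (leqnSn k) gk.
  exists (fun p => f p * g' p + g p * f' p).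
    apply: (@Ck_bounded_global set0 k _ ((fun=> 0) \+ (fun=> 0))) => //.
    by apply: Ck_boundedD; exact: IH.
  by move=> p; exact: is_deriveM.
Qed.

Lemma Ck_globalD k f g : Ck_global b k f -> Ck_global b k g ->
  Ck_global b k (fun p => f p + g p).
Proof.
move=> fk gk; apply: (@Ck_bounded_global set0 k _ ((fun=> 0) \+ (fun=> 0))) => //.
exact: Ck_boundedD.
Qed.

End CkBounded.

Lemma Ck_global_affine (R : realType) (E : normedModType R) (b : seq E) k
    (f : E -> R) : continuous f ->
  (forall e, e \in b -> exists c, forall p, is_derive p e f c) -> Ck_global b k f.
Proof.
move=> fc fD; case: k => [|k]; split=> // e /fD[c cD].
by exists (fun=> c); first exact: Ck_global_cst.
Qed.

(** * Truncated powers and plateau functions *)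

Section PositivePart.
Variable R : realType.
Implicit Types z : R.

(* Equal to max(z, 0)^(m+1). *)
Definition pos_pow m z : R := z ^+ m * Num.max z 0.

Lemma pos_pow_le0 m z : z <= 0 -> pos_pow m z = 0.
Proof. by move=> z0; rewrite /pos_pow max_r// mulr0. Qed.

Lemma pos_pow_ge0 m z : 0 <= z -> pos_pow m z = z ^+ m.+1.
Proof. by move=> z0; rewrite /pos_pow max_l// exprSr. Qed.

(** Only the factor z max(z, 0) has a kink, where a quadratic error bound with constant 1 applies;
    the remaining factor z^m is left to the product rule. *)
Lemma is_derive_pos_pow m z :
  is_derive z 1 (pos_pow m.+1) (m.+2%:R * pos_pow m z).
Proof.
have D1 (w : R) : is_derive w 1 (fun z : R => z * Num.max z 0) (2 * Num.max w 0).
  apply: (@is_derive_quadratic _ _ _ _ 1) => x.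
  rewrite mul1r ler_norml.
  have := sqr_ge0 (x - w); have := sqr_ge0 x; have := sqr_ge0 w.
  rewrite !expr2; case: (lerP x 0) => x0; case: (lerP w 0) => w0 *.
  - by apply/andP; split; lra.
  - by have := mulr_le0_ge0 x0 (ltW w0) => *; apply/andP; split; lra.
  - by have := mulr_ge0_le0 (ltW x0) w0 => *; apply/andP; split; lra.
  - by apply/andP; split; lra.
have Dm : is_derive z 1 (fun z : R => z ^+ m) (m%:R * z ^+ m.-1).
  have -> : m%:R * z ^+ m.-1 = (fun x : R => x ^+ m)^`()%classic z.
    by rewrite exp_derive1.
  by rewrite derive1E; apply/derivableP/exprn_derivable.
have := @is_deriveM R R (fun z : R => z ^+ m) (fun z => z * Num.max z 0) z 1 _ _ Dm (D1 z).
have -> : (fun z : R => z ^+ m) * (fun z => z * Num.max z 0) = pos_pow m.+1.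
  by apply/funext => x /=; rewrite /pos_pow exprSr -mulrA.
move/is_derive_eq; apply; rewrite /pos_pow.
case: m Dm => [|m] _.
  by rewrite mul0r scaler0 expr0 addr0 mul1r [_ *: _]mul1r.
transitivity (z ^+ m.+1 * (2 * Num.max z 0) +
  z * Num.max z 0 * (m.+1%:R * z ^+ m)); first by [].
by rewrite exprS -[m.+3%:R]natr1 -[m.+2%:R]natr1; ring.
Qed.

Lemma continuous_pos_pow m : continuous (pos_pow m).
Proof.
case: m => [|m] z; last first.
  have /@ex_derive/derivable1_diffP := is_derive_pos_pow m z.
  exact: differentiable_continuous.
have -> : pos_pow 0 = (fun z : R => Num.max z 0).
  by apply/funext => x; rewrite /pos_pow expr0 mul1r.
by apply: continuous_max; [exact: cvg_id|exact: cvg_cst].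
Qed.

Lemma Ck_global_pos_pow (E : normedModType R) (b : seq E) k m (f : E -> R) :
  (k <= m)%N -> Ck_global b k f -> Ck_global b k (fun p => pos_pow m (f p)).
Proof.
elim: k m f => [|k IH] m f km fk; have [fc fA fD] := fk; split=> //.
- by move=> p; apply: continuous_comp; [exact: fc|exact: continuous_pos_pow].
- by move=> p; apply: continuous_comp; [exact: fc|exact: continuous_pos_pow].
- case: m km => // m km e eb; have [f' f'A f'D] := fD _ eb.
  have f1 : Ck_global b k f by exact: Ck_bounded_global (leqnSn k) fk.
  exists (fun p => m.+2%:R * pos_pow m (f p) * f' p).
    apply: Ck_globalM f'A; apply: Ck_globalM; last exact: IH.
    exact: Ck_global_cst.
  move=> p; exact: is_derive_comp (f'D p) (is_derive_pos_pow m (f p)).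
Qed.

(* 1 on [-1, 1], and 0 for z^2 >= 2. *)
Definition plateau m z : R := pos_pow m (1 - pos_pow m (z ^+ 2 - 1)).

Lemma plateau_eq1 m z : `|z| <= 1 -> plateau m z = 1.
Proof.
move=> z1; rewrite /plateau [X in _ - X]pos_pow_le0.
  by rewrite subr0 pos_pow_ge0// expr1n.
by rewrite subr_le0 -real_normK ?num_real// expr_le1.
Qed.

Lemma plateau_eq0 m z : 2 <= z ^+ 2 -> plateau m z = 0.
Proof.
move=> z2; rewrite /plateau pos_pow_le0// subr_le0 pos_pow_ge0; last lra.
by rewrite exprn_ege1//; lra.
Qed.

Lemma plateau_itv m z : 0 <= plateau m z <= 1.
Proof.
have p0 w : 0 <= pos_pow m w.
  case: (lerP w 0) => w0; first by rewrite pos_pow_le0.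
  by rewrite pos_pow_ge0 ?exprn_ge0// ltW.
rewrite p0 /plateau /=; set w := 1 - _; have w1 : w <= 1 by rewrite gerBl.
case: (lerP w 0) => w0; first by rewrite pos_pow_le0.
by rewrite pos_pow_ge0 ?exprn_ile1// ltW.
Qed.

Lemma Ck_global_plateau (E : normedModType R) (b : seq E) k m (f : E -> R) :
  (k <= m)%N -> Ck_global b k f -> Ck_global b k (fun p => plateau m (f p)).
Proof.
have cst c : Ck_global b k (fun=> c) by exact: Ck_global_cst.
move=> km fk; apply: Ck_global_pos_pow => //; apply: Ck_globalD => //.
have -> : (fun p => - pos_pow m (f p ^+ 2 - 1)) =
    (fun p => (fun=> -1) p * pos_pow m (f p * f p + -1)).
  by apply/funext => p; rewrite mulN1r.
by apply: Ck_globalM => //; apply/Ck_global_pos_pow/Ck_globalD => //; exact: Ck_globalM.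
Qed.

End PositivePart.

(** * Iterated primitives *)

Section RealPrimitives.
Variable R : realType.
Implicit Types (f df F : R -> R) (x y z M : R) (P : set R).

(** Intervals in the order sense, so that one mean value estimate serves the line, half-lines and
    open or closed intervals. *)
Definition order_convex P := forall x y z, P x -> P y -> x <= z <= y -> P z.

Lemma derive_lipschitz P f df M : order_convex P ->
  (forall x, P x -> is_derive x 1 f (df x)) ->
  (forall x, P x -> `|df x| <= M) ->
  forall x y, P x -> P y -> `|f x - f y| <= M * `|x - y|.
Proof.
move=> Pc Df dfM; suff H x y : P x -> P y -> x <= y -> `|f x - f y| <= M * `|x - y|.
  move=> x y Px Py; have [xy|yx] := leP x y; first exact: H.
  by rewrite distrC [`|x - y|]distrC; apply: H => //; exact: ltW.
move=> Px Py xy; rewrite distrC [`|x - y|]distrC.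
have fP z : z \in `[x, y] -> P z by rewrite in_itv/=; exact: Pc.
have [||c cxy ->] := @MVT_segment _ f df x y xy.
- by move=> z /subset_itv_oo_cc/fP/Df.
- apply: derivable_within_continuous => z /fP/Df.
  by case.
- by rewrite normrM ler_wpM2r//; exact/dfM/fP.
Qed.

Lemma derive_eq_primitive P F F' f : order_convex P ->
  (forall x, P x -> is_derive x 1 F (f x)) ->
  (forall x, P x -> is_derive x 1 F' (f x)) ->
  forall x y, P x -> P y -> F x - F y = F' x - F' y.
Proof.
move=> Pc DF DF' x y Px Py.
have H : `|(F \- F') x - (F \- F') y| <= 0 * `|x - y|.
  apply: (@derive_lipschitz P (F \- F') (fun=> 0)) => // z Pz.
    have := @is_deriveB R R R F F' z 1 _ _ (DF z Pz) (DF' z Pz).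
    by rewrite subrr.
  by rewrite normr0.
by move: H; rewrite mul0r normr_le0 => /eqP /=; lra.
Qed.

(** The integral from -m is a primitive only to the right of -m, so m has to grow with x.
    Subtracting the value at x0 makes the result independent of m. *)
Lemma continuous_has_primitive f x0 : continuous f ->
  exists F, F x0 = 0 /\ forall x, is_derive x 1 F (f x).
Proof.
move=> fc; pose G (m : nat) x : R :=
  (\int[@lebesgue_measure R]_(t in [set` `[- m%:R, x]]) f t)%R.
have DG m x : - m%:R < x -> is_derive x 1 (G m) (f x).
  move=> mx; have [||||d e] := @continuous_FTC1_closed R f (- m%:R) x (x + 1).
  - by rewrite ltrDl.
  - apply: continuous_compact_integrable; first exact: segment_compact.
    exact: continuous_subspaceT.
  - exact: mx.
  - exact: fc.
  - by rewrite -e derive1E; exact/derivableP.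
pose k x := Num.bound (`|x| + `|x0|).
have kP x : `|x| + `|x0| < (k x)%:R by rewrite archi_boundP.
pose F x := G (k x) x - G (k x) x0.
have FE x (m : nat) : `|x| + `|x0| < m%:R -> F x = G m x - G m x0.
  move=> mx; pose P := [set y | - (minn m (k x))%:R < y] : set R.
  have kx := kP x.
  have mk : `|x| + `|x0| < (minn m (k x))%:R.
    by rewrite /minn; case: ifP.
  have Px : P x.
    by rewrite /P/=; have := ler_norm (- x); have := normr_ge0 x0; rewrite normrN; lra.
  have Px0 : P x0.
    by rewrite /P/=; have := ler_norm (- x0); have := normr_ge0 x; rewrite normrN; lra.
  apply: (@derive_eq_primitive P _ _ f) => //.
  - by move=> y z w /= Py _ /andP[yw _]; rewrite /P/=; exact: lt_le_trans yw.
  - move=> y /= Py; apply: DG; apply: le_lt_trans Py.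
    by rewrite lerN2 ler_nat geq_minr.
  - move=> y /= Py; apply: DG; apply: le_lt_trans Py.
    by rewrite lerN2 ler_nat geq_minl.
exists F; split; first by rewrite /F subrr.
move=> x; pose m := Num.bound (`|x| + 1 + `|x0|).
have mP : `|x| + 1 + `|x0| < m%:R by rewrite archi_boundP// !addr_ge0.
apply: (@near_eq_is_derive _ _ _ (fun y => G m y - G m x0)).
  near=> y; apply/esym/FE; apply: le_lt_trans mP; rewrite lerD2r.
  have yx : `|x - y| < 1 by near: y; exact: nbhsx_ballx.
  by rewrite -{1}(subKr x y) (le_trans (ler_normB _ _))// lerD2l ltW.
have mx : - m%:R < x.
  by have := ler_norm (- x); have := normr_ge0 x0; rewrite normrN; lra.
have := @is_deriveB R R R (G m) (cst (G m x0)) x 1 _ _ (DG m x mx) (is_derive_cst _ _ _).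
by rewrite subr0.
Unshelve. all: by end_near. Qed.

Definition primitive x0 f : R -> R :=
  get [set F | F x0 = 0 /\ forall x, is_derive x 1 F (f x)].

Lemma primitiveP x0 f : continuous f ->
  primitive x0 f x0 = 0 /\ forall x, is_derive x 1 (primitive x0 f) (f x).
Proof.
move=> /(@continuous_has_primitive f x0)[F HF].
by have := getPex (ex_intro [set F | F x0 = 0 /\ _] F HF).
Qed.

Definition iter_primitive x0 n f : R -> R := iter n (primitive x0) f.

Lemma derive_continuous F f : (forall x, is_derive x 1 F (f x)) -> continuous F.
Proof.
move=> DF x; have /@ex_derive/derivable1_diffP := DF x.
exact: differentiable_continuous.
Qed.

Lemma continuous_iter_primitive x0 n f : continuous f ->
  continuous (iter_primitive x0 n f).
Proof.
move=> fc; elim: n => [|n IH] //.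
exact: derive_continuous (primitiveP x0 IH).2.
Qed.

Lemma is_derive_iter_primitive x0 n f x : continuous f ->
  is_derive x 1 (iter_primitive x0 n.+1 f) (iter_primitive x0 n f x).
Proof. by move=> /(@continuous_iter_primitive x0 n)/(@primitiveP x0)[]. Qed.

Lemma iter_primitive_base x0 n f : continuous f -> iter_primitive x0 n.+1 f x0 = 0.
Proof. by move=> /(@continuous_iter_primitive x0 n)/(@primitiveP x0)[]. Qed.

(** Uniqueness of primitives, applied n times. Since only values on P are compared, it serves both
    to recover [v] from its derivative of order n and to see that changing f away from x0 leaves its
    primitives near x0 unchanged. *)
Lemma iter_primitive_eq P x0 n f (g : nat -> R -> R) : order_convex P -> P x0 ->
  continuous f ->
  (forall x, P x -> g 0%N x = f x) ->
  (forall i x, (i < n)%N -> P x -> is_derive x 1 (g i.+1) (g i x)) ->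
  (forall i, (i < n)%N -> g i.+1 x0 = 0) ->
  forall x, P x -> g n x = iter_primitive x0 n f x.
Proof.
move=> Pc P0 fc g0; elim: n => [|n IH] Dg gx0 x Px; first exact: g0.
have := @derive_eq_primitive P (g n.+1) (iter_primitive x0 n.+1 f) (g n) Pc.
move=> /(_ _ _ x x0 Px P0); rewrite gx0// iter_primitive_base// !subr0; apply.
- by move=> y Py; exact: Dg.
- move=> y Py; have -> : g n y = iter_primitive x0 n f y.
    by apply: IH => // [i z i1|i i1]; [apply: Dg|apply: gx0]; exact: ltnW.
  exact: is_derive_iter_primitive.
Qed.

End RealPrimitives.

(** * Hoelder estimates *)

Lemma continuous_pair (T U V : topologicalType) (f : T -> U) (g : T -> V) :
  continuous f -> continuous g -> continuous (fun x => (f x, g x)).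
Proof. by move=> fc gc x; exact: (cvg_pair (fc x) (gc x)). Qed.

Section GlobalToClosure.
Variables (R : realType) (E : normedModType R) (b : seq E) (D : set E).
Implicit Types (f g : E -> R).

Lemma Ck_upto_global k f : Ck_global b k f -> Ck_upto b D k f.
Proof.
elim: k f => [|k IH] f [fc _ fD].
  by split=> //; exact: continuous_subspaceT.
split; first exact: continuous_subspaceT.
move=> e eb; have [g gk gD] := fD e eb.
split; first by move=> p _; case: (gD p).
by exists g; split; [exact: IH|move=> p _; case: (gD p)].
Qed.

Lemma Ck_upto_global_pair k f g : Ck_global b k f -> Ck_global b k g ->
  Ck_upto b D k (fun p => (f p, g p)).
Proof.
have cpair (h h' : E -> R) : continuous h -> continuous h' ->
    {within closure D, continuous (fun p => (h p, h' p))}.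
  by move=> hc hc'; apply: continuous_subspaceT; exact: continuous_pair.
elim: k f g => [|k IH] f g [fc _ fD] [gc _ gD].
  by split=> //; exact: cpair.
split; first exact: cpair.
move=> e eb; have [f' fk f'D] := fD e eb; have [g' gk g'D] := gD e eb.
have fgD p := is_derive_pair (f'D p) (g'D p).
split; first by move=> p _; case: (fgD p).
exists (fun p => (f' p, g' p)); split; first exact: IH.
by move=> p _; case: (fgD p).
Qed.

End GlobalToClosure.

Lemma norm_pair (R : realType) (x y : R) : `|(x, y)| = Num.max `|x| `|y|.
Proof. by rewrite prod_normE. Qed.

Section HolderEstimates.
Variable R : realType.
Implicit Types (f g : R * R -> R) (A : nat -> R) (p q : R * R) (a M alpha : R).

Definition axes : seq (R * R) := [:: (1, 0); (0, 1)].

Local Notation dir_x := ((1, 0) : R * R).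
Local Notation dir_y := ((0, 1) : R * R).

Lemma mem_axis_x : dir_x \in axes. Proof. by rewrite mem_head. Qed.
Lemma mem_axis_y : dir_y \in axes. Proof. by rewrite !inE eqxx orbT. Qed.

Lemma is_derive_slice_x f x y d : is_derive ((x, y) : R * R) dir_x f d ->
  is_derive x 1 (fun s => f (s, y)) d.
Proof.
apply: (@is_derive_affine R _ _ _ (fun s => (s, y)) f) => h.
by congr (_, _); rewrite /= ?[h *: 0]mulr0 ?add0r.
Qed.

Lemma is_derive_slice_y f x y d : is_derive ((x, y) : R * R) dir_y f d ->
  is_derive y 1 (fun s => f (x, s)) d.
Proof.
apply: (@is_derive_affine R _ _ _ (fun s => (x, s)) f) => h.
by congr (_, _); rewrite /= ?[h *: 0]mulr0 ?add0r.
Qed.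

(** From p to q along a horizontal and then a vertical segment, both in the strip; each is at most
    as long as the maximum norm of p - q, whence the factor 2. *)
Lemma Ck_bounded_lipschitz k A f p q : Ck_bounded axes (@strip R) k.+1 A f ->
  strip p -> strip q -> `|f p - f q| <= 2 * A 1%N * `|p - q|.
Proof.
case: p q => [x y] [x' y'] [_ _ fD]; rewrite /strip/= => sy sy'.
have [fx fxA fxD] := fD _ mem_axis_x; have [fy fyA fyD] := fD _ mem_axis_y.
have A1 : 0 <= A 1%N.
  by apply: le_trans (Ck_bounded_le fxA (_ : strip (x, y))).
have nx : `|x - x'| <= `|(x, y) - (x', y') : R * R| by rewrite norm_pair le_max lexx.
have ny : `|y - y'| <= `|(x, y) - (x', y') : R * R|.
  by rewrite norm_pair le_max lexx orbT.
have hx : `|f (x, y) - f (x', y)| <= A 1%N * `|x - x'|.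
  apply: (@derive_lipschitz R setT (fun s => f (s, y)) (fun s => fx (s, y))) => //.
    by move=> s _; apply: is_derive_slice_x; exact: fxD.
  by move=> s _; exact: (Ck_bounded_le fxA).
have hy : `|f (x', y) - f (x', y')| <= A 1%N * `|y - y'|.
  apply: (@derive_lipschitz R [set s | -1 < s < 1] (fun s => f (x', s))
            (fun s => fy (x', s))) => //.
  - move=> s t w /= /andP[s1 s2] /andP[t1 t2] /andP[sw wt].
    by rewrite (lt_le_trans s1)// (le_lt_trans wt).
  - by move=> s _; apply: is_derive_slice_y; exact: fyD.
  - by move=> s s1; exact: (Ck_bounded_le fyA).
rewrite -(subrK (f (x', y)) (f (x, y))) -addrA (le_trans (ler_normD _ _))//.
have := ler_wpM2l A1 nx; have := ler_wpM2l A1 ny; lra.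
Qed.

Lemma interpolation (z X Y alpha : R) : 0 < alpha < 1 -> 0 <= z ->
  z <= X -> z <= Y -> z <= X `^ alpha * Y `^ (1 - alpha).
Proof.
move=> /andP[a0 a1]; rewrite le_eqVlt => /predU1P[<- _ _|z0 zX zY].
  by rewrite mulr_ge0 ?powR_ge0.
have X0 := lt_le_trans z0 zX; have Y0 := lt_le_trans z0 zY.
have -> : z = z `^ alpha * z `^ (1 - alpha).
  rewrite -powRD; last by rewrite (gt_eqF z0) implybT.
  by rewrite [alpha + _]addrC subrK powRr1// ltW.
apply: ler_pM; rewrite ?powR_ge0//; apply: ge0_ler_powR;
  rewrite ?nnegrE ?(ltW z0) ?(ltW X0) ?(ltW Y0)//; lra.
Qed.

(** The derivatives recorded in [Ck_bounded] exist on the whole plane, so each application of ['D]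
    is an equality of functions; it shifts the bounds by one index. *)
Lemma partial_pair k A f g i j : (i + j <= k)%N ->
  Ck_bounded axes (@strip R) k A f -> Ck_bounded axes (@strip R) k A g ->
  exists f' g', [/\ partial i j (fun p => (f p, g p)) = fun p => (f' p, g' p),
    Ck_bounded axes (@strip R) (k - (i + j)) (fun l => A (l + (i + j))%N) f' &
    Ck_bounded axes (@strip R) (k - (i + j)) (fun l => A (l + (i + j))%N) g'].
Proof.
move=> ijk fA gA.
have shift m B h e : e \in axes -> Ck_bounded axes (@strip R) m.+1 B h ->
    exists2 h', Ck_bounded axes (@strip R) m (B \o succn) h' &
      forall p, is_derive p e h (h' p).
  by move=> eb [_ _] /(_ _ eb).
have step m h h' e : (m < k)%N -> e \in axes ->
    Ck_bounded axes (@strip R) (k - m) (fun l => A (l + m)%N) h ->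
    Ck_bounded axes (@strip R) (k - m) (fun l => A (l + m)%N) h' ->
  exists f' g', [/\ 'D_e (fun p => (h p, h' p)) = fun p => (f' p, g' p),
    Ck_bounded axes (@strip R) (k - m.+1) (fun l => A (l + m.+1)%N) f' &
    Ck_bounded axes (@strip R) (k - m.+1) (fun l => A (l + m.+1)%N) g'].
  move=> mk eb; rewrite -(subnSK mk).
  have -> : (fun l => A (l + m.+1)%N) = (fun l => A (l + m)%N) \o succn.
    by apply/funext => l /=; rewrite addnS.
  move=> /(shift _ _ _ _ eb)[f' f'A f'D] /(shift _ _ _ _ eb)[g' g'A g'D].
  exists f', g'; split => //; apply: is_derive_derive => p.
  exact: is_derive_pair.
elim: i ijk => [|i IH].
  elim: j => [|j IH] jk.
    exists f, g; rewrite add0n subn0; split=> //.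
      by have -> : (fun l => A (l + 0)%N) = A by apply/funext => l; rewrite addn0.
    by have -> : (fun l => A (l + 0)%N) = A by apply/funext => l; rewrite addn0.
  have [f' [g' [e f'A g'A]]] := IH (ltnW jk).
  have [f'' [g'' [e' f''A g''A]]] := step _ _ _ _ jk mem_axis_y f'A g'A.
  exists f'', g''; split=> //.
  by rewrite -e' -[fun p => (f' p, g' p)]e.
move=> ijk; have [f' [g' [e f'A g'A]]] := IH (ltnW ijk).
have [f'' [g'' [e' f''A g''A]]] := step _ _ _ _ ijk mem_axis_x f'A g'A.
exists f'', g''; split=> //.
by rewrite -e' -[fun p => (f' p, g' p)]e.
Qed.

Lemma strip_nonempty : @strip R (0, 0).
Proof. by rewrite /strip/= ltrN10 ltr01. Qed.

Lemma strip_nonempty' : @strip R (1, 0).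
Proof. by rewrite /strip/= ltrN10 ltr01. Qed.

(** A supremum over the empty set would be -oo, so a point of the strip has to be exhibited. *)
Lemma sup_norm_ge0 (W : normedModType R) (f : R * R -> W) : (0 <= sup_norm f)%E.
Proof.
apply: (@le_trans _ _ (`|f (0, 0)|%:E)); first by rewrite lee_fin.
apply: ereal_sup_ubound; exists (0, 0) => //=; exact: strip_nonempty.
Qed.

Lemma holder_seminorm_ge0 (W : normedModType R) alpha (f : R * R -> W) :
  (0 <= holder_seminorm alpha f)%E.
Proof.
apply: (@le_trans _ _ (`|f (0, 0) - f (1, 0)| /
    `|(0, 0) - (1, 0) : R * R| `^ alpha)%:E).
  by rewrite lee_fin divr_ge0// powR_ge0.
apply: ereal_sup_ubound; exists (0, 0), (1, 0); split => //;
    [exact: strip_nonempty|exact: strip_nonempty'|by rewrite xpair_eqE eq_sym oner_eq0].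
Qed.

Lemma holder_norm_ge0 (W : normedModType R) k alpha (f : R * R -> W) :
  (0 <= holder_norm k alpha f)%E.
Proof.
apply: adde_ge0; apply: sume_ge0 => i _; last exact: holder_seminorm_ge0.
by apply: sume_ge0 => j _; exact: sup_norm_ge0.
Qed.

(* The Hoelder quotient is bounded by interpolating between the bounds on the
   derivatives of orders k and k + 1. *)
Lemma holder_norm_le k A a M alpha f g : 0 < alpha < 1 -> 0 <= a -> 0 <= M ->
  (forall j, (j <= k)%N -> A j <= a) -> A k.+1 <= M ->
  Ck_bounded axes (@strip R) k.+1 A f -> Ck_bounded axes (@strip R) k.+1 A g ->
  (holder_norm k alpha (fun p => (f p, g p)) <=
   (k.+1%:R * (k.+1%:R * a) +
    k.+1%:R * ((2 * M) `^ alpha * (2 * a) `^ (1 - alpha)))%:E)%E.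
Proof.
move=> al a0 M0 Aa AM fA gA; rewrite EFinD.
have sumle (F : 'I_k.+1 -> \bar R) (P : pred 'I_k.+1) c : 0 <= c ->
    (forall i, P i -> (F i <= c%:E)%E) ->
    (\sum_(i < k.+1 | P i) F i <= (k.+1%:R * c)%:E)%E.
  move=> c0 Fc; apply: (@le_trans _ _ (\sum_(i < k.+1) c%:E)%E).
    rewrite big_mkcond; apply: lee_sum => i _.
    by case: ifP => [/Fc|]//; rewrite lee_fin.
  by rewrite sumEFin big_const_ord iter_addr_0 mulr_natl.
have supb i j : (i + j <= k)%N ->
    (sup_norm (partial i j (fun p => (f p, g p))) <= a%:E)%E.
  move=> ijk; have ijk1 : (i + j <= k.+1)%N by exact: leqW.
  have [f' [g' [-> f'A g'A]]] := partial_pair ijk1 fA gA.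
  apply: ge_ereal_sup => _ [p sp <-]; rewrite lee_fin norm_pair ge_max.
  have Aija := Aa _ ijk.
  have f'a := le_trans (Ck_bounded_le f'A sp) Aija.
  have g'a := le_trans (Ck_bounded_le g'A sp) Aija.
  exact/andP.
apply: leeD; (apply: (@sumle); [by rewrite mulr_ge0 ?powR_ge0|move=> i _]).
- by apply: sumle => // j; exact: supb.
- have ik : (i <= k)%N by rewrite -ltnS.
  have ijk1 : (i + (k - i) <= k.+1)%N by rewrite subnKC.
  have [f' [g' [-> f'A g'A]]] := partial_pair ijk1 fA gA.
  move: f'A g'A; rewrite subnKC// subSnn => f'A g'A.
  apply: ge_ereal_sup => _ [p [q [sp sq pq ->]]]; rewrite lee_fin.
  have pq0 : 0 < `|p - q| by rewrite normr_gt0 subr_eq0.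
  rewrite ler_pdivrMr ?powR_gt0// mulrAC -powRM ?mulr_ge0//.
  (* The difference is at most 2 M |p - q| by the Lipschitz bound and at most 2 a by the triangle
     inequality; interpolation keeps |p - q|^alpha and the factor (2 a)^(1 - alpha). *)
  have comp h : Ck_bounded axes (@strip R) 1 (fun l => A (l + k)%N) h ->
      `|h p - h q| <= (2 * M * `|p - q|) `^ alpha * (2 * a) `^ (1 - alpha).
    move=> hA; apply: interpolation => //.
      apply: le_trans (Ck_bounded_lipschitz hA sp sq) _.
      by rewrite ler_wpM2r// ler_wpM2l// add1n.
    rewrite (le_trans (ler_normB _ _))// -[2 * a]/((1 + 1) * a) mulrDl mul1r lerD//;
      apply: le_trans (Ck_bounded_le hA _) _ => //; exact: Aa.
  have -> : (f' p, g' p) - (f' q, g' q) = (f' p - f' q, g' p - g' q) by [].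
  by rewrite norm_pair ge_max !comp.
Qed.

End HolderEstimates.

(** * Functions on the strip *)

Lemma Ck_upto_pred (R : realType) (E W : normedModType R) (b : seq E) (D : set E)
    k (f : E -> W) : Ck_upto b D k.+1 f -> Ck_upto b D k f.
Proof.
elim: k f => [|k IH] f [fc fD]; first by split.
split=> // e /fD[fe [g [gk gE]]]; split=> //.
by exists g; split=> //; exact: IH.
Qed.

Section Extensionality.
Variable R : realType.

(** As D is open, f and g agree near each of its points and have the same derivatives there. *)
Lemma Ck_upto_ext (E W : normedModType R) (b : seq E) (D : set E) k
    (f g : E -> W) : open D -> (forall p, closure D p -> f p = g p) ->
  Ck_upto b D k f -> Ck_upto b D k g.
Proof.
move=> Dop fg.
have cont h : {within closure D, continuous f} ->
    (forall p, closure D p -> f p = h p) -> {within closure D, continuous h}.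
  move=> fc fh; apply: (@subspace_eq_continuous _ _ _ f) => // p.
  by rewrite inE; exact: fh.
have near p : D p -> \forall q \near p, f q = g q.
  move=> Dp; have := open_nbhs_nbhs (conj Dop Dp).
  by apply: filterS => q Dq; apply/fg/subset_closure.
case: k => [|k] [fc fD]; split=> //; [exact: cont..|].
move=> e /fD[fe [h [hk hD]]]; split=> [p Dp|].
  by apply: near_eq_derivable (fe p Dp); exact: near.
exists h; split=> // p Dp; rewrite hD//.
by apply: near_eq_derive; exact: near.
Qed.

Lemma open_strip : open (@strip R).
Proof.
have -> : @strip R = (snd : R * R -> R) @^-1` `]-1, 1[.
  by apply/funext => p; apply/propext; rewrite /strip/= in_itv.
apply: open_comp; last exact: interval_open.
by move=> p _; exact: cvg_snd.
Qed.

Lemma closure_strip : closure (@strip R) `<=` @cstrip R.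
Proof.
have -> : @cstrip R = (snd : R * R -> R) @^-1` `[-1, 1].
  by apply/funext => p; apply/propext; rewrite /cstrip/= in_itv.
have c : closed ((snd : R * R -> R) @^-1` `[-1, 1]).
  apply: preimage_closed; last exact: interval_closed.
  by move=> p _; exact: cvg_snd.
rewrite ((closure_id _).1 c); apply: closureS => p /andP[p1 p2] /=.
by rewrite in_itv/= !ltW.
Qed.

Lemma strip_cstrip : @strip R `<=` @cstrip R.
Proof. by move=> p /andP[p1 p2]; rewrite /cstrip/= !ltW. Qed.

Lemma Ck_M_ext (W : normedModType R) k (f g : R * R -> W) :
  (forall p, cstrip p -> f p = g p) -> Ck_M k f -> Ck_M k g.
Proof.
move=> fg; apply: Ck_upto_ext; first exact: open_strip.
by move=> p /closure_strip; exact: fg.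
Qed.

Lemma partial_ext (W : normedModType R) i j (f g : R * R -> W) :
  (forall p, strip p -> f p = g p) ->
  forall p, strip p -> partial i j f p = partial i j g p.
Proof.
have ext e (h h' : R * R -> W) : (forall p, strip p -> h p = h' p) ->
    forall p, strip p -> 'D_e h p = 'D_e h' p.
  move=> hh p sp; apply: near_eq_derive.
  by have := open_nbhs_nbhs (conj open_strip sp); apply: filterS => q /hh.
move=> fg; elim: i => [|i IH]; last exact: ext.
by elim: j => [|j IH]; [exact: fg|exact: ext].
Qed.

Lemma holder_norm_ext (W : normedModType R) k alpha (f g : R * R -> W) :
  (forall p, strip p -> f p = g p) -> holder_norm k alpha f = holder_norm k alpha g.
Proof.
move=> fg; rewrite /holder_norm; congr (_ + _)%E.
  apply: eq_bigr => i _; apply: eq_bigr => j _; rewrite /sup_norm; congr ereal_sup.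
  by apply/seteqP; split=> _ [p sp <-]; exists p => //; rewrite (partial_ext i j fg).
apply: eq_bigr => i _; rewrite /holder_seminorm; congr ereal_sup.
apply/seteqP; split=> _ [p [q [sp sq pq ->]]]; exists p, q; split=> //;
  by rewrite !(partial_ext i _ fg).
Qed.

Lemma holder_space_ext (W : normedModType R) k alpha (f g : R * R -> W) :
  (forall p, cstrip p -> f p = g p) ->
  holder_space k alpha f -> holder_space k alpha g.
Proof.
move=> fg [fp fk fn]; split.
- by move=> p sp; rewrite -!fg//; exact: fp.
- exact: Ck_M_ext fg fk.
- by rewrite -(holder_norm_ext _ _ (fun p sp => fg p (strip_cstrip sp))).
Qed.

End Extensionality.

(** * Profiles that vanish to finite order *)

Section VanishingProfile.
Variable R : realType.
Implicit Types (v f : R -> R) (g : nat -> R -> R) (x y : R).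

Lemma closure_segment : closure [set y : R | -1 < y < 1] = `[-1, 1]%classic.
Proof.
have -> : [set y : R | -1 < y < 1] = ball (0 : R) 1.
  by rewrite ball_itv sub0r add0r; apply/seteqP; split=> y /=; rewrite in_itv.
by rewrite -[closure _]/(closed_ball (0 : R) 1) closed_ball_itv// sub0r add0r.
Qed.

(** [g j] is the continuous extension to [-1, 1] of the derivative of order j, extracted from the
    nested existentials of [Ck_upto]. *)
Lemma Ck_segment_derivatives k v : Ck_segment k v -> exists g,
  [/\ g 0%N = v, (forall j, (j <= k)%N -> {within `[-1, 1], continuous (g j)}) &
  forall j y, (j < k)%N -> -1 < y < 1 -> is_derive y 1 (g j) (g j.+1 y)].
Proof.
rewrite /Ck_segment; elim: k v => [|k IH] v; rewrite /= closure_segment => -[vc].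
  move=> _; exists (fun=> v); split=> // j.
move=> /(_ 1 (mem_head _ _))[vD [v' [/IH[g [g0 gc gD]] v'E]]].
exists (fun j => if j is j'.+1 then g j' else v); split=> //.
  by case=> // j; exact: gc.
case=> [|j] y jk y1; last exact: gD.
by rewrite g0 v'E//; apply/derivableP/vD.
Qed.

Lemma derive1n_derivatives k v g : g 0%N = v ->
  (forall j y, (j < k)%N -> -1 < y < 1 -> is_derive y 1 (g j) (g j.+1 y)) ->
  forall j y, (j <= k)%N -> -1 < y < 1 -> derive1n j v y = g j y.
Proof.
move=> g0 gD; elim=> [|j IH] y jk y1; first by rewrite derive1n0 g0.
rewrite derive1nS derive1E.
have -> : 'D_1 (derive1n j v) y = 'D_1 (g j) y.
  apply: near_eq_derive.
  have yI : y \in `]-1, 1[ by rewrite in_itv.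
  have := near_in_itvoo yI; apply: filterS => z; rewrite in_itv/= => z1.
  by apply: IH => //; exact: ltnW.
by case: (gD j y jk y1).
Qed.

(** Retraction onto [-1, 1]: precomposing with it extends a function continuous on the segment to
    one continuous on the line. *)
Definition clamp y : R := Num.max (-1) (Num.min 1 y).

Lemma clamp_itv y : clamp y \in `[-1, 1].
Proof.
by rewrite in_itv/= le_max lexx ge_max ge_min lexx/= andbT; lra.
Qed.

Lemma clampK y : -1 <= y <= 1 -> clamp y = y.
Proof. by move=> /andP[y1 y2]; rewrite /clamp min_r// max_r. Qed.

Lemma continuous_clamp : continuous clamp.
Proof.
rewrite /clamp => y.
apply: (@continuous_max _ _ (fun=> -1) (fun y => Num.min 1 y)); first exact: cvg_cst.
by apply: (@continuous_min _ _ (fun=> 1) id); [exact: cvg_cst|exact: cvg_id].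
Qed.

Lemma continuous_comp_clamp f : {within `[-1, 1], continuous f} ->
  continuous (f \o clamp).
Proof.
move=> /subspace_continuousP fc y.
have fy := fc (clamp y) (clamp_itv y).
apply: cvg_comp fy => P /=; rewrite /within/= => PN.
have : \forall z \near y, `[-1, 1]%classic (clamp z) -> P (clamp z).
  exact: (@continuous_clamp y _ PN).
by apply: filterS => z; apply; exact: clamp_itv.
Qed.

(* All derivatives of v of order less than n vanish at y0, so v is the n-fold
   primitive of its n-th derivative. *)
Lemma vanishing_profile_primitive n v (y0 : R) : (0 < n)%N -> Ck_segment n v ->
  -1 < y0 < 1 -> \sum_(0 <= i < n) `|derive1n i v y0| = 0 ->
  exists2 f, continuous f & forall y, -1 <= y <= 1 -> v y = iter_primitive y0 n f y.
Proof.
move=> n0 /Ck_segment_derivatives[g [g0 gc gD]] y01 vsum.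
have gy0 j : (j < n)%N -> g j y0 = 0.
  move=> jn; rewrite -(derive1n_derivatives g0 gD (ltnW jn) y01).
  move/eqP: vsum; rewrite big_mkord psumr_eq0//.
  by move=> /allP/(_ (Ordinal jn) (mem_index_enum _)) /=; rewrite normr_eq0 => /eqP.
pose f := g n \o clamp; exists f; first exact/continuous_comp_clamp/gc.
have fc : continuous f by exact/continuous_comp_clamp/gc.
pose P := [set y : R | -1 < y < 1].
have Pc : order_convex P.
  move=> x y z /andP[x1 _] /andP[_ y1] /andP[xz zy]; rewrite /P/=.
  by rewrite (lt_le_trans x1)// (le_lt_trans zy).
have gE j y : (j <= n)%N -> P y -> g (n - j)%N y = iter_primitive y0 j f y.
  move=> jn; apply: (@iter_primitive_eq R P y0 j f (fun i => g (n - i)%N)) => //.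
  - by move=> z /andP[z1 z2]; rewrite subn0 /f/= clampK// !ltW.
  - move=> i z ij Pz; rewrite -(subnSK (leq_trans ij jn)).
    apply: gD => //.
    by rewrite subnSK ?leq_subr// (leq_trans ij jn).
  - by move=> i ij; apply: gy0; rewrite ltn_subrL.
move=> y y1; case: n n0 g0 gc gD gy0 f fc gE {vsum} => // n _ g0 gc gD gy0 f fc gE.
(* [gE] holds in the open interval only. The endpoints are reached through the difference h,
   continuous on [-1, 1] with derivative 0 inside. *)
pose h := v \- iter_primitive y0 n.+1 f.
have hc : {within `[-1, 1], continuous h}.
  apply: within_continuousB; first by rewrite -g0; exact: gc.
  by apply: continuous_subspaceT; exact: continuous_iter_primitive.
have hD x : P x -> is_derive x 1 h 0.
  move=> Px; have := gD 0%N x isT Px; rewrite g0.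
  have -> : g 1%N x = iter_primitive y0 n f x by rewrite -gE// subSnn.
  move=> Dv.
  have Dw := is_derive_iter_primitive y0 n x fc.
  by have := @is_deriveB R R R _ _ x 1 _ _ Dv Dw; rewrite subrr.
have h0 : h y0 = 0.
  rewrite -[h y0]/(v y0 - iter_primitive y0 n.+1 f y0) iter_primitive_base//.
  by rewrite subr0 -g0 gy0.
have eqh a b : -1 <= a -> a <= b -> b <= 1 -> -1 < b -> a < 1 -> h b = h a.
  move=> a1 ab b1 b0 a0; have [||c _ ] := @MVT_segment R h (fun=> 0) a b ab.
  - move=> x /[!in_itv]/= /andP[ax xb]; apply: hD; rewrite /P/=.
    by rewrite (le_lt_trans a1)// (lt_le_trans xb).
  - apply: continuous_subspaceW hc => x /=; rewrite !in_itv/= => /andP[ax xb].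
    by rewrite (le_trans a1)// (le_trans xb).
  - by rewrite mul0r => /subr0_eq.
suff : h y = 0 by move/subr0_eq.
have /andP[y01a y01b] := y01; have /andP[y1a y1b] := y1.
rewrite -h0; have [yy|yy] := leP y0 y.
  by apply: eqh => //; [exact: ltW|exact: lt_le_trans yy].
by apply/esym/eqh => //; [exact: ltW..|exact: lt_trans yy y01b].
Qed.

End VanishingProfile.

(** * Angles modulo 2 pi *)

Section AngleReduction.
Variable R : realType.
Implicit Types x : R.

(** Index of the multiple of 2 pi nearest to x, so that [reduce x] is the representative of x in
    [-pi, pi). *)
Definition turns x : int := Num.floor ((x + pi) / (2 * pi)).
Definition reduce x : R := x - 2 * pi * (turns x)%:~R.

Lemma reduce_le_pi x : `|reduce x| <= pi.
Proof.
have pi0 : 0 < 2 * pi :> R by rewrite mulr_gt0// pi_gt0.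
have /andP[] := floor_itv ((x + pi) / (2 * pi)).
rewrite -/(turns x) ler_pdivlMr// ltr_pdivrMr// intrD => h1 h2.
by rewrite ler_norml /reduce; apply/andP; split; lra.
Qed.

Lemma intr_nat_or_opp (m : int) :
  exists n : nat, m%:~R = n%:R :> R \/ m%:~R = - n%:R :> R.
Proof.
by case: m => n; [exists n; left|exists n.+1; right; rewrite NegzE mulrNz].
Qed.

Lemma cosD_2pin x (n : nat) : cos (x + 2 * pi * n%:R) = cos x.
Proof.
rewrite -[RHS](periodicn (@cosD2pi R) n); congr cos.
by rewrite mulr_natr mulr_natl.
Qed.

Lemma cos_periodic x (m : int) : cos (x - 2 * pi * m%:~R) = cos x.
Proof.
have [n [->|->]] := intr_nat_or_opp m.
  by rewrite -(cosD_2pin (x - _) n) subrK.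
by rewrite mulrN opprK cosD_2pin.
Qed.

Lemma cos_reduce x : cos (reduce x) = cos x.
Proof. exact: cos_periodic. Qed.

End AngleReduction.

(** * Periodisation *)

Section ProductDerivatives.
Variable R : realType.
Implicit Types (f g : R * R -> R) (p : R * R).

Lemma is_derive_snd (phi : R -> R) p d : is_derive p.2 1 phi d ->
  is_derive p ((0, 1) : R * R) (fun q => phi q.2) d.
Proof.
apply: (@is_derive_affine R _ _ _ snd phi) => h /=.
by rewrite [h *: 1]mulr1.
Qed.

Lemma is_derive_snd0 (phi : R -> R) p :
  is_derive p ((1, 0) : R * R) (fun q => phi q.2) 0.
Proof.
apply: (@is_derive_affine R _ _ _ snd phi p (1, 0) 0 0) => [h|].
  by rewrite /= scaler0.
exact: is_derive0.
Qed.

Lemma is_derive_fst0 (phi : R -> R) p :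
  is_derive p ((0, 1) : R * R) (fun q => phi q.1) 0.
Proof.
apply: (@is_derive_affine R _ _ _ fst phi p (0, 1) 0 0) => [h|].
  by rewrite /= scaler0.
exact: is_derive0.
Qed.

Lemma is_derive_translate f c p (e : R * R) d :
  is_derive (p.1 - c, p.2) e f d ->
  is_derive p e (fun q => f (q.1 - c, q.2)) d.
Proof.
apply: (@is_derive_affine R _ _ _ (fun q : R * R => (q.1 - c, q.2)) f) => h.
by congr (_, _); rewrite /= addrA.
Qed.

Lemma continuous_translate f c : continuous f ->
  continuous (fun q => f (q.1 - c, q.2)).
Proof.
move=> fc; have tc : continuous (fun q : R * R => (q.1 - c, q.2)).
  apply: continuous_pair => q; last exact: cvg_snd.
  by apply: cvgB; [exact: cvg_fst|exact: cvg_cst].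
by move=> p; apply: continuous_comp; [exact: tc|exact: fc].
Qed.

Lemma Ck_bounded_translate k A f c (D : set (R * R)) :
  (forall p, D p -> D (p.1 - c, p.2)) -> Ck_bounded (axes R) D k A f ->
  Ck_bounded (axes R) D k A (fun q => f (q.1 - c, q.2)).
Proof.
move=> Dc; elim: k A f => [|k IH] A f [fc fA fD]; split => //.
- exact: continuous_translate.
- by move=> p /Dc/fA.
- exact: continuous_translate.
- by move=> p /Dc/fA.
- move=> e /fD[g gA gD]; exists (fun q => g (q.1 - c, q.2)); first exact: IH.
  by move=> p; exact: is_derive_translate.
Qed.

End ProductDerivatives.

Section Periodic.
Variable R : realType.
Implicit Types (f g : R * R -> R) (p q : R * R) (x : R).

Definition periodic_x f := forall p, f (p.1 + 2 * pi, p.2) = f p.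

Lemma periodic_x_int f p (m : int) : periodic_x f ->
  f (p.1 - 2 * pi * m%:~R, p.2) = f p.
Proof.
move=> fp; have fn (n : nat) q : f (q.1 + 2 * pi * n%:R, q.2) = f q.
  elim: n => [|n IH]; first by rewrite mulr0 addr0 -surjective_pairing.
  rewrite -[n.+1%:R]natr1 mulrDr mulr1 addrA -[RHS]IH.
  exact: (fp (q.1 + 2 * pi * n%:R, q.2)).
have [n [->|->]] := @intr_nat_or_opp R m.
  have := fn n (p.1 - 2 * pi * n%:R, p.2); rewrite /= subrK => <-.
  by rewrite -surjective_pairing.
by rewrite mulrN opprK fn.
Qed.

Lemma continuous_periodic_bounded f : continuous f -> periodic_x f ->
  exists2 M, 0 <= M & forall p, cstrip p -> `|f p| <= M.
Proof.
move=> fc fp; pose K := (`[- pi, pi] `*` `[-1, 1] : set (R * R)).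
have Kc : compact K by apply: compact_setX; exact: segment_compact.
have K0 : K !=set0.
  exists (0, 0); split; rewrite /= in_itv/= ?ler01 ?lerN10//.
  by rewrite oppr_le0 andbb pi_ge0.
have cf : {within K, continuous (fun p => `|f p|)}.
  apply: continuous_subspaceT => p.
  by apply: cvg_norm; exact: fc.
have [c _ cmax] := compact_EVT_max K0 Kc cf.
exists `|f c| => // p sp; rewrite -(periodic_x_int p (turns p.1) fp).
apply: cmax; rewrite inE; split; rewrite /= in_itv/=; last exact: sp.
by rewrite -ler_norml; exact: reduce_le_pi.
Qed.

Lemma periodic_x_derive f g (e : R * R) : (forall p, is_derive p e f (g p)) ->
  periodic_x f -> periodic_x g.
Proof.
move=> fg fp p; have [_ <-] := fg p.
have : is_derive p e (fun q => f (q.1 - - (2 * pi), q.2)) (g (p.1 + 2 * pi, p.2)).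
  apply: is_derive_translate; rewrite opprK; exact: fg.
have -> : (fun q => f (q.1 - - (2 * pi), q.2)) = f.
  by apply/funext => q; rewrite opprK fp.
by move=> [_ <-].
Qed.

(** Partial derivatives of a periodic function are periodic, so each of the finitely many is bounded
    on the strip by compactness of one period; one constant dominates them all. *)
Lemma Ck_global_periodic_bounded k f : Ck_global (axes R) k f -> periodic_x f ->
  exists2 M, 0 <= M & Ck_bounded (axes R) (@strip R) k (fun=> M) f.
Proof.
elim: k f => [|k IH] f [fc _ fD] fp;
    have [M M0 fM] := continuous_periodic_bounded fc fp.
  by exists M => //; split=> // p /strip_cstrip; exact: fM.
have [fx fxk fxD] := fD _ (mem_axis_x R); have [fy fyk fyD] := fD _ (mem_axis_y R).
have [Mx Mx0 fxM] := IH fx fxk (periodic_x_derive fxD fp).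
have [My My0 fyM] := IH fy fyk (periodic_x_derive fyD fp).
exists (M + Mx + My); first by rewrite !addr_ge0.
split=> //.
  by move=> p /strip_cstrip/fM/le_trans; apply; rewrite -addrA lerDl addr_ge0.
move=> e; rewrite !inE => /orP[]/eqP->; [exists fx|exists fy] => //.
- by apply: Ck_bounded_weaken fxM => // j _ _ /=; lra.
- by apply: Ck_bounded_weaken fyM => // j _ _ /=; lra.
Qed.

Lemma reduceD2pi x : reduce (x + 2 * pi) = reduce x.
Proof.
have pi0 : 2 * pi != 0 :> R by rewrite mulf_neq0 ?pnatr_eq0// gt_eqF// pi_gt0.
have tE : turns (x + 2 * pi) = turns x + 1.
  rewrite /turns addrAC mulrDl divff//.
  by rewrite -[1 in LHS]/(1%:~R) floorDrz ?intr_int// intrKfloor.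
rewrite /reduce tE intrD mulr1z; move: (2 * pi) (_%:~R) => a b.
by ring.
Qed.

(** Not a sum over translates: f is evaluated at the representative in [-pi, pi). For [thin] f the
    jump of [reduce] falls where f vanishes, so no regularity is lost. *)
Definition periodize f p : R := f (reduce p.1, p.2).

Lemma periodic_x_periodize f : periodic_x (periodize f).
Proof. by move=> p; rewrite /periodize/= reduceD2pi. Qed.

Definition thin f := forall p, 1 < `|p.1| -> f p = 0.

Lemma near_periodize f p : thin f ->
  \forall q \near p, f (q.1 - 2 * pi * (turns p.1)%:~R, q.2) = periodize f q.
Proof.
move=> ft; near=> q.
have pq : `|p.1 - q.1| < 4^-1.
  near: q; have e0 : 0 < 4^-1 :> R by rewrite invr_gt0.
  by apply: filterS (nbhsx_ballx p _ e0) => q [].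
rewrite /periodize; have [<-//|tt] := eqVneq (turns q.1) (turns p.1).
(* If q has another number of turns, the two arguments differ by at least 2 pi, while their moduli
   are at most pi and pi + 1/4; so both moduli exceed 1, and f vanishes at both. *)
have rp := reduce_le_pi p.1; have rq := reduce_le_pi q.1.
have p2 := @pi_ge2 R.
have d1 : 1 <= `|(turns p.1)%:~R - (turns q.1)%:~R : R|.
  rewrite -intrB -intr_norm -[1]/(1%:~R) ler_int.
  by rewrite -gtz0_ge1 normr_gt0 subr_eq0 eq_sym.
have d2 : 2 * pi <= `|2 * pi * ((turns p.1)%:~R - (turns q.1)%:~R) : R|.
  rewrite normrM ger0_norm; last by rewrite mulr_ge0// pi_ge0.
  by rewrite ler_peMr// mulr_ge0// pi_ge0.
have e1 : 2 * pi * ((turns p.1)%:~R - (turns q.1)%:~R) =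
    reduce q.1 - reduce p.1 + (p.1 - q.1) :> R.
  by rewrite /reduce; move: pi (_%:~R) (_%:~R) => a b c; ring.
have e2 : q.1 - 2 * pi * (turns p.1)%:~R = reduce p.1 - (p.1 - q.1) :> R.
  by rewrite /reduce; move: pi (_%:~R) => a b; ring.
have n1 := ler_normB (reduce q.1) (reduce p.1 - (p.1 - q.1)).
have n2 := ler_normB (reduce p.1) (p.1 - q.1).
have e3 : reduce q.1 - (reduce p.1 - (p.1 - q.1)) =
    2 * pi * ((turns p.1)%:~R - (turns q.1)%:~R).
  by rewrite e1 opprB addrA addrAC.
rewrite e3 in n1; rewrite !ft//= ?e2; lra.
Unshelve. all: by end_near. Qed.

Lemma is_derive_periodize f g (e : R * R) p : thin f ->
  (forall p, is_derive p e f (g p)) -> is_derive p e (periodize f) (periodize g p).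
Proof.
move=> ft fg; apply: (near_eq_is_derive (near_periodize p ft)).
by apply: is_derive_translate; exact: fg.
Qed.

Lemma continuous_periodize f : thin f -> continuous f -> continuous (periodize f).
Proof.
move=> ft fc p.
have fE := near_periodize p ft.
have := @continuous_translate _ f (2 * pi * (turns p.1)%:~R) fc p.
rewrite /continuous_at -(nbhs_singleton fE) => cv.
exact: cvg_trans (near_eq_cvg fE) cv.
Qed.

Lemma thin_derive f g (e : R * R) : thin f -> (forall p, is_derive p e f (g p)) ->
  thin g.
Proof.
move=> ft fg p p1; have [_ <-] := fg p.
have /(@near_eq_derive _ _ _ f (cst 0) p e) -> : \forall q \near p, f q = 0.
  near=> q; apply: ft; near: q.
  apply: (@cvgr_gt _ _ _ _ (fun q : R * R => `|q.1|) `|p.1|) p1.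
  by apply: cvg_norm; exact: cvg_fst.
by rewrite derive_cst.
Unshelve. all: by end_near. Qed.

Lemma Ck_global_periodize k f : thin f -> Ck_global (axes R) k f ->
  Ck_global (axes R) k (periodize f).
Proof.
elim: k f => [|k IH] f ft [fc _ fD].
  by split=> //; exact: continuous_periodize.
split=> //; first exact: continuous_periodize.
move=> e /fD[g gk gD]; exists (periodize g).
  by apply: IH => //; exact: thin_derive gD.
by move=> p; exact: is_derive_periodize.
Qed.

End Periodic.

(** * Steady vortices *)

(* Radial vortex of radius rho centred at (0, z). *)
Section Vortex.
Variables (R : realType) (l : nat) (rho z : R).
Implicit Types p : R * R.

Local Notation dir_x := ((1, 0) : R * R).
Local Notation dir_y := ((0, 1) : R * R).

Definition vortex_height p : R := rho ^+ 2 - (p.1 ^+ 2 + (p.2 - z) ^+ 2).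
Let H := vortex_height.
Definition vortex_speed p : R := pos_pow l.+1 (H p).
Let G := vortex_speed.
Let g p : R := l.+2%:R * pos_pow l (H p).

(** The rotation (-(y - z), x) with angular speed [G], a function of the radius; it is tangent to
    the circles on which [G] is constant. *)
Definition vortex1 p : R := - ((p.2 - z) * G p).
Definition vortex2 p : R := p.1 * G p.
(** A primitive of -G^2 / 2 with respect to [H]: its gradient G^2 (x, y - z) balances the
    centripetal acceleration. *)
Definition vortex_pressure p : R :=
  - (2 * (2 * l.+1).+3%:R)^-1 * pos_pow (2 * l.+1).+2 (H p).

Definition vortex1x p : R := 2 * p.1 * (p.2 - z) * g p.
Definition vortex1y p : R := - G p + 2 * (p.2 - z) ^+ 2 * g p.
Definition vortex2x p : R := G p - 2 * p.1 ^+ 2 * g p.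
Definition vortex2y p : R := - (2 * p.1 * (p.2 - z) * g p).
Definition vortex_pressurex p : R := p.1 * G p ^+ 2.
Definition vortex_pressurey p : R := (p.2 - z) * G p ^+ 2.

Lemma is_derive_fst_x p : is_derive p dir_x (fun q : R * R => q.1) 1.
Proof.
apply: (@is_derive_affine R _ _ _ fst id) => //.
Qed.

Lemma is_derive_fst_y p : is_derive p dir_y (fun q : R * R => q.1) 0.
Proof. exact: (is_derive_fst0 id). Qed.

Lemma is_derive_vortex_height_x p : is_derive p dir_x H (- (2 * p.1)).
Proof.
have D := is_derive_fst_x p; have D2 := @is_deriveM _ _ _ _ _ _ _ _ D D.
have Dy := is_derive_snd0 (fun y => rho ^+ 2 - (y - z) ^+ 2) p.
have := @is_deriveB _ _ _ _ _ _ _ _ _ Dy D2.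
have -> : (fun q : R * R => rho ^+ 2 - (q.2 - z) ^+ 2) -
    (fun q : R * R => q.1) * (fun q => q.1) = H.
  by apply/funext => q; rewrite /H /vortex_height !fctE; ring.
move/is_derive_eq; apply.
by transitivity (0 - (p.1 * 1 + p.1 * 1)); [by []|ring].
Qed.

Lemma is_derive_vortex_height_y p : is_derive p dir_y H (- (2 * (p.2 - z))).
Proof.
have D0 : is_derive p.2 1 (fun y : R => y - z) 1.
  apply: (@is_derive_quadratic _ _ _ _ 0) => w.
  by rewrite mul0r normr_le0; apply/eqP; ring.
have D := is_derive_snd D0; have D2 := @is_deriveM _ _ _ _ _ _ _ _ D D.
have Dx : is_derive p dir_y (fun q : R * R => rho ^+ 2 - q.1 ^+ 2) 0.
  exact: (is_derive_fst0 (fun x => rho ^+ 2 - x ^+ 2)).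
have := @is_deriveB _ _ _ _ _ _ _ _ _ Dx D2.
have -> : (fun q : R * R => rho ^+ 2 - q.1 ^+ 2) -
    (fun q : R * R => q.2 - z) * (fun q => q.2 - z) = H.
  by apply/funext => q; rewrite /H /vortex_height !fctE; ring.
move/is_derive_eq; apply.
by transitivity (0 - ((p.2 - z) * 1 + (p.2 - z) * 1)); [by []|ring].
Qed.

Lemma is_derive_vortex_speed_x p : is_derive p dir_x G (- (2 * p.1 * g p)).
Proof.
have := is_derive_comp (is_derive_vortex_height_x p) (is_derive_pos_pow l (H p)).
by move/is_derive_eq; apply; rewrite /g; ring.
Qed.

Lemma is_derive_vortex_speed_y p : is_derive p dir_y G (- (2 * (p.2 - z) * g p)).
Proof.
have := is_derive_comp (is_derive_vortex_height_y p) (is_derive_pos_pow l (H p)).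
by move/is_derive_eq; apply; rewrite /g; ring.
Qed.

Lemma is_derive_sndB_x p : is_derive p dir_x (fun q : R * R => q.2 - z) 0.
Proof. exact: (is_derive_snd0 (fun y => y - z)). Qed.

Lemma is_derive_sndB_y p : is_derive p dir_y (fun q : R * R => q.2 - z) 1.
Proof.
apply: (@is_derive_snd _ (fun y => y - z)).
apply: (@is_derive_quadratic _ _ _ _ 0) => w.
by rewrite mul0r normr_le0; apply/eqP; ring.
Qed.

Lemma is_derive_vortex1_x p : is_derive p dir_x vortex1 (vortex1x p).
Proof.
have := @is_deriveN _ _ _ _ _ _ _ (@is_deriveM _ _ _ _ _ _ _ _ (is_derive_sndB_x p) (is_derive_vortex_speed_x p)).
move/is_derive_eq; apply.
by transitivity (- ((p.2 - z) * - (2 * p.1 * g p) + G p * 0));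
  [by []|rewrite /vortex1x; ring].
Qed.

Lemma is_derive_vortex1_y p : is_derive p dir_y vortex1 (vortex1y p).
Proof.
have := @is_deriveN _ _ _ _ _ _ _ (@is_deriveM _ _ _ _ _ _ _ _ (is_derive_sndB_y p) (is_derive_vortex_speed_y p)).
move/is_derive_eq; apply.
by transitivity (- ((p.2 - z) * - (2 * (p.2 - z) * g p) + G p * 1));
  [by []|rewrite /vortex1y; ring].
Qed.

Lemma is_derive_vortex2_x p : is_derive p dir_x vortex2 (vortex2x p).
Proof.
have := @is_deriveM _ _ _ _ _ _ _ _ (is_derive_fst_x p) (is_derive_vortex_speed_x p).
move/is_derive_eq; apply.
by transitivity (p.1 * - (2 * p.1 * g p) + G p * 1);
  [by []|rewrite /vortex2x; ring].
Qed.

Lemma is_derive_vortex2_y p : is_derive p dir_y vortex2 (vortex2y p).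
Proof.
have := @is_deriveM _ _ _ _ _ _ _ _ (is_derive_fst_y p) (is_derive_vortex_speed_y p).
move/is_derive_eq; apply.
by transitivity (p.1 * - (2 * (p.2 - z) * g p) + G p * 0);
  [by []|rewrite /vortex2y; ring].
Qed.

Lemma vortex_speed_sqr p : pos_pow (2 * l.+1).+1 (H p) = G p ^+ 2.
Proof.
rewrite /G /vortex_speed; have [h|h] := leP (H p) 0.
  by rewrite !pos_pow_le0// expr0n.
by rewrite !pos_pow_ge0 ?ltW// -exprM; congr (_ ^+ _); rewrite mulnC; lia.
Qed.

Lemma is_derive_vortex_pressure_x p :
  is_derive p dir_x vortex_pressure (vortex_pressurex p).
Proof.
have := is_derive_comp (is_derive_vortex_height_x p)
  (is_derive_pos_pow (2 * l.+1).+1 (H p)).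
move=> D; have := @is_deriveZ _ _ _ _ (- (2 * (2 * l.+1).+3%:R)^-1) _ _ _ D.
move/is_derive_eq; apply; rewrite vortex_speed_sqr /vortex_pressurex.
transitivity (- (2 * (2 * l.+1).+3%:R)^-1 * ((2 * l.+1).+3%:R * G p ^+ 2 * - (2 * p.1)));
  first by [].
have : (2 * l.+1).+3%:R != 0 :> R by rewrite pnatr_eq0.
by move: (_.+3%:R) (G p) => c a c0; field.
Qed.

Lemma is_derive_vortex_pressure_y p :
  is_derive p dir_y vortex_pressure (vortex_pressurey p).
Proof.
have := is_derive_comp (is_derive_vortex_height_y p)
  (is_derive_pos_pow (2 * l.+1).+1 (H p)).
move=> D; have := @is_deriveZ _ _ _ _ (- (2 * (2 * l.+1).+3%:R)^-1) _ _ _ D.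
move/is_derive_eq; apply; rewrite vortex_speed_sqr /vortex_pressurey.
transitivity (- (2 * (2 * l.+1).+3%:R)^-1 * ((2 * l.+1).+3%:R * G p ^+ 2 * - (2 * (p.2 - z))));
  first by [].
have : (2 * l.+1).+3%:R != 0 :> R by rewrite pnatr_eq0.
by move: (_.+3%:R) (G p) => c a c0; field.
Qed.

Lemma vortex_divergence p : vortex1x p + vortex2y p = 0.
Proof. by rewrite /vortex1x /vortex2y; ring. Qed.

(** The terms in [g] cancel because the velocity is tangent to the level lines of [G]; what remains
    is the centripetal acceleration. With [G] and [g] as unknowns this is a polynomial identity. *)
Lemma vortex_steady1 p : vortex1 p * vortex1x p + vortex2 p * vortex1y p =
  - vortex_pressurex p.
Proof. by rewrite /vortex1 /vortex1x /vortex2 /vortex1y /vortex_pressurex; ring. Qed.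

Lemma vortex_steady2 p : vortex1 p * vortex2x p + vortex2 p * vortex2y p =
  - vortex_pressurey p.
Proof. by rewrite /vortex1 /vortex2x /vortex2 /vortex2y /vortex_pressurey; ring. Qed.

Lemma vortex_height_le0_x p : 0 < rho <= 1 -> 1 < `|p.1| -> H p <= 0.
Proof.
move=> /andP[r0 r1] p1; rewrite subr_le0.
apply: (@le_trans _ _ 1); first by rewrite expr_le1// ltW.
rewrite -[1]addr0 lerD ?sqr_ge0//.
by rewrite -real_normK ?num_real// -[1](expr1n _ 2) lerXn2r ?nnegrE// ltW.
Qed.

Lemma vortex_height_le0_y p : 0 < rho -> rho <= `|p.2 - z| -> H p <= 0.
Proof.
move=> r0 p2; rewrite subr_le0 -[rho ^+ 2]add0r lerD ?sqr_ge0//.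
by rewrite -[leRHS]real_normK ?num_real// lerXn2r ?nnegrE// ltW.
Qed.

Lemma vortex_eq0 p : H p <= 0 ->
  [/\ vortex1 p = 0, vortex2 p = 0, vortex1x p = 0 & vortex1y p = 0] /\
  [/\ vortex2x p = 0, vortex2y p = 0, vortex_pressurex p = 0,
      vortex_pressurey p = 0 & vortex_pressure p = 0].
Proof.
move=> h; rewrite /vortex1 /vortex2 /vortex1x /vortex1y /vortex2x /vortex2y
  /vortex_pressurex /vortex_pressurey /vortex_pressure /G /vortex_speed /g.
by rewrite !(pos_pow_le0 _ h); split; split; ring.
Qed.

Lemma Ck_global_vortex : [/\ Ck_global (axes R) l.+1 vortex1,
  Ck_global (axes R) l.+1 vortex2 & Ck_global (axes R) l.+1 vortex_pressure].
Proof.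
have cst c : Ck_global (axes R) l.+1 (fun=> c) by exact: Ck_global_cst.
have fstC : Ck_global (axes R) l.+1 (fun q : R * R => q.1).
  split=> //; first by move=> p; exact: cvg_fst.
  move=> e; rewrite !inE => /orP[]/eqP->.
    by exists (fun=> 1); [exact: (Ck_bounded_global (leqnSn l) (cst 1))|exact: is_derive_fst_x].
  by exists (fun=> 0); [exact: (Ck_bounded_global (leqnSn l) (cst 0))|exact: is_derive_fst_y].
have sndC : Ck_global (axes R) l.+1 (fun q : R * R => q.2 - z).
  split=> //.
    by move=> p; apply: cvgB; [exact: cvg_snd|exact: cvg_cst].
  move=> e; rewrite !inE => /orP[]/eqP->.
    by exists (fun=> 0); [exact: (Ck_bounded_global (leqnSn l) (cst 0))|exact: is_derive_sndB_x].
  by exists (fun=> 1); [exact: (Ck_bounded_global (leqnSn l) (cst 1))|exact: is_derive_sndB_y].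
have HC : Ck_global (axes R) l.+1 H.
  have -> : H = fun q => rho ^+ 2 + -1 * (q.1 * q.1 + (q.2 - z) * (q.2 - z)).
    by apply/funext => q; rewrite /H /vortex_height; ring.
  apply: Ck_globalD => //; apply: Ck_globalM => //.
  by apply: Ck_globalD; exact: Ck_globalM.
have GC : Ck_global (axes R) l.+1 G by exact: Ck_global_pos_pow.
split.
- have -> : vortex1 = fun q => -1 * ((q.2 - z) * G q).
    by apply/funext => q; rewrite mulN1r.
  by apply: Ck_globalM => //; exact: Ck_globalM.
- exact: Ck_globalM.
- by apply: Ck_globalM => //; apply: Ck_global_pos_pow => //; lia.
Qed.

Lemma vortex2_center : 0 < rho -> 0 < vortex2 (rho / 2, z).
Proof.
move=> r0; rewrite /vortex2/= mulr_gt0 ?divr_gt0//.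
have h : 0 < H (rho / 2, z).
  rewrite /H /vortex_height/= subrr expr0n addr0.
  have -> : rho ^+ 2 - (rho / 2) ^+ 2 = 3 * (rho / 2) ^+ 2 by field.
  by rewrite mulr_gt0// exprn_gt0// divr_gt0.
by rewrite /G /vortex_speed pos_pow_ge0 ?exprn_gt0// ltW.
Qed.

(** Upward velocity occurs only to the right of the centre, at distance less than rho. Seeing it at
    a fixed point therefore locates the vortex up to rho. *)
Lemma vortex2_gt0 p : 0 < rho -> 0 < vortex2 p -> 0 < p.1 < rho.
Proof.
move=> r0; rewrite /vortex2; have [h|h] := leP (H p) 0.
  by rewrite /G /vortex_speed pos_pow_le0// mulr0 ltxx.
rewrite pmulr_lgt0; last by rewrite /G /vortex_speed pos_pow_ge0 ?exprn_gt0// ltW.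
move=> p1; rewrite p1/= -(@ltr_pXn2r _ 2)// ?nnegrE ?(ltW p1) ?(ltW r0)//.
move: h; rewrite subr_gt0; apply: le_lt_trans.
by rewrite lerDl sqr_ge0.
Qed.

End Vortex.

(** * Moving vortices *)

Section MovingVortices.
Variables (R : realType) (l N : nat) (rho : R) (z : 'I_N -> R).
Hypothesis rho01 : 0 < rho <= 1.
Implicit Types (F Fe : R -> R * R -> R) (theta : 'I_N -> R) (p : R * R).

Local Notation dir_x := ((1, 0) : R * R).
Local Notation dir_y := ((0, 1) : R * R).

Let rho0 : 0 < rho. Proof. by case/andP: rho01. Qed.

(** [theta i] is the horizontal position of the i-th vortex. F is generic so that velocities, their
    derivatives and pressures are superposed in the same way. *)
Definition translates F theta p : R :=
  \sum_i periodize (F (z i)) (p.1 - theta i, p.2).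

Definition localized F := (forall a, thin (F a)) /\
  (forall a p, rho <= `|p.2 - a| -> F a p = 0).

Lemma localizedP F :
  (forall a p, vortex_height rho a p <= 0 -> F a p = 0) -> localized F.
Proof.
move=> F0; split=> a p h; apply: F0.
  exact: vortex_height_le0_x.
exact: vortex_height_le0_y.
Qed.

Lemma translates_eq0 F theta p : localized F ->
  (forall i, rho <= `|p.2 - z i|) -> translates F theta p = 0.
Proof. by move=> [_ F0] h; rewrite /translates big1// => i _; exact: F0. Qed.

(** At a height that meets the strip of one vortex only, the sum has one term; this removes all
    cross terms from the quadratic part of the Euler equations. *)
Lemma translates_single F theta p i : localized F ->
  (forall j, j != i -> rho <= `|p.2 - z j|) ->
  translates F theta p = periodize (F (z i)) (p.1 - theta i, p.2).
Proof.
move=> [_ F0] h; rewrite /translates (bigD1 i)//= big1 ?addr0// => j ji.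
by apply: F0; exact: h.
Qed.

Lemma is_derive_translates F Fe e theta p : localized F ->
  (forall a q, is_derive q e (F a) (Fe a q)) ->
  is_derive p e (translates F theta) (translates Fe theta p).
Proof.
move=> [Ft _] FD.
have D i : is_derive p e (fun q => periodize (F (z i)) (q.1 - theta i, q.2))
    (periodize (Fe (z i)) (p.1 - theta i, p.2)).
  by apply: is_derive_translate; apply: is_derive_periodize.
have := is_derive_sum D.
suff -> : \sum_i (fun q => periodize (F (z i)) (q.1 - theta i, q.2)) =
  translates F theta by [].
by apply/funext => q; rewrite fct_sumE.
Qed.

Lemma periodic_x_translates F theta : periodic_x (translates F theta).
Proof.
move=> p; apply: eq_bigr => i _ /=; rewrite addrAC.
exact: (@periodic_x_periodize _ (F (z i)) (p.1 - theta i, p.2)).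
Qed.

Lemma Ck_bounded_translates D k A F theta : (forall p c, D p -> D (p.1 - c, p.2)) ->
  (forall i, Ck_bounded (axes R) D k (A i) (periodize (F (z i)))) ->
  Ck_bounded (axes R) D k (fun j => \sum_i A i j) (translates F theta).
Proof.
move=> DD FA; apply: (@Ck_bounded_sum _ _ _ _ _ D k A
  (fun i p => periodize (F (z i)) (p.1 - theta i, p.2))) => i.
by apply: Ck_bounded_translate => // p; exact: DD.
Qed.

Lemma translates_periodic F theta theta' p : (forall i, exists m : int,
    theta' i = theta i + 2 * pi * m%:~R) ->
  translates F theta' p = translates F theta p.
Proof.
move=> th; apply: eq_bigr => i _; have [m ->] := th i.
rewrite opprD addrA.
exact: (@periodic_x_int _ (periodize (F (z i))) (p.1 - theta i, p.2) m
  (@periodic_x_periodize _ _)).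
Qed.

Definition spacetime_axes : seq (R * (R * R)) :=
  [:: (1, (0, 0)); (0, (1, 0)); (0, (0, 1))].

(** The map (t, x, y) -> (x - c t, y) sends e to a e': a = -c for the time axis, a = 1 for the two
    space axes. *)
Lemma is_derive_moving (f g : R * R -> R) c (w : R * (R * R)) (e : R * (R * R))
    (e' : R * R) a :
  (e.2.1 - c * e.1, e.2.2) = a *: e' ->
  (forall p, is_derive p e' f (g p)) ->
  is_derive w e (fun w => f (w.2.1 - c * w.1, w.2.2))
    (a * g (w.2.1 - c * w.1, w.2.2)).
Proof.
move=> [e1 e2] fg.
apply: (@is_derive_affine R _ _ _
  (fun w : R * (R * R) => (w.2.1 - c * w.1, w.2.2)) f w e (a *: e')).
  move=> h; congr (_, _); last by rewrite /= -e2.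
  rewrite /= -e1.
  transitivity (h * e.2.1 + w.2.1 - c * (h * e.1 + w.1)); first by [].
  by transitivity (h * (e.2.1 - c * e.1) + (w.2.1 - c * w.1)); [ring|].
exact: is_derive_scaled_direction.
Qed.

Lemma Ck_global_moving f c : Ck_global (axes R) 1 f ->
  Ck_global spacetime_axes 1
    (fun w : R * (R * R) => f (w.2.1 - c * w.1, w.2.2)).
Proof.
have Lc : continuous (fun w : R * (R * R) => (w.2.1 - c * w.1, w.2.2)).
  have c1 : continuous (fun w : R * (R * R) => w.1) by move=> w; exact: cvg_fst.
  have c2 : continuous (fun w : R * (R * R) => w.2) by move=> w; exact: cvg_snd.
  have c21 : continuous (fun w : R * (R * R) => w.2.1).
    by move=> w; apply: (continuous_comp (c2 w)); exact: cvg_fst.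
  have c22 : continuous (fun w : R * (R * R) => w.2.2).
    by move=> w; apply: (continuous_comp (c2 w)); exact: cvg_snd.
  apply: continuous_pair => // w; apply: cvgB; first exact: c21.
  by apply: cvgM; [exact: cvg_cst|exact: c1].
have comp (h : R * R -> R) : continuous h ->
    continuous (fun w : R * (R * R) => h (w.2.1 - c * w.1, w.2.2)).
  by move=> hc w; apply: continuous_comp; [exact: Lc|exact: hc].
have compZ (h : R * R -> R) a : continuous h ->
    continuous (fun w : R * (R * R) => a * h (w.2.1 - c * w.1, w.2.2)).
  by move=> /comp hc w; apply: cvgM; [exact: cvg_cst|exact: hc].
move=> [fc _ fD].
have [fx [fxc _ _] fxD] := fD _ (mem_axis_x R).
have [fy [fyc _ _] fyD] := fD _ (mem_axis_y R).
split=> //; first exact: comp.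
move=> e; rewrite !inE => /or3P[]/eqP->.
- exists (fun w => (- c) * fx (w.2.1 - c * w.1, w.2.2)).
    by split=> //; exact: compZ.
  move=> w; apply: is_derive_moving fxD.
  by congr (_, _); rewrite /= ?[_ *: 1]mulr1 ?[_ *: 0]mulr0
      ?mulr0 ?mulr1 ?sub0r ?subr0 ?oppr0.
- exists (fun w => 1 * fx (w.2.1 - c * w.1, w.2.2)).
    by split=> //; exact: compZ.
  move=> w; apply: is_derive_moving fxD.
  by congr (_, _); rewrite /= ?[_ *: 1]mulr1 ?[_ *: 0]mulr0
      ?mulr0 ?mulr1 ?sub0r ?subr0 ?oppr0.
- exists (fun w => 1 * fy (w.2.1 - c * w.1, w.2.2)).
    by split=> //; exact: compZ.
  move=> w; apply: is_derive_moving fyD.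
  by congr (_, _); rewrite /= ?[_ *: 1]mulr1 ?[_ *: 0]mulr0
      ?mulr0 ?mulr1 ?sub0r ?subr0 ?oppr0.
Qed.

Variables (V V' : R -> R) (kappa : R) (c : 'I_N -> R).
Hypothesis separated : forall i j y, j != i -> `|y - z i| < rho -> rho <= `|y - z j|.
Hypothesis inside : forall i, rho <= `|1 - z i| /\ rho <= `|- 1 - z i|.
Hypothesis derV : forall y : R, is_derive y 1 V (V' y).
Hypothesis contV' : continuous V'.
Hypothesis V_const : forall i y, `|y - z i| < rho -> V y = c i /\ V' y = 0.

Let W1 := vortex1 l rho.
Let W2 := vortex2 l rho.
Let W1x := vortex1x l rho.
Let W1y := vortex1y l rho.
Let W2x := vortex2x l rho.
Let W2y := vortex2y l rho.
Let P := vortex_pressure l rho.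
Let Px := vortex_pressurex l rho.
Let Py := vortex_pressurey l rho.

Definition vortex_field (U : R -> R) theta p : R * R :=
  (U p.2 + kappa * translates W1 theta p, kappa * translates W2 theta p).

Definition phases t (i : 'I_N) : R := c i * t.

Lemma vortices_localized :
  [/\ localized W1, localized W2, localized W1x & localized W1y] /\
  [/\ localized W2x, localized W2y, localized Px, localized Py & localized P].
Proof.
by split; split; apply: localizedP => a p /(@vortex_eq0 _ l)[[]] ? ? ? ? [].
Qed.

Lemma is_derive_vortex_field_x theta p :
  is_derive p dir_x (vortex_field V theta)
    (kappa * translates W1x theta p, kappa * translates W2x theta p).
Proof.
have [[w1 w2 _ _] _] := vortices_localized.
have D1 := is_derive_translates theta p w1 (@is_derive_vortex1_x R l rho).
have D2 := is_derive_translates theta p w2 (@is_derive_vortex2_x R l rho).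
have := is_derive_add (is_derive_snd0 V p) (is_derive_mulc kappa D1).
rewrite add0r => D; exact: (is_derive_pair D (is_derive_mulc kappa D2)).
Qed.

Lemma is_derive_vortex_field_y theta p :
  is_derive p dir_y (vortex_field V theta)
    (V' p.2 + kappa * translates W1y theta p, kappa * translates W2y theta p).
Proof.
have [[w1 w2 _ _] _] := vortices_localized.
have D1 := is_derive_translates theta p w1 (@is_derive_vortex1_y R l rho).
have D2 := is_derive_translates theta p w2 (@is_derive_vortex2_y R l rho).
have D := is_derive_add (is_derive_snd (derV p.2)) (is_derive_mulc kappa D1).
exact: (is_derive_pair D (is_derive_mulc kappa D2)).
Qed.

Lemma is_derive_translates_time F Fx p (t : R) : localized F ->
  (forall a q, is_derive q dir_x (F a) (Fx a q)) ->
  is_derive t 1 (fun s => translates F (phases s) p)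
    (- \sum_i c i * periodize (Fx (z i)) (p.1 - c i * t, p.2)).
Proof.
move=> [Ft _] FD.
have D i : is_derive t 1 (fun s => periodize (F (z i)) (p.1 - c i * s, p.2))
    (- c i * periodize (Fx (z i)) (p.1 - c i * t, p.2)).
  apply: (@is_derive_affine R _ _ _ (fun s => (s, p))
    (fun w : R * (R * R) => periodize (F (z i)) (w.2.1 - c i * w.1, w.2.2))
    t 1 (1, (0, 0))).
    by move=> h; congr (_, _); rewrite /= scaler0 add0r.
  apply: (@is_derive_moving (periodize (F (z i))) _ (c i) (t, p) _ dir_x (- c i)).
    by congr (_, _); rewrite /= ?[_ *: 1]mulr1 ?[_ *: 0]mulr0
      ?mulr0 ?mulr1 ?sub0r ?subr0 ?oppr0.
  by move=> q; apply: is_derive_periodize.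
have := is_derive_sum D.
have -> : \sum_i (fun s => periodize (F (z i)) (p.1 - c i * s, p.2)) =
    (fun s => translates F (phases s) p).
  by apply/funext => q; rewrite fct_sumE.
by under eq_bigr do rewrite mulNr; rewrite sumrN.
Qed.

Lemma Ck_global_translates_spacetime F :
  (forall a, thin (F a)) -> (forall a, Ck_global (axes R) 1 (F a)) ->
  Ck_global spacetime_axes 1
    (fun w : R * (R * R) => translates F (phases w.1) w.2).
Proof.
move=> Ft FC.
apply: (@Ck_bounded_global _ _ _ set0 1 _ (fun=> \sum_(i < N) 0)) => //.
apply: (@Ck_bounded_sum _ _ _ _ _ set0 1 (fun=> fun=> 0)
  (fun i (w : R * (R * R)) => periodize (F (z i)) (w.2.1 - c i * w.1, w.2.2))) => i.
by apply: Ck_global_moving; apply: Ck_global_periodize.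
Qed.

Let pair_eqN (a b a' b' : R) : a = - a' -> b = - b' -> (a, b) = - (a', b').
Proof. by move=> -> ->. Qed.

(** In the strip of the i-th vortex the field is (c_i, 0) plus [kappa] times a vortex carried along
    at speed c_i. The time derivative cancels the transport by c_i, and the quadratic part is the
    steady identity times kappa^2. Elsewhere the field is the shear [V], with pressure 0. *)
Lemma euler_vortices : euler_solution (fun t => vortex_field V (phases t)).
Proof.
have [[lW1 lW2 lW1x lW1y] [lW2x lW2y lPx lPy lP]] := vortices_localized.
have CV a := @Ck_global_vortex R l rho a.
split.
- move=> t p _; rewrite /vortex_field /= !(periodic_x_translates _ _ p).
  by [].
- rewrite /Ck_spacetime; apply: Ck_upto_global_pair.
  + apply: Ck_globalD.
      have sndc : continuous (fun w : R * (R * R) => w.2.2).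
        by move=> w; apply: (@continuous_comp _ _ _ snd snd); exact: cvg_snd.
      split=> //.
        move=> w; apply: continuous_comp; first exact: sndc.
        exact: derive_continuous derV _.
      move=> e; rewrite !inE => eb.
      exists (fun w => e.2.2 * V' w.2.2).
        split=> // w; apply: cvgM; first exact: cvg_cst.
        by apply: continuous_comp; [exact: sndc|exact: contV'].
      move=> w; apply: (@is_derive_affine R _ _ _
        (fun w : R * (R * R) => w.2.2) V w e (e.2.2 *: 1)).
        by move=> h; rewrite /= [_ *: 1]mulr1.
      exact: is_derive_scaled_direction.
    apply: Ck_globalM.
      exact: Ck_global_cst.
    apply: Ck_global_translates_spacetime; first exact: lW1.1.
    by move=> a; have [+ _ _] := CV a; exact: Ck_bounded_global.
  + apply: Ck_globalM.
      exact: Ck_global_cst.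
    apply: Ck_global_translates_spacetime; first exact: lW2.1.
    by move=> a; have [_ + _] := CV a; exact: Ck_bounded_global.
- exists (fun t p => kappa ^+ 2 * translates P (phases t) p); split.
  + by move=> t p _ /=; rewrite periodic_x_translates.
  + move=> t; apply: Ck_upto_global; apply: Ck_globalM.
      exact: Ck_global_cst.
    apply: (@Ck_bounded_global _ _ _ set0 1 _ (fun=> \sum_(i < N) 0)) => //.
    apply: (@Ck_bounded_translates set0 1 (fun=> fun=> 0)) => // i.
    apply: Ck_global_periodize; first exact: lP.1.
    by have [_ _ +] := CV (z i); exact: Ck_bounded_global.
  + move=> t p _.
    have [_ ux] := is_derive_vortex_field_x (phases t) p.
    have [_ uy] := is_derive_vortex_field_y (phases t) p.
    have [_ px] := is_derive_mulc (kappa ^+ 2)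
      (is_derive_translates (phases t) p lP (@is_derive_vortex_pressure_x R l rho)).
    have [_ py] := is_derive_mulc (kappa ^+ 2)
      (is_derive_translates (phases t) p lP (@is_derive_vortex_pressure_y R l rho)).
    have [_ ut] : is_derive t 1 (fun s => vortex_field V (phases s) p)
        (kappa * - \sum_i c i * periodize (W1x (z i)) (p.1 - c i * t, p.2),
         kappa * - \sum_i c i * periodize (W2x (z i)) (p.1 - c i * t, p.2)).
      have D1 := is_derive_translates_time p t lW1 (@is_derive_vortex1_x R l rho).
      have D2 := is_derive_translates_time p t lW2 (@is_derive_vortex2_x R l rho).
      have := is_derive_add (is_derive_cst (V p.2) t 1) (is_derive_mulc kappa D1).
      rewrite add0r => D; exact: (is_derive_pair D (is_derive_mulc kappa D2)).
    rewrite derive1E ut /dx /dy ux uy.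
    transitivity (- (kappa ^+ 2 * translates Px (phases t) p,
      kappa ^+ 2 * translates Py (phases t) p)); last first.
      by congr (- (_, _)); apply/esym.
    have pairE (a b a1 b1 a2 b2 u1 u2 : R) :
        (a, b) + (u1 *: (a1, b1) + u2 *: (a2, b2)) =
        (a + (u1 * a1 + u2 * a2), b + (u1 * b1 + u2 * b2)) by [].
    (* Here e stands for the velocity c_i of the strip, and the summand 0 is the slope of [V]
       there. *)
    have cancel1 (a b ax ay r k e : R) : a * ax + b * ay = - r ->
        k * - (e * ax) + ((e + k * a) * (k * ax) + k * b * (0 + k * ay)) =
        - (k ^+ 2 * r).
      by move=> /(congr1 -%R); rewrite opprK => <-; ring.
    have cancel2 (a b ax ay r k e : R) : a * ax + b * ay = - r ->
        k * - (e * ax) + ((e + k * a) * (k * ax) + k * b * (k * ay)) =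
        - (k ^+ 2 * r).
      by move=> /(congr1 -%R); rewrite opprK => <-; ring.
    rewrite pairE /=; apply: pair_eqN.
    (* Either p lies in the strip of exactly one vortex, or all vortex terms vanish at p. *)
    + have [[i Hi]|none] := pselect (exists i, `|p.2 - z i| < rho); last first.
        have none' i : rho <= `|p.2 - z i|.
          by rewrite leNgt; apply/negP => h; apply: none; exists i.
        rewrite !translates_eq0// big1; first by ring.
        by move=> i _; rewrite [periodize _ _](lW1x.2)// mulr0.
      have sep j : j != i -> rho <= `|p.2 - z j| by move=> ji; exact: separated Hi.
      rewrite !(@translates_single _ _ _ i)//.
      rewrite (bigD1 i)//= big1 ?addr0; last first.
        by move=> j ji; rewrite [periodize _ _](lW1x.2) ?mulr0//; exact: sep.
      have [-> ->] := V_const Hi.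
      exact: cancel1 (vortex_steady1 l rho (z i) (reduce (p.1 - phases t i), p.2)).
    + have [[i Hi]|none] := pselect (exists i, `|p.2 - z i| < rho); last first.
        have none' i : rho <= `|p.2 - z i|.
          by rewrite leNgt; apply/negP => h; apply: none; exists i.
        rewrite !translates_eq0// big1; first by ring.
        by move=> i _; rewrite [periodize _ _](lW2x.2)// mulr0.
      have sep j : j != i -> rho <= `|p.2 - z j| by move=> ji; exact: separated Hi.
      rewrite !(@translates_single _ _ _ i)//.
      rewrite (bigD1 i)//= big1 ?addr0; last first.
        by move=> j ji; rewrite [periodize _ _](lW2x.2) ?mulr0//; exact: sep.
      have [-> _] := V_const Hi.
      exact: cancel2 (vortex_steady2 l rho (z i) (reduce (p.1 - phases t i), p.2)).
- move=> t p _.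
  have [_ ux] := is_derive_vortex_field_x (phases t) p.
  have [_ uy] := is_derive_vortex_field_y (phases t) p.
  rewrite /dx /dy ux uy /= -mulrDr -big_split/= big1 ?mulr0// => i _.
  exact: vortex_divergence.
- move=> t x.
  have in1 := fun i => (inside i).1; have in2 := fun i => (inside i).2.
  by split; rewrite /vortex_field/= translates_eq0 ?mulr0.
Qed.

End MovingVortices.

(** * Flattening the profile *)

Section Profiles.
Variable R : realType.
Implicit Types (f F : R -> R) (A : nat -> R) (y : R).

(** Bounds are indexed by the order of differentiation, primitives by its complement: the
    y-derivative of order m - j is the j-fold primitive. Derivatives in x vanish. *)
Lemma Ck_bounded_profile (D : set (R * R)) (x0 : R) m A F : continuous F ->
  (forall j, 0 <= A j) ->
  (forall j p, (j <= m)%N -> D p -> `|iter_primitive x0 j F p.2| <= A (m - j)%N) ->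
  Ck_bounded (axes R) D m A (fun p => iter_primitive x0 m F p.2).
Proof.
move=> Fc; have c2 j : continuous (fun p : R * R => iter_primitive x0 j F p.2).
  move=> p; apply: continuous_comp; first exact: cvg_snd.
  exact: continuous_iter_primitive.
elim: m A => [|m IH] A A0 FA; split=> //; try exact: c2.
- by move=> p Dp; have := FA 0%N p isT Dp; rewrite subn0.
- by move=> p Dp; have := FA m.+1 p (leqnn _) Dp; rewrite subnn.
- move=> e; rewrite !inE => /orP[]/eqP->.
    exists (fun=> 0); first by apply: Ck_bounded_cst => [|j]; rewrite ?normr0 /=.
    by move=> p; exact: is_derive_snd0.
  exists (fun p => iter_primitive x0 m F p.2).
    apply: IH => [j|j p jm Dp]; first exact: A0.
    by rewrite /= -subSn//; apply: FA => //; exact: leqW.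
  by move=> p; apply: is_derive_snd; exact: is_derive_iter_primitive.
Qed.

Lemma Ck_global_profile (x0 : R) m F : continuous F ->
  Ck_global (axes R) m (fun p => iter_primitive x0 m F p.2).
Proof. by move=> Fc; apply: Ck_bounded_profile. Qed.

Lemma continuous_plateau0 : continuous (@plateau R 0).
Proof.
have [] // := @Ck_global_plateau R R [::] 0 0 id.
by split=> //; move=> y; exact: cvg_id.
Qed.

(** Each further primitive from x0 costs a factor |y - x0| <= 2, and 2^k dominates the factors of
    all orders involved. *)
Lemma iter_primitive_le (x0 a : R) F k : -1 < x0 < 1 -> continuous F -> 0 <= a ->
  (forall y, -1 < y < 1 -> `|iter_primitive x0 1 F y| <= a) ->
  forall j y, (j <= k)%N -> -1 < y < 1 -> `|iter_primitive x0 j.+1 F y| <= 2 ^+ k * a.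
Proof.
move=> /andP[x01 x02] Fc a0 F1; suff H j y : -1 < y < 1 ->
    `|iter_primitive x0 j.+1 F y| <= 2 ^+ j * a.
  move=> j y jk y1; apply: le_trans (H j y y1) _.
  by rewrite ler_wpM2r// ler_weXn2l// ler1n.
elim: j y => [|j IH] y y1; first by rewrite expr0 mul1r F1.
have := @derive_lipschitz R [set y | -1 < y < 1] (iter_primitive x0 j.+2 F)
  (iter_primitive x0 j.+1 F) (2 ^+ j * a).
move=> /(_ _ _ _ y x0 y1); rewrite iter_primitive_base// subr0 => H.
have ja : 0 <= 2 ^+ j * a by rewrite mulr_ge0// exprn_ge0.
rewrite exprS -mulrA mulrC; apply: le_trans (H _ _ _ _) _.
- move=> s t w /= /andP[s1 s2] /andP[t1 t2] /andP[sw wt].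
  by rewrite (lt_le_trans s1)// (le_lt_trans wt).
- by move=> w _; exact: is_derive_iter_primitive.
- by move=> w; exact: IH.
- by rewrite /= x01.
- by rewrite ler_wpM2l// ler_norml; move: y1 => /andP[? ?]; apply/andP; split; lra.
Qed.

(** Within distance d of x0 the mean value bound gives M d; beyond, F vanishes and the primitive
    keeps its value at x0 + d or x0 - d. *)
Lemma primitive_bump_le (x0 d M : R) F : continuous F -> 0 < d -> 0 <= M ->
  (forall y, `|F y| <= M) -> (forall y, d <= `|y - x0| -> F y = 0) ->
  forall y, `|iter_primitive x0 1 F y| <= M * d.
Proof.
move=> Fc d0 M0 FM Fd y; set H := iter_primitive x0 1 F.
have H0 : H x0 = 0 by exact: iter_primitive_base.
have DH (w : R) : is_derive w 1 H (F w) by exact: is_derive_iter_primitive.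
have near w : `|w - x0| <= d -> `|H w| <= M * d.
  move=> wd; rewrite -[H w]subr0 -H0.
  apply: (@le_trans _ _ (M * `|w - x0|)); last exact: ler_wpM2l.
  by apply: (@derive_lipschitz R setT H F).
have far (P : set R) w : order_convex P -> P y -> P w ->
    (forall x, P x -> d <= `|x - x0|) -> `|w - x0| <= d -> `|H y| <= M * d.
  move=> Pc Py Pw PF wd.
  have : `|H y - H w| <= 0 * `|y - w|.
    apply: (@derive_lipschitz R P H F) => // x Px.
    by rewrite Fd ?normr0//; exact: PF.
  by rewrite mul0r normr_le0 subr_eq0 => /eqP->; exact: near.
have [yd|yd] := leP `|y - x0| d; first exact: near.
move: yd; rewrite ltr_normr => /orP[yd|yd].
- apply: (far [set x | x0 + d <= x] (x0 + d)) => //=.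
  + by move=> a b c /= xa _ /andP[ac _]; exact: le_trans ac.
  + by lra.
  + by move=> x xd; rewrite ler_normr; apply/orP; left; lra.
  + by rewrite addrAC subrr add0r ger0_norm// ltW.
- apply: (far [set x | x <= x0 - d] (x0 - d)) => //=.
  + by move=> a b c /= _ xb /andP[_ cb]; exact: le_trans xb.
  + by lra.
  + by move=> x xd; rewrite ler_normr; apply/orP; right; lra.
  + by rewrite addrAC subrr add0r normrN ger0_norm// ltW.
Qed.

(* Cutting off f near x0 changes its iterated primitives only slightly: no
   cutoff function has to be differentiated. *)
Lemma localized_primitives (x0 : R) f k : -1 < x0 < 1 -> continuous f ->
  exists2 M, 0 <= M & forall a, 0 < a -> exists d F,
  [/\ 0 < d, d <= 1 - `|x0|, continuous F, (forall y, `|y - x0| <= d -> F y = f y) &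
      (forall y, -1 < y < 1 -> `|F y| <= M) /\
      (forall j y, (j <= k)%N -> -1 < y < 1 -> `|iter_primitive x0 j.+1 F y| <= a)].
Proof.
move=> x01 fc.
have cf : {within `[-1, 1], continuous (fun y => `|f y|)}.
  by apply: continuous_subspaceT => y; apply: cvg_norm; exact: fc.
have le11 : -1 <= 1 :> R by lra.
have [c _ cmax] := @EVT_max R (fun y => `|f y|) (-1) 1 le11 cf.
have M0 : 0 <= `|f c| by [].
exists `|f c| => // a a0; set M := `|f c| in cmax M0 *.
have x0n : 0 < 1 - `|x0| by rewrite subr_gt0 ltr_norml.
(* The cutoff vanishes for |y - x0| >= 2 d: the first term keeps this range inside (-1, 1), the
   second makes 2^k M (2 d) at most a. *)
pose d := Num.min ((1 - `|x0|) / 2) (a / (2 ^+ k * (M + 1) * 2)).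
have K0 : 0 < 2 ^+ k * (M + 1) * 2 by rewrite !mulr_gt0 ?exprn_gt0// ltr_pwDr.
have d0 : 0 < d by rewrite lt_min !divr_gt0.
have d1 : d * 2 <= 1 - `|x0| by rewrite -ler_pdivlMr// ge_min lexx.
have d2 : d * (2 ^+ k * (M + 1) * 2) <= a by rewrite -ler_pdivlMr// ge_min lexx orbT.
pose F y := f y * plateau 0 ((y - x0) / d).
have Fc : continuous F.
  move=> y; apply: cvgM; first exact: fc.
  apply: (@continuous_comp _ _ _ (fun y => (y - x0) / d) (plateau 0)).
    apply: cvgM; last exact: cvg_cst.
    by apply: cvgB; [exact: cvg_id|exact: cvg_cst].
  exact: continuous_plateau0.
have F0 y : d * 2 <= `|y - x0| -> F y = 0.
  move=> yd; rewrite /F plateau_eq0 ?mulr0//.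
  rewrite -[leRHS]real_normK ?num_real// normrM normfV (gtr0_norm d0).
  have h : 2 <= `|y - x0| / d by rewrite ler_pdivlMr// mulrC.
  by rewrite expr2; nra.
have FM y : `|F y| <= M.
  have [y1|y1] := leP `|y| 1.
    have /andP[p0 p1] := plateau_itv 0 ((y - x0) / d).
    rewrite /F normrM -[M]mulr1; apply: ler_pM => //.
      by apply: cmax; rewrite in_itv/= -ler_norml.
    by rewrite ger0_norm.
  rewrite F0 ?normr0//.
  have := ler_normB (y - x0) (- x0); rewrite opprK subrK normrN; lra.
exists d, F; split=> //.
- by apply: le_trans d1; rewrite ler_peMr ?ler1n// ltW.
- move=> y yd; rewrite /F plateau_eq1 ?mulr1//.
  by rewrite normrM normfV (gtr0_norm d0) ler_pdivrMr// mul1r.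
split=> [y _|j y jk y1]; first exact: FM.
have dd0 : 0 < d * 2 by rewrite mulr_gt0.
have := @iter_primitive_le x0 (M * (d * 2)) F k x01 Fc _ _ j y jk y1.
move=> /(_ _ _)/wrap[||H].
- by rewrite mulr_ge0// ltW.
- by move=> w _; exact: primitive_bump_le.
apply: le_trans H (le_trans _ d2).
have -> : 2 ^+ k * (M * (d * 2)) = d * (2 ^+ k * M * 2) by ring.
by rewrite ler_pM2l// ler_pM2r// ler_wpM2l ?exprn_ge0// lerDl.
Qed.

(** The shape is that of [holder_norm_le] with the bound 2 a on the lower orders. The choice of a
    makes K a less than eps / 2 and the power at most eps / (2 (C + 1)). *)
Lemma small_parameter (K C eps alpha : R) : 0 <= K -> 0 <= C -> 0 < eps ->
  0 < alpha < 1 -> exists2 a, 0 < a <= 1 & K * a + C * (4 * a) `^ (1 - alpha) < eps.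
Proof.
move=> K0 C0 e0 /andP[al0 al1]; have al : 0 < 1 - alpha by rewrite subr_gt0.
pose t := eps / (2 * (C + 1)).
have C1 : 0 < 2 * (C + 1) by rewrite mulr_gt0// ltr_pwDr.
have K1 : 0 < 2 * (K + 1) by rewrite mulr_gt0// ltr_pwDr.
have t0 : 0 < t by rewrite divr_gt0.
pose s := t `^ (1 - alpha)^-1.
have s0 : 0 < s by rewrite powR_gt0.
pose a := Num.min 1 (Num.min (eps / (2 * (K + 1))) (s / 4)).
have a0 : 0 < a by rewrite !lt_min ltr01 !divr_gt0.
have aK : a * (2 * (K + 1)) <= eps by rewrite -ler_pdivlMr// !ge_min lexx orbT.
have as4 : 4 * a <= s by rewrite mulrC -ler_pdivlMr// !ge_min lexx !orbT.
exists a; first by rewrite a0 !ge_min lexx.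
have pt : (4 * a) `^ (1 - alpha) <= t.
  apply: (@le_trans _ _ (s `^ (1 - alpha))).
    by apply: ge0_ler_powR => //; rewrite ?nnegrE ?mulr_ge0 ?(ltW al) ?(ltW s0) ?(ltW a0).
  by rewrite /s -powRrM mulVf ?gt_eqF// powRr1// ltW.
have Ct : C * t * 2 <= eps - 2 * t.
  have : t * (2 * (C + 1)) = eps by rewrite /t divfK// gt_eqF.
  lra.
have := ler_wpM2l C0 pt; lra.
Qed.

(** The mean value theorem in x costs one derivative, for f and for each of its derivatives; this
    makes the flows Lipschitz in the phases. *)
Lemma Ck_bounded_translate_diff k M (f : R * R -> R) (c c' : R) :
  Ck_bounded (axes R) (@strip R) k.+1 (fun=> M) f ->
  Ck_bounded (axes R) (@strip R) k (fun=> M * `|c - c'|)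
    (fun p => f (p.1 - c, p.2) - f (p.1 - c', p.2)).
Proof.
have bnd (h h' : R * R -> R) p : (forall q, is_derive q ((1, 0) : R * R) h (h' q)) ->
    (forall q, strip q -> `|h' q| <= M) -> strip p ->
    `|h (p.1 - c, p.2) - h (p.1 - c', p.2)| <= M * `|c - c'|.
  move=> hD hM sp.
  have := @derive_lipschitz R setT (fun s => h (s, p.2)) (fun s => h' (s, p.2)) M.
  move=> /(_ _ _ _ (p.1 - c) (p.1 - c') I I).
  have -> : p.1 - c - (p.1 - c') = - (c - c') by ring.
  rewrite normrN; apply=> // s _; last exact: hM.
  by apply: is_derive_slice_x; exact: hD.
have cont (h : R * R -> R) : continuous h ->
    continuous (fun p : R * R => h (p.1 - c, p.2) - h (p.1 - c', p.2)).
  by move=> hc p; apply: cvgB; apply: continuous_translate.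
have dxM m h : Ck_bounded (axes R) (@strip R) m.+1 (fun=> M) h -> exists2 h',
    forall q, is_derive q ((1, 0) : R * R) h (h' q) &
    forall q, strip q -> `|h' q| <= M.
  move=> [_ _ /(_ _ (mem_axis_x R))[h' h'M h'D]]; exists h' => // q sq.
  exact: (Ck_bounded_le (h'M : Ck_bounded (axes R) (@strip R) m _ h') sq).
elim: k f => [|k IH] f fM; have [fx fxD fxM] := dxM _ _ fM.
  have [fc _ _] := fM; split=> //; first exact: cont.
  by move=> p; exact: bnd fxD fxM.
have [fc _ fD] := fM; split; first exact: cont.
  by move=> p; exact: bnd fxD fxM.
move=> e /fD[g gM gD]; exists (fun p => g (p.1 - c, p.2) - g (p.1 - c', p.2)).
  exact: IH.
move=> p; apply: (@is_deriveB _ _ _ (fun p => f (p.1 - c, p.2))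
  (fun p => f (p.1 - c', p.2))); exact: is_derive_translate.
Qed.

Lemma holder_space_global k (alpha : R) (f g : R * R -> R) : 0 < alpha < 1 ->
  periodic_x f -> periodic_x g ->
  Ck_global (axes R) k.+1 f -> Ck_global (axes R) k.+1 g ->
  holder_space k alpha (fun p => (f p, g p)).
Proof.
move=> al fp gp fk gk.
have [M M0 fM] := Ck_global_periodic_bounded fk fp.
have [M' M'0 gM] := Ck_global_periodic_bounded gk gp.
have MM j : (j <= k.+1)%N -> @strip R !=set0 -> M <= M + M' by rewrite lerDl.
have MM' j : (j <= k.+1)%N -> @strip R !=set0 -> M' <= M + M' by rewrite lerDr.
split.
- by move=> p _ /=; rewrite fp gp.
- by apply: Ck_upto_global_pair; [exact: Ck_bounded_global fk|exact: Ck_bounded_global gk].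
- have MM0 : 0 <= M + M' by rewrite addr_ge0.
  apply: (le_lt_trans (@holder_norm_le R k (fun=> M + M') (M + M') (M + M')
    alpha f g al MM0 MM0 _ _ _ _)); rewrite ?ltry//.
  + exact: (Ck_bounded_weaken _ _ MM fM).
  + exact: (Ck_bounded_weaken _ _ MM' gM).
Qed.

End Profiles.

(** * The family of flows *)

Section VortexFamily.
Variable R : realType.

Lemma cos_ge_half : exists2 r : R, 0 < r & forall y, `|y| < r -> 2^-1 <= cos y.
Proof.
have : cos y @[y --> (0 : R)] --> cos 0 by exact: continuous_cos.
have h0 : 0 < 2^-1 :> R by rewrite invr_gt0.
rewrite cos0 => /cvgr_dist_lt/(_ _ h0)[r r0 H].
exists r => // y yr; have := H y; rewrite /= sub0r normrN => /(_ yr).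
rewrite ltr_norml; lra.
Qed.

Definition step_profile m N (rho : R) (z b : 'I_N -> R) (y : R) : R :=
  \sum_i b i * plateau m ((y - z i) / rho).

Lemma Ck_global_step_profile (E : normedModType R) (bs : seq E) m N rho
    (z b : 'I_N -> R) (f : E -> R) : Ck_global bs m f ->
  Ck_global bs m (fun p => step_profile m rho z b (f p)).
Proof.
have cst c : Ck_global bs m (fun=> c) by exact: Ck_global_cst.
move=> fm; apply: (@Ck_bounded_global _ _ _ set0 m _ (fun=> \sum_(i < N) 0)) => //.
apply: (@Ck_bounded_sum _ _ _ _ _ set0 m (fun=> fun=> 0)
  (fun i p => b i * plateau m ((f p - z i) / rho))) => i.
apply: Ck_globalM => //; apply: Ck_global_plateau => //.
by apply: Ck_globalM => //; apply: Ck_globalD.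
Qed.

(** Within rho of [z i], the other centres are at distance at least 2 rho, where their plateaus
    vanish. *)
Lemma step_profile_eq m N rho (z b : 'I_N -> R) i y : 0 < rho ->
  (forall j, j != i -> 3 * rho <= `|z i - z j|) -> `|y - z i| <= rho ->
  step_profile m rho z b y = b i.
Proof.
move=> r0 sep yz; rewrite /step_profile (bigD1 i)//= plateau_eq1; last first.
  by rewrite normrM normfV (gtr0_norm r0) ler_pdivrMr// mul1r.
rewrite mulr1 big1 ?addr0// => j ji; rewrite plateau_eq0 ?mulr0//.
rewrite -[leRHS]real_normK ?num_real// normrM normfV (gtr0_norm r0).
have h : 2 <= `|y - z j| / rho.
  rewrite ler_pdivlMr//; have := sep j ji.
  have := ler_normB (y - z j) (y - z i).
  have -> : y - z j - (y - z i) = z i - z j by ring.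
  lra.
by rewrite expr2; nra.
Qed.

(** The phases theta are free parameters, so [U] is also the map on the torus, continuous by the
    Lipschitz bound. Upward velocity somewhere excludes a shear. The last clause provides an
    observable: at a suitable point the vertical velocity is at least e when theta_i = 0 and
    positive only when theta_i is close to 2 pi Z, which isolates the phase of one vortex. *)
Lemma exists_vortex_family k (v : R -> R) (y0 eps alpha : R) :
  Ck_segment k.+2 v -> -1 < y0 < 1 ->
  \sum_(0 <= i < k.+1) `|derive1n i v y0| = 0 -> 0 < eps -> 0 < alpha < 1 ->
  forall N (b : 'I_N -> R), exists (kappa : R) (U : ('I_N -> R) -> R * R -> R * R),
  [/\ 0 < kappa,
      euler_solution (fun t => U (fun i : 'I_N => kappa * b i * t)),
      (forall theta, [/\ holder_space k alpha (U theta),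
        holder_space k alpha (U theta \- shear_flow v) &
        (holder_norm k alpha (U theta \- shear_flow v)%R < eps%:E)%E]),
      (exists2 C, 0 <= C & forall theta theta' h, 0 <= h ->
        (forall i : 'I_N, `|theta i - theta' i| <= h) ->
        (holder_norm k alpha (U theta \- U theta')%R <= (C * h)%:E)%E) &
      [/\ (forall theta theta' p,
            (forall i : 'I_N, exists m : int, theta' i = theta i + 2 * pi * m%:~R) ->
            U theta' p = U theta p),
          (forall theta (i : 'I_N), exists2 p, strip p & 0 < (U theta p).2) &
          forall i : 'I_N, exists p e, [/\ strip p, 0 < e,
            (forall theta, theta i = 0 -> e <= (U theta p).2) &
            (forall theta, 0 < (U theta p).2 -> 2^-1 <= cos (theta i))]]].
Proof.
move=> hv hy0 hvan eps0 al N b.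
have hv' : Ck_segment k.+1 v by exact: (@Ck_upto_pred R _ _ _ _ k.+1 v hv).
have [f fc vE] := vanishing_profile_primitive (ltn0Sn k) hv' hy0 hvan.
have [M0 M00 Hloc] := localized_primitives k hy0 fc.
(* [K] and [Ch] are the factors that [holder_norm_le] produces for the bounds 2 a on orders up to k
   and M0 + 1 on order k + 1. *)
pose K := k.+1%:R * (k.+1%:R * 2) : R.
pose Ch := k.+1%:R * (2 * (M0 + 1)) `^ alpha.
have K0 : 0 <= K by rewrite !mulr_ge0.
have Ch0 : 0 <= Ch by rewrite mulr_ge0 ?powR_ge0.
have [a /andP[a0 a1] aeps] := small_parameter K0 Ch0 eps0 al.
have [d [F [d0 d1 Fc Ff [FM Fa]]]] := Hloc a a0.
have [r r0 rcos] := cos_ge_half.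
(* The term with d lets N strips at spacing 3 rho fit into the interval of rest, r gives cos theta_i
   >= 1/2 for an observed vortex, and 1 keeps the vortices [thin]. *)
pose rho := Num.min (d / (3 * N%:R + 1)) (Num.min r 1).
have N1 : 0 < 3 * N%:R + 1 :> R by rewrite ltr_wpDl// mulr_ge0.
have rho0 : 0 < rho by rewrite !lt_min r0 ltr01 divr_gt0.
have rho1 : rho <= 1 by rewrite !ge_min lexx !orbT.
have rhor : rho <= r by rewrite !ge_min lexx !orbT.
have rhod : rho * (3 * N%:R + 1) <= d by rewrite -ler_pdivlMr// ge_min lexx.
have rho01 : 0 < rho <= 1 by rewrite rho0.
pose z (i : 'I_N) := y0 + 3 * rho * i%:R.
have zi (i : 'I_N) : 0 <= 3 * rho * i%:R <= d - 4 * rho.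
  have iN : i%:R + 1 <= N%:R :> R by rewrite natr1 ler_nat.
  have := ler_wpM2l (ltW rho0) iN.
  rewrite !mulr_ge0 ?(ltW rho0)//=; lra.
have sep (i j : 'I_N) : j != i -> 3 * rho <= `|z i - z j|.
  move=> ji; have -> : z i - z j = 3 * rho * (i%:R - j%:R) by rewrite /z; ring.
  rewrite normrM ger0_norm ?mulr_ge0 ?(ltW rho0)//.
  rewrite ler_peMr ?mulr_ge0 ?(ltW rho0)//.
  have [ij|ij|/val_inj ij] := ltngtP i j; last by rewrite ij eqxx in ji.
  - rewrite distrC; apply: le_trans (ler_norm _).
    by rewrite lerBrDl natr1 ler_nat.
  - apply: le_trans (ler_norm _).
    by rewrite lerBrDl natr1 ler_nat.
(* The vortices are of class C^(k+2): [holder_norm_le] takes one order above k, and differences of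
   translates take another. *)
pose l := k.+1.
pose B := step_profile k.+1 rho z b.
have [B' B'c DB] : exists2 B' : R -> R, continuous B' &
    forall y : R, is_derive y 1 B (B' y).
  have [_ _ /(_ 1 (mem_head _ _))[B' B'k DB]] : Ck_global [:: 1 : R] k.+1 B.
    apply: (@Ck_global_step_profile R [:: 1] k.+1 N rho z b id).
    apply: Ck_global_affine => [y|e]; first exact: cvg_id.
    by rewrite inE => /eqP->; exists 1 => y; exact: is_derive_id.
  by exists B' => //; exact: (Ck_bounded_continuous (B'k : Ck_global [:: 1 : R] k B')).
(* The flattened profile. It vanishes for |y - y0| <= d, where f and F agree, and differs from [v]
   on [-1, 1] by the small primitive of F. *)
pose phi y := iter_primitive y0 k.+1 f y - iter_primitive y0 k.+1 F y.
have phi0 y : `|y - y0| <= d -> phi y = 0.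
  move=> yd; apply/eqP; rewrite subr_eq0; apply/eqP/esym.
  apply: (@iter_primitive_eq R [set y | `|y - y0| <= d] y0 k.+1 f
    (fun i => iter_primitive y0 i F)) => //=.
  - move=> s t w /=; rewrite !ler_norml => /andP[s1 s2] /andP[t1 t2] /andP[sw wt].
    by apply/andP; split; lra.
  - by rewrite subrr normr0 ltW.
  - by move=> i w _ _; exact: is_derive_iter_primitive.
  - by move=> i _; exact: iter_primitive_base.
have Dphi (y : R) : is_derive y 1 phi (iter_primitive y0 k f y - iter_primitive y0 k F y).
  exact: (@is_deriveB _ _ _ (iter_primitive y0 k.+1 f) (iter_primitive y0 k.+1 F)
    y 1 _ _ (is_derive_iter_primitive y0 k y fc) (is_derive_iter_primitive y0 k y Fc)).
pose W1 i := periodize (vortex1 l rho (z i)).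
pose W2 i := periodize (vortex2 l rho (z i)).
have [[lW1 lW2 _ _] _] := vortices_localized l rho01.
have CW1 i : Ck_global (axes R) k.+2 (W1 i).
  by apply: Ck_global_periodize; [exact: lW1.1|case: (Ck_global_vortex l rho (z i))].
have CW2 i : Ck_global (axes R) k.+2 (W2 i).
  by apply: Ck_global_periodize; [exact: lW2.1|case: (Ck_global_vortex l rho (z i))].
have CB : Ck_global (axes R) k.+1 (fun p => B p.2).
  apply: Ck_global_step_profile; apply: Ck_global_affine => [p|e].
    exact: cvg_snd.
  rewrite !inE => /orP[]/eqP->.
    by exists 0 => p; exact: (is_derive_snd0 id).
  by exists 1 => p; apply: (@is_derive_snd _ id); exact: is_derive_id.
have [MB MB0 BM] := Ck_global_periodic_bounded CB (fun p => erefl).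
have HW1 i := Ck_global_periodic_bounded (CW1 i) (@periodic_x_periodize _ _).
have HW2 i := Ck_global_periodic_bounded (CW2 i) (@periodic_x_periodize _ _).
pose m1 i := s2val (cid2 (HW1 i)); pose m2 i := s2val (cid2 (HW2 i)).
have m10 i : 0 <= m1 i by exact: s2valP (cid2 (HW1 i)).
have m20 i : 0 <= m2 i by exact: s2valP (cid2 (HW2 i)).
have W1M i : Ck_bounded (axes R) (@strip R) k.+2 (fun=> m1 i) (W1 i).
  exact: s2valP' (cid2 (HW1 i)).
have W2M i : Ck_bounded (axes R) (@strip R) k.+2 (fun=> m2 i) (W2 i).
  exact: s2valP' (cid2 (HW2 i)).
pose M := MB + \sum_i m1 i + \sum_i m2 i.
have S1 : 0 <= \sum_i m1 i by apply: sumr_ge0.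
have S2 : 0 <= \sum_i m2 i by apply: sumr_ge0.
have M1 : 0 < M + 1 by rewrite ltr_pwDr// !addr_ge0.
(* Chosen after all bounds on the vortices and on the step profile; M + 1 avoids a division by 0. *)
pose kappa := a / (M + 1).
have kappa0 : 0 < kappa by rewrite divr_gt0.
have kM : kappa * M <= a.
  rewrite /kappa mulrAC ler_pdivrMr// ler_pM2l//; lra.
pose V y := phi y + kappa * B y.
pose V' y := iter_primitive y0 k f y - iter_primitive y0 k F y + kappa * B' y.
have DV (y : R) : is_derive y 1 V (V' y) by apply: is_derive_add => //; exact: is_derive_mulc.
have V'c : continuous V'.
  move=> y; apply: cvgD; first apply: cvgB.
  - exact: continuous_iter_primitive.
  - exact: continuous_iter_primitive.
  - by apply: cvgM; [exact: cvg_cst|exact: B'c].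
have Vz i y : `|y - z i| < rho -> V y = kappa * b i.
  move=> yz; rewrite /V phi0 ?add0r; last first.
    have /andP[z0 z1] := zi i.
    have -> : y - y0 = (y - z i) + 3 * rho * i%:R by rewrite /z; ring.
    by rewrite (le_trans (ler_normD _ _))// (ger0_norm z0); lra.
  by congr (_ * _); apply: step_profile_eq (ltW yz) => // j; exact: sep.
have Vconst i y : `|y - z i| < rho -> V y = kappa * b i /\ V' y = 0.
  move=> yz; split; first exact: Vz.
  have [_ <-] := DV y.
  have /(@near_eq_derive _ _ _ V (cst (kappa * b i)) y 1) -> : \forall w \near y,
      V w = kappa * b i.
    near=> w; apply: Vz; near: w.
    apply: (@cvgr_lt _ _ _ _ (fun w : R => `|w - z i|) `|y - z i|) yz.
    by apply: cvg_norm; apply: cvgB; [exact: cvg_id|exact: cvg_cst].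
  by rewrite derive_cst.
have sep' (i j : 'I_N) y : j != i -> `|y - z i| < rho -> rho <= `|y - z j|.
  move=> ji yz; have := sep i j ji; have := ler_normB (y - z j) (y - z i).
  have -> : y - z j - (y - z i) = z i - z j by ring.
  lra.
have zin i : `|z i| <= 1 - 4 * rho.
  have /andP[z0 z1] := zi i.
  rewrite /z (le_trans (ler_normD _ _))// (ger0_norm z0); lra.
have inside i : rho <= `|1 - z i| /\ rho <= `|- 1 - z i|.
  have := zin i; rewrite ler_norml => /andP[z1 z2]; split.
    by apply: le_trans (ler_norm _); lra.
  by rewrite -normrN; apply: le_trans (ler_norm _); lra.
pose U theta := vortex_field l rho z kappa V theta.
exists kappa, U.
pose T1 := translates z (vortex1 l rho); pose T2 := translates z (vortex2 l rho).
have stripT (p : R * R) (c : R) : strip p -> strip (p.1 - c, p.2) by [].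
have CT1 theta : Ck_bounded (axes R) (@strip R) k.+2 (fun=> \sum_i m1 i) (T1 theta).
  exact: Ck_bounded_translates.
have CT2 theta : Ck_bounded (axes R) (@strip R) k.+2 (fun=> \sum_i m2 i) (T2 theta).
  exact: Ck_bounded_translates.
split; first exact: kappa0.
- exact: (euler_vortices l rho01 kappa sep' inside DV V'c Vconst).
- move=> theta.
  have T1p := @periodic_x_translates R N z (vortex1 l rho) theta.
  have T2p := @periodic_x_translates R N z (vortex2 l rho) theta.
  have gT1 : Ck_global (axes R) k.+1 (T1 theta) := Ck_bounded_global (leqnSn _) (CT1 theta).
  have gT2 : Ck_global (axes R) k.+1 (T2 theta) := Ck_bounded_global (leqnSn _) (CT2 theta).
  have gf := Ck_global_profile y0 k.+1 fc.
  have gF := Ck_globalM (Ck_global_cst (axes R) k.+1 (-1)) (Ck_global_profile y0 k.+1 Fc).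
  have gk : Ck_global (axes R) k.+1 (fun=> kappa) := Ck_global_cst _ _ _.
  have gk2 := Ck_globalM gk gT2.
  have sU : holder_space k alpha (U theta).
    apply: (holder_space_global al _ _ _ gk2).
    + by move=> p; exact: (congr1 (fun x => V p.2 + kappa * x) (T1p p)).
    + by move=> p; exact: (congr1 ( *%R kappa) (T2p p)).
    + apply: Ck_globalD; last exact: Ck_globalM.
      apply: Ck_globalD; last exact: Ck_globalM.
      have := Ck_globalD gf gF.
      suff -> : (fun p : R * R => iter_primitive y0 k.+1 f p.2 +
          -1 * iter_primitive y0 k.+1 F p.2) = fun p => phi p.2 by [].
      by apply/funext => p; rewrite mulN1r.
  (* First component of [U theta] minus the shear, rewritten without [v]: on [-1, 1] the primitive
     of f inside [phi] is [v] and cancels. The rest is of class C^(k+1) on the whole plane. *)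
  pose g1 (p : R * R) := -1 * iter_primitive y0 k.+1 F p.2 +
    kappa * (B p.2 + T1 theta p).
  have gg1 : Ck_global (axes R) k.+1 g1.
    by apply: Ck_globalD => //; apply: Ck_globalM => //; exact: Ck_globalD.
  have Ug p : cstrip p -> (g1 p, kappa * T2 theta p) = (U theta \- shear_flow v) p.
    move=> sp; rewrite /= /U /vortex_field /shear_flow.
    rewrite -[RHS]/(V p.2 + kappa * T1 theta p - v p.2, kappa * T2 theta p - 0).
    by congr (_, _); rewrite ?subr0// vE// /g1 /V /phi; ring.
  (* Orders up to k are small; order k + 1 is that of F itself and only bounded. *)
  pose AH j := if (j <= k)%N then a else M0.
  have AH0 j : 0 <= AH j by rewrite /AH; case: ifP => // _; exact: ltW.
  have HF : Ck_bounded (axes R) (@strip R) k.+1 AH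
      (fun p => iter_primitive y0 k.+1 F p.2).
    apply: Ck_bounded_profile => // -[|j] p jk sp.
      by rewrite subn0 /AH ltnn; exact: FM.
    by rewrite subSS /AH leq_subr; exact: Fa.
  pose A j := AH j + kappa * M.
  have kMl x : 0 <= x -> x <= M -> `|kappa| * x <= kappa * M.
    by move=> x0 xM; rewrite gtr0_norm// ler_pM2l.
  have g1A : Ck_bounded (axes R) (@strip R) k.+1 A g1.
    have BT := Ck_boundedD BM (Ck_bounded_weaken (leqnSn _) (@subset_refl _ _)
      (fun j _ _ => lexx _) (CT1 theta)).
    apply: (Ck_bounded_weaken (leqnn _) (@subset_refl _ _) _
      (Ck_boundedD (Ck_boundedZ (-1) HF) (Ck_boundedZ kappa BT))).
    move=> j _ _ /=; rewrite normrN normr1 mul1r lerD2l; apply: kMl.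
      by rewrite addr_ge0.
    by rewrite lerDl.
  have g2A : Ck_bounded (axes R) (@strip R) k.+1 A (fun p => kappa * T2 theta p).
    apply: (Ck_bounded_weaken (leqnSn _) (@subset_refl _ _) _
      (Ck_boundedZ kappa (CT2 theta))).
    move=> j _ _ /=; rewrite -[leLHS]add0r lerD//; apply: kMl => //.
    by rewrite /M lerDr addr_ge0.
  split; first exact: sU.
    apply: holder_space_ext Ug _; apply: (holder_space_global al _ _ gg1 gk2).
    + move=> p; exact: (congr1 (fun x => -1 * iter_primitive y0 k.+1 F p.2 +
        kappa * (B p.2 + x)) (T1p p)).
    + by move=> p; exact: (congr1 ( *%R kappa) (T2p p)).
  rewrite -(holder_norm_ext _ _ (fun p sp => Ug p (strip_cstrip sp))).
  have a20 : 0 <= 2 * a by rewrite mulr_ge0// ltW.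
  have M10 : 0 <= M0 + 1 by rewrite addr_ge0.
  have Aa j : (j <= k)%N -> A j <= 2 * a by move=> jk; rewrite /A /AH jk; lra.
  have AM : A k.+1 <= M0 + 1 by rewrite /A /AH ltnn; lra.
  apply: le_lt_trans (holder_norm_le al a20 M10 Aa AM g1A g2A) _.
  rewrite lte_fin; apply: le_lt_trans aeps.
  by rewrite /K /Ch -!mulrA lerD// ?mulrA// -natrM.
- pose MM := kappa * (\sum_i m1 i + \sum_i m2 i).
  have MM0 : 0 <= MM by rewrite mulr_ge0 ?addr_ge0// ltW.
  exists (k.+1%:R * (k.+1%:R * MM) + k.+1%:R * (2 * MM)).
    by apply: addr_ge0; apply: mulr_ge0 => //; apply: mulr_ge0.
  move=> theta theta' h h0 hh.
  have bnd (m : 'I_N -> R) (W : R -> R * R -> R) : (forall i, 0 <= m i) ->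
      (forall i, Ck_bounded (axes R) (@strip R) k.+2 (fun=> m i) (periodize (W (z i)))) ->
      \sum_i m i <= \sum_i m1 i + \sum_i m2 i ->
      Ck_bounded (axes R) (@strip R) k.+1 (fun=> MM * h)
        (fun p => kappa * (translates z W theta p - translates z W theta' p)).
    move=> m0 Wm mM.
    have D := @Ck_bounded_sum R _ (axes R) _ (index_enum 'I_N) _ k.+1 _ _
      (fun i => Ck_bounded_translate_diff (theta i) (theta' i) (Wm i)).
    have := Ck_boundedZ kappa D.
    have -> : (fun p : R * R => kappa * \sum_i (periodize (W (z i)) (p.1 - theta i, p.2) -
        periodize (W (z i)) (p.1 - theta' i, p.2))) =
        (fun p => kappa * (translates z W theta p - translates z W theta' p)).
      by apply/funext => p; rewrite sumrB.
    apply: Ck_bounded_weaken => // j _ _.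
    rewrite gtr0_norm// /MM -mulrA ler_pM2l//.
    apply: (@le_trans _ _ (\sum_i m i * h)).
      by apply: ler_sum => i _; rewrite ler_wpM2l.
    by rewrite -mulr_suml ler_wpM2r.
  have b1 : Ck_bounded (axes R) (@strip R) k.+1 (fun=> MM * h)
      (fun p => kappa * (T1 theta p - T1 theta' p)).
    by apply: bnd W1M _ => //; rewrite lerDl.
  have b2 : Ck_bounded (axes R) (@strip R) k.+1 (fun=> MM * h)
      (fun p => kappa * (T2 theta p - T2 theta' p)).
    by apply: bnd W2M _ => //; rewrite lerDr.
  have -> : U theta \- U theta' = fun p => (kappa * (T1 theta p - T1 theta' p),
      kappa * (T2 theta p - T2 theta' p)).
    apply/funext => p; rewrite /= /U /vortex_field.
    rewrite -[LHS]/(V p.2 + kappa * T1 theta p - (V p.2 + kappa * T1 theta' p),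
      kappa * T2 theta p - kappa * T2 theta' p).
    by congr (_, _); ring.
  have Mh0 : 0 <= MM * h by rewrite mulr_ge0.
  apply: le_trans (@holder_norm_le R k (fun=> MM * h) (MM * h) (MM * h) alpha _ _
    al Mh0 Mh0 _ _ b1 b2) _ => //.
  (* All orders have the same bound x here, and interpolation collapses: (2 x)^alpha (2 x)^(1 -
     alpha) = 2 x. *)
  rewrite lee_fin -powRD; last by rewrite addrC subrK oner_eq0.
  have X0 : 0 <= 2 * (MM * h) by apply: mulr_ge0.
  rewrite [alpha + _]addrC subrK (powRr1 X0) [leRHS]mulrDl.
  by rewrite -!mulrA.
have Uval theta i x : (U theta (x, z i)).2 =
    kappa * vortex2 l rho (z i) (reduce (x - theta i), z i).
  rewrite /U /vortex_field/= (@translates_single _ _ _ _ _ _ _ i lW2)// => j ji.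
  by apply: sep' ji _; rewrite /= subrr normr0.
have pi2 := @pi_ge2 R.
have rid : reduce (rho / 2) = rho / 2.
  rewrite /reduce /turns (_ : Num.floor _ = 0) ?mulr0 ?subr0//.
  apply: floor_def; rewrite add0r ler_pdivlMr ?mulr_gt0 ?pi_gt0//.
  by rewrite ltr_pdivrMr ?mulr_gt0 ?pi_gt0// mul0r mul1r; apply/andP; split; lra.
have zstrip i x : strip (x, z i).
  by have := zin i; rewrite /strip/= ler_norml => /andP[? ?]; apply/andP; split; lra.
split.
- move=> theta theta' p th; rewrite /U /vortex_field.
  by rewrite !(@translates_periodic _ _ _ _ theta theta').
- move=> theta i; exists (rho / 2 + theta i, z i); first exact: zstrip.
  by rewrite Uval addrK rid mulr_gt0// vortex2_center.
(* The observation point is half a radius to the right of the centre that the vortex has at phase 0,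
   where its velocity points upwards. *)
- move=> i; exists (rho / 2, z i), (kappa * vortex2 l rho (z i) (rho / 2, z i)).
  split; first exact: zstrip.
  + by rewrite mulr_gt0// vortex2_center.
  + by move=> theta ti; rewrite Uval ti subr0 rid.
  (* A positive value puts rho / 2 - theta_i, modulo 2 pi, into (0, rho); so theta_i is within rho /
     2 < r of a multiple of 2 pi. *)
  + move=> theta; rewrite Uval pmulr_rgt0// => /(vortex2_gt0 rho0)/= /andP[x0 x1].
    rewrite -(cos_periodic (theta i) (- turns (rho / 2 - theta i))).
    have -> : theta i - 2 * pi * (- turns (rho / 2 - theta i))%:~R =
        rho / 2 - reduce (rho / 2 - theta i).
      by rewrite /reduce mulrNz; move: pi (_%:~R) => s t; ring.
    by apply: rcos; rewrite ltr_norml; apply/andP; split; lra.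
Unshelve. all: by end_near. Qed.

End VortexFamily.

(** * Means of cosine sums *)

Section TrigonometricSums.
Variable R : realType.
Implicit Types (q : seq (R * R)) (t tau : R).

(* A finite cosine sum is encoded by its list of (amplitude, frequency) pairs. *)
Definition cos_sum q t : R := \sum_(a <- q) a.1 * cos (a.2 * t).

(** The amplitude at frequency 0, which is the time average. *)
Definition cos_mean q : R := \sum_(a <- q | a.2 == 0) a.1.

Definition cos_mul q q' : seq (R * R) :=
  [seq (a.1 * b.1 / 2, a.2 + b.2) | a <- q, b <- q'] ++
  [seq (a.1 * b.1 / 2, a.2 - b.2) | a <- q, b <- q'].

Lemma cos_sum_cat q q' t : cos_sum (q ++ q') t = cos_sum q t + cos_sum q' t.
Proof. by rewrite /cos_sum big_cat. Qed.

Lemma cos_mean_cat q q' : cos_mean (q ++ q') = cos_mean q + cos_mean q'.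
Proof. by rewrite /cos_mean big_cat. Qed.

Lemma cos_sum_mul q q' t : cos_sum (cos_mul q q') t = cos_sum q t * cos_sum q' t.
Proof.
rewrite /cos_mul cos_sum_cat /cos_sum !big_allpairs_dep/= -big_split/= mulr_suml.
apply: eq_bigr => a _; rewrite -big_split/= mulr_sumr; apply: eq_bigr => b _.
by rewrite mulrDl mulrBl cosD cosB; lra.
Qed.

(** Equal or opposite nonzero frequencies also contribute to frequency 0, but with nonnegative
    amplitudes; hence an inequality, valid whatever relations hold between the frequencies. *)
Lemma cos_mean_mul_ge q q' :
  (forall a, a \in q -> 0 <= a.1) -> (forall a, a \in q' -> 0 <= a.1) ->
  cos_mean q * cos_mean q' <= cos_mean (cos_mul q q').
Proof.
move=> q0 q'0; rewrite /cos_mul cos_mean_cat /cos_mean big_mkcond.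
rewrite [X in _ * X]big_mkcond [X in _ <= X + _]big_mkcond.
rewrite [X in _ <= _ + X]big_mkcond !big_allpairs_dep/= -big_split/= mulr_suml.
rewrite big_seq [leRHS]big_seq; apply: ler_sum => a aq.
rewrite -big_split/= mulr_sumr big_seq [leRHS]big_seq; apply: ler_sum => b bq'.
have ab0 : 0 <= a.1 * b.1 by apply: mulr_ge0; [exact: q0|exact: q'0].
have [->|a0] := eqVneq a.2 0; have [->|b0] := eqVneq b.2 0.
- by rewrite addr0 subr0 eqxx; lra.
- by rewrite mulr0 add0r sub0r oppr_eq0 (negPf b0); lra.
- by rewrite mul0r addr0 subr0 (negPf a0); lra.
- by rewrite mul0r; case: ifP => _; case: ifP => _; lra.
Qed.

Lemma cos_mul_amplitude_ge0 q q' :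
  (forall a, a \in q -> 0 <= a.1) -> (forall a, a \in q' -> 0 <= a.1) ->
  forall a, a \in cos_mul q q' -> 0 <= a.1.
Proof.
move=> q0 q'0 a; rewrite mem_cat => /orP[] /allpairsP[[b c]] /= [bq cq ->] /=;
by apply: divr_ge0 => //; apply: mulr_ge0; [exact: q0|exact: q'0].
Qed.

(** Multiplication by 2 sin (x / 2) makes the sum telescope, and this factor is nonzero in the given
    range. *)
Lemma sum_cos_bounded (x : R) : 0 < `|x| < 2 * pi ->
  exists C, forall L, `|\sum_(l < L) cos (x * l%:R)| <= C.
Proof.
move=> /andP[x0 x2].
have s0 : sin (x / 2) != 0.
  have [xp|xn|xe] := ltgtP x 0.
  - rewrite -[x / 2]opprK sinN oppr_eq0 gt_eqF// sin_gt0_pi//.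
    by move: x2; rewrite ltr0_norm//; lra.
  - rewrite gt_eqF// sin_gt0_pi//.
    by move: x2; rewrite gtr0_norm//; lra.
  - by rewrite xe normr0 ltxx in x0.
exists (`|2 * sin (x / 2)|^-1 * 2) => L.
have s20 : 2 * sin (x / 2) != 0 by rewrite mulf_neq0// pnatr_eq0.
rewrite -ler_pdivrMl ?invr_gt0 ?normr_gt0// invrK -normrM.
have -> : 2 * sin (x / 2) * (\sum_(l < L) cos (x * l%:R)) =
    sin (x * L%:R - x / 2) - sin (- (x / 2)).
  elim: L => [|L IH]; first by rewrite big_ord0 !mulr0 sub0r subrr.
  rewrite big_ord_recr/= mulrDr IH.
  have -> : x * L.+1%:R - x / 2 = x * L%:R + x / 2 by rewrite -natr1; field.
  rewrite sinB sinD; lra.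
apply: le_trans (ler_normB _ _) _.
by rewrite -[2]/(1 + 1) lerD// ler_norml sin_geN1 sin_le1.
Qed.

(* The mean is the limit of averages along the progression of a small step. *)
Lemma cos_mean_ge0 q : (forall t, 0 <= cos_sum q t) -> 0 <= cos_mean q.
Proof.
move=> q0.
(* A step so small that no nonzero frequency becomes a multiple of 2 pi along the progression. *)
have [tau tau0 Htau] : exists2 tau, 0 < tau &
    forall a, a \in q -> `|a.2 * tau| < 2 * pi.
  pose S := \sum_(a <- q) `|a.2| + 1.
  have S0 : 0 < S by rewrite ltr_pwDr// sumr_ge0.
  exists (S^-1); first by rewrite invr_gt0.
  move=> a aq; rewrite normrM [`|S^-1|]ger0_norm ?invr_ge0 ?ltW//.
  rewrite ltr_pdivrMr//; apply: (@le_lt_trans _ _ (1 * S)).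
    rewrite mul1r /S (big_rem a)//= -addrA lerDl addr_ge0// sumr_ge0//.
  by rewrite ltr_pM2r//; have := @pi_ge2 R; lra.
have [C HC] : exists C, forall L,
    \sum_(l < L) cos_sum q (l%:R * tau) <= L%:R * cos_mean q + C.
  elim: q {q0} Htau => [|[a w] q IH] Htau.
    by exists 0 => L; rewrite /cos_mean big_nil mulr0 addr0 big1// => i _;
      rewrite /cos_sum big_nil.
  have [C HC] : exists C, forall L,
      \sum_(l < L) cos_sum q (l%:R * tau) <= L%:R * cos_mean q + C.
    by apply: IH => b bq; apply: Htau; rewrite in_cons bq orbT.
  have eqL L : \sum_(l < L) cos_sum ((a, w) :: q) (l%:R * tau) =
      a * (\sum_(l < L) cos (w * tau * l%:R)) +
      \sum_(l < L) cos_sum q (l%:R * tau).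
    rewrite mulr_sumr -big_split; apply: eq_bigr => l _ /=.
    by rewrite /cos_sum big_cons/= [_ * tau]mulrC mulrA.
  have [w0|w0] := eqVneq w 0.
    exists C => L; rewrite eqL /cos_mean big_cons/= w0 eqxx mulrDr -addrA lerD ?HC//.
    rewrite (eq_bigr (fun=> 1)) ?big_const_ord; last first.
      by move=> l _; rewrite !mul0r cos0.
    by rewrite iter_addr_0 mulrC.
  have [|C' HC'] := @sum_cos_bounded (w * tau).
    rewrite normr_gt0 mulf_neq0 ?(gt_eqF tau0)//=.
    by apply: (Htau (a, w)); rewrite mem_head.
  exists (`|a| * C' + C) => L.
  rewrite eqL /cos_mean big_cons/= (negPf w0) addrCA lerD ?HC//.
  by rewrite (le_trans (ler_norm _))// normrM ler_wpM2l ?HC'.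
rewrite leNgt; apply/negP => mneg.
have mpos : 0 < - cos_mean q by rewrite oppr_gt0.
have := archi_boundP (normr_ge0 (C / - cos_mean q)).
set L := Num.bound _ => HL.
have := HC L; apply/negP; rewrite -ltNge.
apply: (@lt_le_trans _ _ 0); last by apply: sumr_ge0 => l _.
have := le_lt_trans (ler_norm _) HL; rewrite ltr_pdivrMr//; lra.
Qed.

End TrigonometricSums.

(** * A nonnegative kernel concentrated at the times of return *)

Section FejerKernel.
Variable R : realType.
Implicit Types (w t x : R) (ws : seq R) (S : set R).

(** Binomial expansion cos^m x = 2^(-m) sum_i C(m, i) cos ((m - 2 i) x) at x = w t. *)
Definition cos_pow_terms m w : seq (R * R) :=
  [seq ('C(m, i)%:R / 2 ^+ m, (m%:R - 2 * i%:R) * w) | i <- iota 0 m.+1].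

Lemma cos_sum_cos_pow_terms m w t :
  cos_sum (cos_pow_terms m w) t = cos (w * t) ^+ m.
Proof.
rewrite /cos_sum big_map /=.
have -> : \sum_(j <- iota 0 m.+1)
    'C(m, j)%:R / 2 ^+ m * cos ((m%:R - 2 * j%:R) * w * t) =
    2^-1 ^+ m * \sum_(j < m.+1) 'C(m, j)%:R * cos ((m%:R - 2 * j%:R) * (w * t)).
  rewrite -{1}[m.+1]subn0 -/(index_iota 0 m.+1) big_mkord mulr_sumr.
  by apply: eq_bigr => i _; rewrite exprVn mulrA [X in X * _]mulrC -!mulrA.
move: (w * t) => x; elim: m => [|m IH].
  by rewrite big_ord_recl big_ord0 !expr0 bin0 mulr0 subr0 mul0r cos0; ring.
rewrite [RHS]exprS -IH exprS -mulrA mulrCA [in RHS]mulrCA; congr (_ * _).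
rewrite [in RHS]mulr_sumr [in LHS]big_ord_recl/= bin0.
under eq_bigr => i _ do rewrite binS natrD mulrDl.
rewrite big_split/= big_ord_recr/= bin_small// mul0r addr0.
have -> : \sum_(i < m.+1) cos x * ('C(m, i)%:R * cos ((m%:R - 2 * i%:R) * x)) =
  2^-1 * (\sum_(i < m.+1) 'C(m, i)%:R * cos ((m.+1%:R - 2 * i%:R) * x)
   + \sum_(i < m.+1) 'C(m, i)%:R * cos ((m.+1%:R - 2 * i.+1%:R) * x)).
  rewrite -big_split mulr_sumr; apply: eq_bigr => i _ /=.
  have -> : (m.+1%:R - 2 * i%:R) * x = (m%:R - 2 * i%:R) * x + x.
    by rewrite -natr1; ring.
  have -> : (m.+1%:R - 2 * i.+1%:R) * x = (m%:R - 2 * i%:R) * x - x.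
    by rewrite -[m.+1%:R]natr1 -[i.+1%:R]natr1; ring.
  by rewrite cosD cosB; field.
congr (_ * _); rewrite addrA; congr (_ + _).
by rewrite [in RHS]big_ord_recl/= bin0.
Qed.

(** The central coefficient is the largest of the 2 K + 1 that add up to 4^K; the proof uses the
    recursion from K to K + 1. *)
Lemma central_binomial_ge K : (4 ^ K <= 'C(K.*2, K) * K.*2.+1)%N.
Proof.
elim: K => // K IH.
have e1 := mul_bin_diag K.*2.+2 K; have e2 := mul_bin_diag K.*2.+1 K.
have e3 : 'C(K.*2.+1, K.+1) = 'C(K.*2.+1, K).
  by rewrite -bin_sub ?ltnS -?addnn ?leq_addr// subSS addKn.
rewrite doubleS expnS; rewrite /= e3 in e1 e2; nia.
Qed.

Lemma cos_mean_cos_pow_terms K w :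
  K.*2.+1%:R^-1 <= cos_mean (cos_pow_terms K.*2 w).
Proof.
rewrite /cos_mean big_map big_mkcond.
have -> : iota 0 K.*2.+1 = index_iota 0 K.*2.+1 by rewrite /index_iota subn0.
rewrite big_mkord (bigD1 (inord K)) //=.
rewrite inordK; last by rewrite ltnS -addnn leq_addr.
have -> : (K.*2%:R - 2 * K%:R) * w == 0.
  by rewrite -muln2 natrM mulrC [_ * 2]mulrC subrr mulr0.
apply: (@le_trans _ _ ('C(K.*2, K)%:R / 2 ^+ K.*2)); last first.
  by rewrite lerDl sumr_ge0// => i _; case: ifP.
have -> : 2 ^+ K.*2 = (4 ^ K)%:R :> R.
  by rewrite -mul2n exprM natrX; congr (_ ^+ _); rewrite expr2; lra.
rewrite ler_pdivlMr ?ltr0n ?expn_gt0// mulrC ler_pdivrMr ?ltr0n//.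
by rewrite -natrM ler_nat central_binomial_ge.
Qed.

(** As cos^2 (s / 2) = (1 + cos s) / 2, powers of order 2 K at half frequencies give the product of
    the ((1 + cos (w t)) / 2)^K, whose frequencies are integral combinations of [ws]. *)
Definition fejer K ws : seq (R * R) :=
  foldr (fun w q => cos_mul (cos_pow_terms K.*2 (w / 2)) q) [:: (1, 0)] ws.

Lemma cos_sum_fejer K ws t :
  cos_sum (fejer K ws) t = \prod_(w <- ws) ((1 + cos (w * t)) / 2) ^+ K.
Proof.
elim: ws => [|w ws IH] /=.
  by rewrite /cos_sum big_seq1 big_nil/= mul0r cos0 mulr1.
rewrite cos_sum_mul IH big_cons cos_sum_cos_pow_terms; congr (_ * _).
rewrite -mul2n exprM; congr (_ ^+ _).
have -> : w * t = (w / 2 * t) *+ 2 by rewrite mulr2n; field.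
by rewrite cos_mulr2n mulr2n; field.
Qed.

Lemma cos_pow_terms_ge0 m w a : a \in cos_pow_terms m w -> 0 <= a.1.
Proof. by move=> /mapP[i _ ->] /=; rewrite divr_ge0// exprn_ge0. Qed.

Lemma fejer_ge0 K ws a : a \in fejer K ws -> 0 <= a.1.
Proof.
elim: ws a => [|w ws IH] a /=; first by rewrite inE => /eqP->.
by apply: cos_mul_amplitude_ge0 => // b; exact: cos_pow_terms_ge0.
Qed.

Lemma cos_mean_fejer K ws :
  K.*2.+1%:R^-1 ^+ size ws <= cos_mean (fejer K ws).
Proof.
elim: ws => [|w ws IH] /=; first by rewrite /cos_mean big_mkcond big_seq1 eqxx.
apply: le_trans (cos_mean_mul_ge _ _); last first.
- exact: fejer_ge0.
- by move=> a; exact: cos_pow_terms_ge0.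
- by rewrite exprS ler_pM ?invr_ge0 ?exprn_ge0 ?invr_ge0// cos_mean_cos_pow_terms.
Qed.

Lemma fejer_frequency S K ws a : S 0 -> (forall x y, S x -> S y -> S (x - y)) ->
  (forall w, w \in ws -> S w) -> a \in fejer K ws -> S a.2.
Proof.
move=> S0 SB; have SN x : S x -> S (- x) by move=> ?; rewrite -sub0r; exact: SB.
have SD x y : S x -> S y -> S (x + y).
  by move=> ? ?; rewrite -[y]opprK; apply/SB => //; exact: SN.
have Sn x n : S x -> S (n%:R * x).
  move=> Sx; elim: n => [|n IH]; first by rewrite mul0r.
  by rewrite -natr1 mulrDl mul1r; exact: SD.
elim: ws a => [|w ws IH] a wsS /=; first by rewrite inE => /eqP->.
have {}IH b : b \in fejer K ws -> S b.2.
  by apply: IH => x xw; apply: wsS; rewrite in_cons xw orbT.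
have Sw b : b \in cos_pow_terms K.*2 (w / 2) -> S b.2.
  move=> /mapP[i _ ->] /=.
  have -> : (K.*2%:R - 2 * i%:R) * (w / 2) = K%:R * w - i%:R * w.
    by rewrite -muln2 natrM; field.
  by apply: SB; apply/Sn/wsS; rewrite mem_head.
rewrite mem_cat => /orP[] /allpairsP[[b c]] /= [/Sw Sb /IH Sc ->] /=.
- exact: SD.
- exact: SB.
Qed.

(** On [eta, pi] the cosine has a maximum below 1; a value of (1 + cos t) / 2 above the
    corresponding threshold brings t within eta of 2 pi Z. *)
Lemma cos_near1 (eta : R) : 0 < eta -> exists2 x, 0 < x < 1 &
  forall t, x < (1 + cos t) / 2 -> exists m : int, `|t - 2 * pi * m%:~R| < eta.
Proof.
move=> eta0; wlog etapi : eta eta0 / eta <= pi.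
  move=> H; have m0 : 0 < Num.min eta pi by rewrite lt_min eta0 pi_gt0.
  have [|x x01 Hx] := H _ m0; first by rewrite ge_min lexx orbT.
  by exists x => // t /Hx[m]; rewrite lt_min => /andP[]; exists m.
have cc : {within `[eta, pi], continuous (@cos R)}.
  by apply: continuous_subspaceT => x; exact: continuous_cos.
have [c /[!in_itv]/= /andP[ec cp] cmax] := EVT_max etapi cc.
have c1 : cos c < 1.
  rewrite lt_neqAle cos_le1 andbT -cos0; apply/eqP => /cos_inj.
  rewrite !in_itv/= cp pi_ge0 lexx/= => /(_ _ _)/wrap[||c0] //.
    by apply/andP; split => //; lra.
  by move: ec; rewrite c0; lra.
have := cos_geN1 c => cN1.
(* The 1/2 only ensures that the threshold is positive. *)
exists (Num.max ((1 + cos c) / 2) 2^-1).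
  by rewrite lt_max gt_max; apply/andP; split; [|apply/andP; split]; lra.
move=> t; rewrite gt_max => /andP[Ht _].
exists (turns t); rewrite -/(reduce t) ltNge; apply/negP => ey.
have : cos (reduce t) <= cos c.
  by rewrite -cos_norm; apply: cmax; rewrite in_itv/= ey/= reduce_le_pi.
by rewrite cos_reduce; lra.
Qed.

(** With h = 1 / x - 1, the Bernoulli inequality gives x^m <= 1 / (m h). For K = m (n + 1) the left
    side is O(m^(-n-1)), the right side of order m^(-n). *)
Lemma poly_lt_geometric (n : nat) x : 0 < x < 1 ->
  exists K : nat, 3 * x ^+ K < K.*2.+1%:R^-1 ^+ n.
Proof.
move=> /andP[x0 x1]; pose h := x^-1 - 1.
have h0 : 0 < h by rewrite subr_gt0 invf_gt1.
have bern m : 1 + m%:R * h <= x^-1 ^+ m.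
  have -> : x^-1 = 1 + h by rewrite /h; ring.
  elim: m => [|m IH]; first by rewrite mul0r addr0 expr0.
  apply: (@le_trans _ _ ((1 + h) * (1 + m%:R * h))).
    rewrite -natr1; have : 0 <= m%:R * h * h by rewrite !mulr_ge0// ltW.
    lra.
  by rewrite exprS ler_wpM2l//; lra.
pose B := 3 * (3 * n.+1%:R) ^+ n / h ^+ n.+1.
have := archi_boundP (normr_ge0 B); set m := Num.bound _ => Bm.
have {}Bm : B < m%:R by exact: le_lt_trans (ler_norm _) Bm.
have B0 : 0 <= B by rewrite divr_ge0 ?mulr_ge0 ?exprn_ge0 ?mulr_ge0// ltW.
have m0 : 0 < m%:R :> R by exact: le_lt_trans B0 Bm.
exists (m * n.+1)%N; rewrite exprM exprVn.
have D0 : 0 < (m * n.+1).*2.+1%:R :> R by rewrite ltr0n.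
rewrite -[X in _ < X]mul1r ltr_pdivlMr ?exprn_gt0//.
have le1 : x ^+ m <= (m%:R * h)^-1.
  rewrite -[x ^+ m]invrK lef_pV2 ?posrE ?invr_gt0 ?exprn_gt0 ?mulr_gt0//.
  by rewrite -exprVn (le_trans _ (bern m))// lerDr.
have le2 : (m * n.+1).*2.+1%:R <= 3 * n.+1%:R * m%:R :> R.
  rewrite -!natrM ler_nat.
  have : (0 < m * n.+1)%N by rewrite muln_gt0 -(ltr0n R) m0.
  by lia.
apply: (@le_lt_trans _ _
    (3 * (m%:R * h)^-1 ^+ n.+1 * (3 * n.+1%:R * m%:R) ^+ n)).
  apply: ler_pM.
  - by rewrite mulr_ge0// !exprn_ge0// ltW.
  - by rewrite exprn_ge0.
  - by rewrite ler_pM2l// lerXn2r ?nnegrE ?invr_ge0 ?mulr_ge0 ?exprn_ge0// ltW.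
  - by rewrite lerXn2r ?nnegrE ?mulr_ge0// ltW.
have -> : 3 * (m%:R * h)^-1 ^+ n.+1 * (3 * n.+1%:R * m%:R) ^+ n = B / m%:R.
  rewrite /B invfM !exprMn !exprVn [m%:R ^+ n.+1]exprS.
  by field; rewrite !expf_neq0 ?gt_eqF//.
by rewrite ltr_pdivrMr// mul1r.
Qed.

(* Integrating the nonnegative kernel [fejer K] against [cos (c t) - 1/2], which
   is positive except where the kernel is exponentially small, would contradict
   the polynomial lower bound on the mean of the kernel. *)
Lemma frequency_in_span (N : nat) (omega : 'rV[R]_N) (c eta : R) : 0 < eta ->
  (forall t, (forall j, exists m : int,
      `|omega 0 j * t - 2 * pi * m%:~R| < eta) -> 2^-1 <= cos (c * t)) ->
  exists m : 'I_N -> int, c = \sum_(j < N) (m j)%:~R * omega 0 j.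
Proof.
move=> eta0 Hc; have [x x01 Hx] := cos_near1 eta0.
pose S := [set y | exists m : 'I_N -> int, y = \sum_j (m j)%:~R * omega 0 j].
have S0 : S 0 by exists (fun=> 0); rewrite big1// => j _; rewrite mul0r.
have SB y z : S y -> S z -> S (y - z).
  move=> [m ->] [m' ->]; exists (fun j => m j - m' j).
  by rewrite -sumrB; apply: eq_bigr => j _; rewrite intrB mulrBl.
apply: contrapT => cS; have {}cS : ~ S c by [].
pose ws := [seq omega 0 j | j <- enum 'I_N].
have wsS w : w \in ws -> S w.
  move=> /mapP[j _ ->]; exists (fun i => (i == j)%:Z).
  rewrite (bigD1 j)//= eqxx mul1r big1 ?addr0// => i /negPf->.
  by rewrite mul0r.
have [K HK] := poly_lt_geometric N x01.
have mF := cos_mean_fejer K ws; rewrite size_map size_enum_ord in mF.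
pose F := fejer K ws.
(* q encodes F(t) (cos (c t) - 1/2) + (3/2) x^K, which is nonnegative at all times. For c outside
   the span its mean is (3/2) x^K minus half the mean of F, negative by the choice of K. *)
pose q := cos_mul F [:: (1, c)] ++
  ([seq (- (a.1 / 2), a.2) | a <- F] ++ [:: (3 / 2 * x ^+ K, 0)]).
have q0 : 0 <= cos_mean q.
  apply: cos_mean_ge0 => t; rewrite /q cos_sum_cat cos_sum_mul cos_sum_cat.
  have -> : cos_sum [:: (1, c)] t = cos (c * t).
    by rewrite /cos_sum big_seq1 mul1r.
  have -> : cos_sum [:: (3 / 2 * x ^+ K, 0)] t = 3 / 2 * x ^+ K.
    by rewrite /cos_sum big_seq1/= mul0r cos0 mulr1.
  have -> : cos_sum [seq (- (a.1 / 2), a.2) | a <- F] t = - (cos_sum F t / 2).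
    rewrite /cos_sum big_map/= mulr_suml -sumrN; apply: eq_bigr => a _.
    by rewrite mulNr mulrAC.
  have P01 j : 0 <= (1 + cos (omega 0 j * t)) / 2 <= 1.
    have := cos_geN1 (omega 0 j * t); have := cos_le1 (omega 0 j * t).
    by move=> *; apply/andP; split; lra.
  have Fj : cos_sum F t = \prod_j ((1 + cos (omega 0 j * t)) / 2) ^+ K.
    by rewrite cos_sum_fejer /ws big_map big_enum.
  have F0 : 0 <= cos_sum F t.
    rewrite Fj; apply: prodr_ge0 => j _.
    by rewrite exprn_ge0//; case/andP: (P01 j).
  have x0 : 0 <= x ^+ K by rewrite exprn_ge0// ltW//; case/andP: x01.
  have cl := cos_geN1 (c * t).
  (* At a time of return cos (c t) >= 1/2. Otherwise one factor of the kernel is at most x^K, the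
     others are at most 1, and cos (c t) - 1/2 >= -3/2. *)
  have [near|/existsNP[j Hj]] := pselect (forall j, exists m : int,
      `|omega 0 j * t - 2 * pi * m%:~R| < eta).
    have := Hc t near => c2; have : 0 <= cos_sum F t * (cos (c * t) - 2^-1).
      by rewrite mulr_ge0// subr_ge0.
    lra.
  have Fx : cos_sum F t <= x ^+ K.
    rewrite Fj (bigD1 j)//=; apply: (@le_trans _ _ (x ^+ K * 1)); last first.
      by rewrite mulr1.
    have /andP[Pj0 Pj1] := P01 j.
    have Pjx : (1 + cos (omega 0 j * t)) / 2 <= x.
      by rewrite leNgt; apply/negP => /Hx.
    apply: ler_pM; rewrite ?exprn_ge0//.
    - by apply: prodr_ge0 => i _; rewrite exprn_ge0//; case/andP: (P01 i).
    - by rewrite lerXn2r// nnegrE// ltW//; case/andP: x01.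
    - apply: prodr_ile1 => i _; case/andP: (P01 i) => i0 i1.
      by rewrite exprn_ge0// exprn_ile1.
  have : 0 <= cos_sum F t * (1 + cos (c * t)) by rewrite mulr_ge0//; lra.
  by lra.
(* The frequencies are d + c and d - c with d in the span, so none of them is 0. *)
have mean0 : cos_mean (cos_mul F [:: (1, c)]) = 0.
  rewrite /cos_mean big1_seq// => a /andP[/eqP a0]; rewrite mem_cat.
  move=> /orP[] /allpairsP[[d e]] /= [dF /[!inE] /eqP -> ae];
    exfalso; apply: cS; have Sd := fejer_frequency S0 SB wsS dF.
  - have -> : c = 0 - d.2 by move: a0; rewrite ae/= => a0; lra.
    exact: SB.
  - by have -> : c = d.2 by move: a0; rewrite ae/= => a0; lra.
move: q0; rewrite /q cos_mean_cat mean0 add0r cos_mean_cat.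
have -> : cos_mean [seq (- (a.1 / 2), a.2) | a <- F] = - (cos_mean F / 2).
  rewrite /cos_mean big_map/= mulr_suml -sumrN.
  by apply: eq_bigr.
have -> : cos_mean [:: (3 / 2 * x ^+ K, 0)] = 3 / 2 * x ^+ K.
  by rewrite /cos_mean big_mkcond big_seq1/= eqxx.
move: mF; rewrite -/F; lra.
Qed.

End FejerKernel.

(** * Rational independence *)

(** The N x N' matrix of coefficients has a nonzero left kernel over the rationals; a vector in it
    is the relation. *)
Lemma integer_combination_dependent (R : realType) (N N' : nat) (c : 'I_N -> R)
    (omega : 'I_N' -> R) (m : 'I_N -> 'I_N' -> int) : (N' < N)%N ->
  (forall i, c i = \sum_j (m i j)%:~R * omega j) ->
  exists2 q : 'I_N -> rat, \sum_i ratr (q i) * c i = 0 & exists i, q i != 0.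
Proof.
move=> NN cE; pose M : 'M[rat]_(N, N') := \matrix_(i, j) (m i j)%:~R.
have : kermx M != 0.
  rewrite kermx_eq0 -row_leq_rank -ltnNge.
  by rewrite (leq_ltn_trans (rank_leq_col M)).
rewrite -mxrank_eq0 -lt0n => kM.
have /rowV0Pn[w /sub_kermxP wM w0] : kermx M != 0 by rewrite -mxrank_eq0 -lt0n.
exists (w 0).
  under eq_bigr => i _ do rewrite cE mulr_sumr.
  rewrite exchange_big big1//= => j _.
  under eq_bigr => i _ do rewrite mulrA -ratr_int -rmorphM/=.
  rewrite -mulr_suml -rmorph_sum/=.
  have -> : \sum_i w 0 i * (m i j)%:~R = (w *m M) 0 j.
    by rewrite mxE; apply: eq_bigr => i _; rewrite mxE.
  by rewrite wM mxE rmorph0 mul0r.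
apply: contrapT => w00; move/eqP: w0; apply; apply/rowP => i; rewrite mxE.
by apply/eqP; apply: contrapT => /negP wi; apply: w00; exists i.
Qed.

(** Euclid's construction: the least prime factor of p! + 1 exceeds p. *)
Fixpoint growing_prime (k : nat) : nat :=
  if k is k'.+1 then pdiv (growing_prime k')`!.+1 else 2.

Lemma prime_growing_prime k : prime (growing_prime k).
Proof. by case: k => //= k; rewrite pdiv_prime// ltnS fact_gt0. Qed.

Lemma growing_prime_inj : injective growing_prime.
Proof.
have incr k : (growing_prime k < growing_prime k.+1)%N.
  rewrite ltnNge; apply/negP => le.
  have pp := prime_growing_prime k.+1.
  have := pdiv_dvd (growing_prime k)`!.+1; rewrite -/(growing_prime k.+1).
  rewrite -[X in (_ %| X)%N]addn1 dvdn_addr ?dvdn_fact ?prime_gt0// dvdn1.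
  by move=> /eqP p1; rewrite p1 in pp.
by apply: incn_inj; apply: leq_mono; exact: (homo_ltn ltn_trans incr).
Qed.

Lemma logn_prod_primes (N : nat) (p u : 'I_N -> nat) i :
  (forall j, prime (p j)) -> injective p -> logn (p i) (\prod_j p j ^ u j) = u i.
Proof.
move=> pp pinj; have pos j : (0 < p j ^ u j)%N by rewrite expn_gt0 prime_gt0.
have -> : logn (p i) (\prod_j p j ^ u j) = (\sum_j logn (p i) (p j ^ u j))%N.
  pose K a b := ((0 < a)%N /\ logn (p i) a = b).
  suff [] : K (\prod_j p j ^ u j)%N (\sum_j logn (p i) (p j ^ u j))%N by [].
  apply: (big_ind2 K); rewrite /K; first by rewrite logn1.
  - by move=> a b a' b' [a0 <-] [a'0 <-]; rewrite muln_gt0 a0 lognM.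
  - by move=> j _.
rewrite (bigD1 i)//= pfactorK// big1 ?addn0// => j ji.
by rewrite lognX logn_prime// eq_sym (inj_eq pinj) (negPf ji) muln0.
Qed.

(** Clear denominators, move the negative coefficients to the other side and exponentiate: two
    products of prime powers are equal, and unique factorisation equates their exponents. *)
Lemma rationally_independent_ln_primes (R : realType) (N : nat) (kappa : R) :
  kappa != 0 ->
  rationally_independent
    (\row_(i < N) (kappa * ln (growing_prime i)%:R)).
Proof.
move=> k0 q; under eq_bigr => i _ do rewrite mxE mulrCA.
rewrite -mulr_sumr => /eqP; rewrite mulf_eq0 (negPf k0)/= => /eqP q0.
pose p (i : 'I_N) := growing_prime i.
have pp i : prime (p i) by exact: prime_growing_prime.
have pinj : injective p by move=> i j /growing_prime_inj/val_inj.
pose D : int := \prod_i denq (q i).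
have D0 : D != 0 by apply/prodf_neq0 => i _; exact: denq_neq0.
pose a i : int := numq (q i) * \prod_(j | j != i) denq (q j).
have aE i : (a i)%:~R = D%:~R * q i.
  pose P : int := \prod_(j | j != i) denq (q j).
  have -> : D = denq (q i) * P by rewrite /D (bigD1 i).
  rewrite -[a i]/(numq (q i) * P) !intrM numqE; ring.
have sa : \sum_i (a i)%:~R * ln (p i)%:R = 0 :> R.
  transitivity (ratr D%:~R * \sum_i ratr (q i) * ln (p i)%:R : R).
    rewrite mulr_sumr; apply: eq_bigr => i _.
    by rewrite mulrA -rmorphM -aE /= ratr_int.
  by rewrite q0 mulr0.
suff a0 i : a i = 0.
  move=> i; have /eqP := aE i; rewrite a0 eq_sym mulf_eq0 intr_eq0 (negPf D0).
  by move/eqP.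
(* Positive and negative parts of [a i]; one of them is 0, so their equality forces [a i = 0]. *)
pose u (i : 'I_N) : nat := if a i is Posz k then k else 0%N.
pose w (i : 'I_N) : nat := if a i is Negz k then k.+1 else 0%N.
have auw j : (a j)%:~R = (u j)%:R - (w j)%:R :> R.
  by rewrite /u /w; case: (a j) => k; rewrite ?subr0// NegzE mulrNz sub0r.
have exp_prod (x : 'I_N -> nat) :
    expR (\sum_j (x j)%:R * ln (p j)%:R) = (\prod_j p j ^ x j)%:R :> R.
  rewrite natr_prod (big_morph _ (@expRD R) (@expR0 R)); apply: eq_bigr => j _.
  by rewrite expRM_natl lnK ?natrX// posrE ltr0n prime_gt0.
have : \sum_j (u j)%:R * ln (p j)%:R = \sum_j (w j)%:R * ln (p j)%:R :> R.
  apply/subr0_eq; rewrite -sumrB -[RHS]sa; apply: eq_bigr => j _.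
  by rewrite auw mulrBl.
move=> /(congr1 expR); rewrite !exp_prod => /eqP; rewrite eqr_nat => /eqP uw.
have := congr1 (logn (p i)) uw; rewrite !logn_prod_primes// /u /w.
by case: (a i) => [k ->//|k].
Qed.

(** * Counting frequencies *)

Section FrequencyCount.
Variable R : realType.

Lemma le_holder_norm (W : normedModType R) k alpha (f : R * R -> W) p :
  strip p -> (`|f p|%:E <= holder_norm k alpha f)%E.
Proof.
move=> sp; apply: (@le_trans _ _ (sup_norm (partial 0 0 f))).
  by apply: ereal_sup_ubound; exists p.
rewrite /holder_norm -[leLHS]adde0; apply: leeD; last first.
  by apply: sume_ge0 => i _; exact: holder_seminorm_ge0.
rewrite big_ord_recl -[leLHS]adde0; apply: leeD; last first.
  by apply: sume_ge0 => i _; apply: sume_ge0 => j _; exact: sup_norm_ge0.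
rewrite big_mkcond big_ord_recl /= -[leLHS]adde0; apply: leeD => //.
by apply: sume_ge0 => j _; case: ifP => // _; exact: sup_norm_ge0.
Qed.

(** The translations that leave V unchanged at p form a group, which contains 2 pi times each unit
    vector. *)
Lemma torus_map_periodic k alpha N (V : 'rV[R]_N -> R * R -> R * R) th
    (m : 'I_N -> int) p : torus_map k alpha V -> cstrip p ->
  V (th + \row_j (2 * pi * (m j)%:~R)) p = V th p.
Proof.
move=> [Vp _ _] sp.
pose S := [set w : 'rV[R]_N | forall th, V (th + w) p = V th p].
have S0 : S 0 by move=> t; rewrite addr0.
have SD w w' : S w -> S w' -> S (w + w') by move=> Sw Sw' t; rewrite addrA Sw' Sw.
have SN w : S w -> S (- w) by move=> Sw t; rewrite -[LHS]Sw subrK.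
have Sn w (n : nat) : S w -> S (n%:R *: w).
  move=> Sw; elim: n => [|n IH]; first by rewrite scale0r.
  by rewrite -natr1 scalerDl scale1r; exact: SD.
have Sz w (a : int) : S w -> S (a%:~R *: w).
  move=> Sw; have [n [->|->]] := @intr_nat_or_opp R a; first exact: Sn.
  by rewrite scaleNr; apply/SN/Sn.
have Sd j : S ((2 * pi) *: delta_mx 0 j) by move=> t; exact: Vp.
suff : S (\row_j (2 * pi * (m j)%:~R)) by apply.
have -> : \row_j (2 * pi * (m j)%:~R) =
    \sum_j (m j)%:~R *: ((2 * pi) *: delta_mx 0 j) :> 'rV[R]_N.
  apply/rowP => i; rewrite mxE summxE (bigD1 i)//= big1 ?addr0.
    by rewrite !mxE !eqxx mulr1 mulrC.
  by move=> j ji; rewrite !mxE eqxx eq_sym (negPf ji) !mulr0.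
by elim/big_ind : _ => // j _; apply: Sz; exact: Sd.
Qed.

(* If the second component of u at p stays positive only when c t is close to
   2 pi Z, every system of frequencies of u generates c. *)
Lemma frequency_of_observable k alpha N (u : R -> R * R -> R * R)
    (V : 'rV[R]_N -> R * R -> R * R) (omega : 'rV[R]_N) p (c e : R) :
  torus_map k alpha V -> (forall t q, cstrip q -> u t q = V (t *: omega) q) ->
  strip p -> 0 < e -> e <= (u 0 p).2 ->
  (forall t, 0 < (u t p).2 -> 2^-1 <= cos (c * t)) ->
  exists m : 'I_N -> int, c = \sum_(j < N) (m j)%:~R * omega 0 j.
Proof.
move=> Vt uV sp e0 u0 uc; have [_ _ Vc] := Vt.
have sp' := strip_cstrip sp.
(* Continuity at the origin of the torus provides eta: phases within eta of 0 change the velocity at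
   p by less than e. *)
have /(Vc 0) : nbhs (0%E : \bar R) [set y | (y < e%:E)%E].
  by apply: open_nbhs_nbhs; split; [exact: open_ereal_lt_ereal|rewrite /= lte_fin].
rewrite nbhs_simpl/= => /nbhs_ballP[eta /= eta0 Heta].
apply: (@frequency_in_span R N omega c eta eta0) => t Ht; apply: uc.
have [m mP] := choice Ht.
pose th := \row_j (omega 0 j * t - 2 * pi * (m j)%:~R).
have thE : t *: omega = th + \row_j (2 * pi * (m j)%:~R).
  by apply/rowP => j; rewrite !mxE subrK mulrC.
have : ball (0 : 'rV[R]_N) eta th.
  split=> // i j; rewrite ord1 !mxE -ball_normE /ball_/= sub0r normrN; exact: mP.
move=> /Heta /= Hn.
have := le_lt_trans (le_holder_norm k alpha (V th \- V 0) sp) Hn.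
rewrite lte_fin => Hd.
have ut : u t p = V th p by rewrite uV// thE (torus_map_periodic _ _ Vt sp').
have uu0 : u 0 p = V 0 p by rewrite uV// scale0r.
have : `|(u t p).2 - (u 0 p).2| < e.
  rewrite ut uu0; apply: le_lt_trans Hd.
  by rewrite prod_normE le_max lexx orbT.
rewrite ltr_norml => /andP[]; lra.
Qed.

End FrequencyCount.

(** * Flows with a prescribed number of frequencies *)

(** One construction serves all three types: N moving vortices and one at rest, which makes the flow
    non-shear even for N = 0. *)
Lemma solutions_with_frequencies (R : realType) k (v : R -> R) (y0 eps alpha : R) :
  Ck_segment k.+2 v -> -1 < y0 < 1 ->
  \sum_(0 <= i < k.+1) `|derive1n i v y0| = 0 -> 0 < eps -> 0 < alpha < 1 ->
  forall N, exists u, [/\ nonshear_solution_near k alpha eps (shear_flow v) u,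
    quasiperiodic k alpha N u, (N = 0%N -> stationary u) &
    (N = 1%N -> time_periodic u)].
Proof.
move=> hv hy0 hvan eps0 al N.
pose b (i : 'I_N.+1) : R :=
  if unlift ord0 i is Some j then ln (growing_prime j)%:R else 0.
have [kappa [U [kappa0 Ueuler Uhol [C C0 Ulip] [Uper Upos Uobs]]]] :=
  exists_vortex_family hv hy0 hvan eps0 al b.
pose u t := U (fun i => kappa * b i * t); exists u.
pose angles (th : 'rV[R]_N) (i : 'I_N.+1) : R :=
  if unlift ord0 i is Some j then th 0 j else 0.
pose V th := U (angles th).
pose omega : 'rV[R]_N := \row_j (kappa * ln (growing_prime j)%:R).
have uV t : u t = V (t *: omega).
  rewrite /u /V; congr U; apply/funext => i; rewrite /angles /b.
  by case: unliftP => [j _|_]; rewrite ?mxE ?mulr0 ?mul0r// mulrC.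
have anglesD (th th' : 'rV[R]_N) h : (forall j, `|th 0 j - th' 0 j| <= h) -> 0 <= h ->
    forall i, `|angles th i - angles th' i| <= h.
  move=> H h0 i; rewrite /angles; case: unliftP => [j _|_]; first exact: H.
  by rewrite subrr normr0.
have Vt : torus_map k alpha V.
  split.
  - move=> th i p _; apply: Uper => a; rewrite /angles.
    case: unliftP => [j _|_]; last by exists 0; rewrite mulr0 addr0.
    exists (j == i)%:Z; rewrite !mxE eqxx /=.
    by case: (j == i); rewrite /= ?mulr1 ?mulr0.
  - by move=> th; have [h _ _] := Uhol (angles th); exact: h.
  - move=> th0.
    have FF : Filter (nbhs th0) by exact: nbhs_filter.
    apply: (@squeeze_cvge _ (nbhs th0) FF _ (fun=> 0%E) _
      (fun th => (C * `|th - th0|)%:E)).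
    + near=> th; rewrite holder_norm_ge0/=; apply: Ulip => //.
      apply: anglesD => // j.
      have -> : th 0 j - th0 0 j = (th - th0) 0 j by rewrite !mxE.
      rewrite [leRHS]/Num.Def.normr/= mx_normrE.
      exact: (le_bigmax _ (fun i => `|(th - th0) i.1 i.2|) (ord0, j)).
    + exact: cvg_cst.
    + apply: cvg_EFin; first by near=> th.
      rewrite -(mulr0 C); apply: cvgM; first exact: cvg_cst.
      rewrite -(normr0 'rV[R]_N) -(subrr th0).
      by apply: cvg_norm; apply: cvgB; [exact: cvg_id|exact: cvg_cst].
have Vind : rationally_independent omega.
  by apply: rationally_independent_ln_primes; rewrite gt_eqF.
have uq : quasiperiodic k alpha N u.
  split; first by exists V, omega; split; [exact: Vt|exact: Vind|move=> t p _; rewrite uV].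
  move=> N' NN' [V' [omega' [V't _ uV']]].
  have span (j : 'I_N) : exists m : 'I_N' -> int,
      omega 0 j = \sum_(i < N') (m i)%:~R * omega' 0 i.
    have [p [e [sp e0 pe pc]]] := Uobs (lift ord0 j).
    apply: (@frequency_of_observable R k alpha N' u V' omega' p _ e V't uV' sp e0).
    - by apply: pe; rewrite mulr0.
    - by move=> t /pc; rewrite /b liftK mxE.
  have [m mE] := choice span.
  have [q q0 [i qi]] := integer_combination_dependent NN' mE.
  by move: qi; rewrite (Vind q q0 i) eqxx.
have ust t : (N = 0%N) -> u t = u 0.
  move=> N0; rewrite !uV; congr V; apply/rowP => j; exfalso.
  by have := leq_trans (ltn_ord j) (eq_leq N0).
split.
- split.
  + exact: Ueuler.
  + move=> t [w sw]; have [p sp] := Upos (fun i => kappa * b i * t) ord0.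
    by rewrite -/(u t) (sw p (strip_cstrip sp)) ltxx.
  + by move=> t; have [_ h1 h2] := Uhol (fun i => kappa * b i * t); exact: conj h1 h2.
- exact: uq.
- by move=> N0 t s p _; rewrite !(ust _ N0).
move=> N1; split.
  (* A stationary flow would be given by a constant map on the torus of dimension 0, against the
     minimality of N = 1. *)
  move=> st; have [_ /(_ 0%N)] := uq; rewrite N1 => /(_ isT); apply.
  exists (fun=> u 0), 0; split.
  - split; first by move=> th [].
    + by move=> th; have [h _ _] := Uhol (fun i => kappa * b i * 0); exact: h.
    + move=> th0; have -> : (fun th : 'rV[R]_0 => holder_norm k alpha (u 0 \- u 0)) = fun=> 0%E.
        apply/funext => th; apply/eqP; rewrite eq_le holder_norm_ge0 andbT.
        have := Ulip (fun i => kappa * b i * 0) (fun i => kappa * b i * 0) 0 (lexx _).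
        by rewrite mulr0; apply=> i; rewrite subrr normr0.
      have FF : Filter (nbhs th0) by exact: nbhs_filter.
      exact: cvg_cst.
  - by move=> q _ [].
  - by move=> t p sp; exact: st.
have ln2 : 0 < ln 2 :> R by apply: ln_gt0; rewrite ltr1n.
(* The only moving vortex has velocity [kappa * ln 2], as the sequence of primes starts with 2. *)
exists (2 * pi / (kappa * ln 2)).
  by rewrite divr_gt0 ?mulr_gt0 ?pi_gt0.
move=> t p _; apply: Uper => i; rewrite /b; case: unliftP => [j _|_]; last first.
  by exists 0; rewrite !mulr0 !mul0r addr0.
have -> : j = 0%N :> nat by have := leq_trans (ltn_ord j) (eq_leq N1); case: (nat_of_ord j).
exists 1; rewrite /= mulr1 mulrDr; congr (_ + _).
by rewrite mulrC divfK// gt_eqF// mulr_gt0.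
Unshelve. all: by end_near. Qed.

Unset Implicit Arguments.

Theorem corollary8p1 (R : realType) (n : nat) (hn : (1 <= n)%N)
    (v : R -> R) (hv : Ck_segment n.+1 v)
    (y0 : R) (hy0 : -1 < y0 < 1)
    (hvan : \sum_(0 <= i < n) `|derive1n i v y0| = 0) (hnz : derive1n n v y0 != 0)
    (eps : R) (heps : 0 < eps) (alpha : R) (halpha : 0 < alpha < 1) :
  (exists u, nonshear_solution_near n.-1 alpha eps (shear_flow v) u /\
     stationary u) /\
  (exists u, nonshear_solution_near n.-1 alpha eps (shear_flow v) u /\
     time_periodic u) /\
  (forall N : nat,
     exists u, nonshear_solution_near n.-1 alpha eps (shear_flow v) u /\
       quasiperiodic n.-1 alpha N u).
Proof.
case: n hn hv hvan {hnz} => // k _ hv hvan.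
have H := solutions_with_frequencies hv hy0 hvan heps halpha.
split; first by have [u [uE _ us _]] := H 0%N; exists u; split=> //; exact: us.
split; first by have [u [uE _ _ up]] := H 1%N; exists u; split=> //; exact: up.
by move=> N; have [u [uE uq _ _]] := H N; exists u.
Qed.
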